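(* For all $m,n$, the special linear supergroup functor $\mathrm{SL}_{m|n}$, defined on commutative superalgebras $A$ over $\mathbb{C}$ by $$\mathrm{SL}_{m|n}(A)=\{g\in\mathrm{GL}_{m|n}(A)\mid \mathrm{Ber}(g)=1\},$$ is representable, i.e. it is an affine algebraic supergroup, and it is a complex supermanifold.
   Context: Superalgebras are unital associative $\mathbb{Z}/2$-graded $\mathbb{C}$-algebras $A=A_0\oplus A_1$, commutative in the sense $xy=(-1)^{p(x)p(y)}yx$ for homogeneous $x,y$. An affine (algebraic) supervariety $X$ is given by its coordinate superalgebra $\mathbb{C}[X]$ such that $\mathbb{C}[X]/I^{odd}$ ($I^{odd}$ the ideal generated by the odd elements) is the coordinate ring of an ordinary affine algebraic variety and $\mathbb{C}[X]_1$ is a finitely generated $\mathbb{C}[X]_0$-module; its functor of points is $A\mapsto\mathrm{Hom}(\mathbb{C}[X],A)$. It is an affine algebraic supergroup if this functor is group valued. $\mathrm{GL}_{m|n}(A)$ is the group of invertible (parity-preserving) morphisms $A^{m|n}\to A^{m|n}$, i.e. of block matrices $g=\begin{pmatrix}p&q\\ r&s\end{pmatrix}$ with $p$ ($m\times m$) and $s$ ($n\times n$) invertible with entries in $A_0$, and $q$ ($m\times n$), $r$ ($n\times m$) with entries in $A_1$. The Berezinian is $\mathrm{Ber}(g)=\det(p-qs^{-1}r)\det(s^{-1})$. $\mathbb{C}^{p|q}$ is the space $\mathbb{C}^p$ with the sheaf $\mathcal{H}_{\mathbb{C}^{p|q}}=\mathcal{H}_{\mathbb{C}^p}\otimes\Lambda(\xi_1,\dots,\xi_q)$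 ($\mathcal{H}_{\mathbb{C}^p}$ the holomorphic functions); a complex supermanifold is a superspace (a topological space with a sheaf of commutative superalgebras with local stalks) locally isomorphic to $\mathbb{C}^{p|q}$. An affine supervariety with $\mathbb{C}[X]=\mathbb{C}[x_1,\dots,x_a,\xi_1,\dots,\xi_b]/I$ ($x_i$ even, $\xi_j$ odd) ''is a complex supermanifold'' if the set $V\subset\mathbb{C}^a$ of its closed points, with the complex topology and the sheaf $(\mathcal{H}_{\mathbb{C}^{a|b}}/\mathcal{K})|_V$, $\mathcal{K}$ the ideal sheaf generated by $I$, is a complex supermanifold. *)

(* Defs.v *)
From HB Require Import structures.
From mathcomp Require Import all_boot all_order all_algebra.

Set Implicit Arguments.
Unset Strict Implicit.
Unset Printing Implicit Defensive.

Import Order.TTheory GRing.Theory Num.Theory.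
Local Open Scope ring_scope.

(* [grassmann b R] is R \otimes \Lambda(xi_0, ..., xi_{b-1}); the function
   f : {set 'I_b} -> R stands for the sum over S of f S * xi_S, where xi_S is
   the product of the xi_i, i in S, in increasing order. Thus
   xi_T * xi_U = (-1) ^+ ninv T U * xi_(T :|: U) for disjoint T, U. *)
Definition grassmann (b : nat) (R : comPzRingType) : Type :=
  {ffun {set 'I_b} -> R}.

Definition ninv (b : nat) (T U : {set 'I_b}) : nat :=
  (\sum_(i in T) \sum_(j in U) (j < i))%N.

Section Grassmann.
Variables (b : nat) (R : comPzRingType).
Local Notation G := (grassmann b R).
Implicit Types (S T U V W : {set 'I_b}).

HB.instance Definition _ := GRing.Zmodule.copy G {ffun {set 'I_b} -> R}.

Lemma gaddE (f g : G) S : (f + g) S = f S + g S.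
Proof. exact: ffunE. Qed.
Lemma goppE (f : G) S : (- f) S = - f S.
Proof. exact: ffunE. Qed.
Lemma gzeroE S : (0 : G) S = 0.
Proof. exact: ffunE. Qed.

Definition gmul (f g : G) : G := [ffun S : {set 'I_b} =>
  \sum_(T : {set 'I_b} | T \subset S)
    (-1) ^+ ninv T (S :\: T) * f T * g (S :\: T)].

Definition gconst (c : R) : G :=
  [ffun S : {set 'I_b} => if S == set0 then c else 0].

Lemma ninvUl T U V : [disjoint T & U] ->
  ninv (T :|: U) V = (ninv T V + ninv U V)%N.
Proof. by move=> dTU; rewrite /ninv (eq_bigl _ _ (fun i => in_setU i T U)) bigU. Qed.

Lemma ninvUr T U V : [disjoint U & V] ->
  ninv T (U :|: V) = (ninv T U + ninv T V)%N.
Proof.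
move=> dUV; rewrite /ninv -big_split /=; apply: eq_bigr => i _.
by rewrite (eq_bigl _ _ (fun i => in_setU i U V)) bigU.
Qed.

Lemma ninv0l T : ninv set0 T = 0%N.
Proof. by rewrite /ninv big_set0. Qed.

Lemma ninv0r T : ninv T set0 = 0%N.
Proof. by rewrite /ninv big1 // => i _; rewrite big_set0. Qed.

Lemma gmulE (f g : G) S : gmul f g S =
  \sum_(T : {set 'I_b} | T \subset S)
    (-1) ^+ ninv T (S :\: T) * f T * g (S :\: T).
Proof. exact: ffunE. Qed.

Lemma gmulA : associative gmul.
Proof.
move=> f g h; apply/ffunP => S; rewrite !gmulE.
under [RHS]eq_bigr => T TS.
  rewrite gmulE mulr_sumr mulr_suml; over.
rewrite /= (exchange_big_dep (fun U : {set 'I_b} => U \subset S)) /=; last first.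
  by move=> T U TS UT; exact: subset_trans TS.
apply: eq_bigr => U US; rewrite gmulE mulr_sumr.
rewrite [RHS](reindex_onto (fun V : {set 'I_b} => U :|: V) (fun T => T :\: U)) /=;
  last first.
  by move=> T /andP[_ UT]; rewrite setDE setUIr setUCr setIT; apply/setUidPr.
have eP V : ((U :|: V \subset S) && (U \subset U :|: V) &&
    ((U :|: V) :\: U == V)) = (V \subset S :\: U).
  rewrite subsetUl andbT subUset US /= subsetD setDUl setDv set0U.
  by congr (_ && _); apply/eqP/setDidPl.
rewrite (eq_bigl _ _ eP); apply: eq_bigr => V; rewrite subsetD => /andP[VS dVU].
have dUV : [disjoint U & V] by rewrite disjoint_sym.
have -> : (U :|: V) :\: U = V.
  by rewrite setDUl setDv set0U; apply/setDidPl.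
rewrite -setDDl; set W := (S :\: U) :\: V.
have eSU : S :\: U = V :|: W.
  rewrite /W -{1}(setID (S :\: U) V); congr (_ :|: _).
  by apply/setIidPr; rewrite subsetD VS.
have dVW : [disjoint V & W] by rewrite disjoint_sym disjoints_subset /W setDE subsetIr.
rewrite eSU (ninvUr _ dVW) (ninvUl _ dUV) !exprD !mulrA.
set x := _ ^+ ninv U W; set y := _ ^+ ninv V W; set z := _ ^+ ninv U V.
by rewrite (mulrAC _ (f U) y) (mulrC z x) (mulrAC x z y).
Qed.

Lemma gmul1l : left_id (gconst 1) gmul.
Proof.
move=> f; apply/ffunP => S; rewrite gmulE (bigD1 set0) ?sub0set //=.
rewrite ninv0l expr0 !ffunE eqxx !mul1r setD0 big1 ?addr0 // => T /andP[_ /negPf T0].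
by rewrite ffunE T0 mulr0 mul0r.
Qed.

Lemma gmul1r : right_id (gconst 1) gmul.
Proof.
move=> f; apply/ffunP => S; rewrite gmulE (bigD1 S) //=.
rewrite setDv ninv0r expr0 ffunE eqxx mul1r mulr1 big1 ?addr0 // => T /andP[TS nTS].
rewrite ffunE ifN ?mulr0 // setD_eq0; apply: contra nTS => ST.
by rewrite eqEsubset TS.
Qed.

Lemma gmulDl : left_distributive gmul +%R.
Proof.
move=> f g h; apply/ffunP => S; rewrite gaddE !gmulE -big_split /=.
by apply: eq_bigr => T _; rewrite gaddE mulrDr mulrDl.
Qed.

Lemma gmulDr : right_distributive gmul +%R.
Proof.
move=> f g h; apply/ffunP => S; rewrite gaddE !gmulE -big_split /=.
by apply: eq_bigr => T _; rewrite gaddE mulrDr.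
Qed.

HB.instance Definition _ :=
  GRing.Zmodule_isPzRing.Build G gmulA gmul1l gmul1r gmulDl gmulDr.

Lemma gmE (f g : G) : f * g = gmul f g. Proof. by []. Qed.

Lemma gconst_is_zmod_morphism : zmod_morphism gconst.
Proof.
move=> x y; apply/ffunP => S; rewrite gaddE goppE !ffunE.
by case: ifP => // _; rewrite subr0.
Qed.

Lemma gconst_mulE c (f : G) S : (gconst c * f) S = c * f S.
Proof.
rewrite gmE gmulE (bigD1 set0) ?sub0set //=.
rewrite ninv0l expr0 !ffunE eqxx mul1r setD0 big1 ?addr0 // => T /andP[_ /negPf T0].
by rewrite ffunE T0 mulr0 mul0r.
Qed.

Lemma gconst_is_monoid_morphism : monoid_morphism gconst.
Proof.
split=> // x y; apply/ffunP => S; rewrite gconst_mulE !ffunE.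
by case: ifP => // _; rewrite mulr0.
Qed.

HB.instance Definition _ :=
  GRing.isZmodMorphism.Build R G gconst gconst_is_zmod_morphism.
HB.instance Definition _ :=
  GRing.isMonoidMorphism.Build R G gconst gconst_is_monoid_morphism.

(* The image of f modulo the xi_i. *)
Definition gbody (f : G) : R := f set0.

Definition ghomog (p : bool) (f : G) : G :=
  [ffun S : {set 'I_b} => if odd #|S| == p then f S else 0].

Definition gpart (p : bool) (f : G) : Prop :=
  forall S : {set 'I_b}, odd #|S| != p -> f S = 0.

Lemma gpart_const c : gpart false (gconst c).
Proof.
move=> S; rewrite ffunE; case: ifP => [/eqP ->|_ _]; last by [].
by rewrite cards0.
Qed.

Lemma gpartB p f g : gpart p f -> gpart p g -> gpart p (f - g).
Proof. by move=> hf hg S pS; rewrite gaddE goppE hf ?hg ?subr0. Qed.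

Lemma gpartM p q f g : gpart p f -> gpart q g -> gpart (p (+) q) (f * g).
Proof.
move=> hf hg S pS; rewrite gmE gmulE big1 // => T TS.
have [pT|nT] := eqVneq (odd #|T|) p; last by rewrite hf // mulr0 mul0r.
rewrite hg ?mulr0 //; apply: contra pS => /eqP <-.
by rewrite -pT -oddD -[X in odd X == _](cardsID T S) (setIidPr TS).
Qed.

Lemma ghomogP p f : gpart p (ghomog p f).
Proof. by move=> S /negPf pS; rewrite ffunE pS. Qed.

Lemma ghomogD f : f = ghomog false f + ghomog true f.
Proof.
by apply/ffunP => S; rewrite gaddE !ffunE; case: (odd _); rewrite ?addr0 ?add0r.
Qed.

Lemma gpart_disj f : gpart false f -> gpart true f -> f = 0.
Proof.
move=> h0 h1; apply/ffunP => S; rewrite gzeroE.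
by case oS: (odd #|S|); [apply: h0|apply: h1]; rewrite oS.
Qed.

Lemma ninvC T U : [disjoint T & U] -> (ninv T U + ninv U T = #|T| * #|U|)%N.
Proof.
move=> dTU; rewrite /ninv [X in (_ + X)%N]exchange_big /= -big_split /=.
rewrite -sum1_card big_distrl /=; apply: eq_bigr => i iT.
rewrite -big_split /= mul1n -sum1_card; apply: eq_bigr => j jU.
have : (i != j :> nat).
  by apply/eqP => /val_inj eij; move/disjointFr: dTU => /(_ _ iT); rewrite eij jU.
by case: ltngtP.
Qed.

Lemma gpartC p q f g : gpart p f -> gpart q g ->
  f * g = (-1) ^+ (p && q) * (g * f).
Proof.
move=> hf hg; have -> : (-1 : G) ^+ (p && q) = gconst ((-1) ^+ (p && q)).
  by rewrite rmorphXn rmorphN1.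
apply/ffunP => S; rewrite gconst_mulE !gmE !gmulE.
rewrite [RHS]mulr_sumr [RHS](reindex_onto (fun T => S :\: T) (fun T => S :\: T)) /=;
  last by move=> T TS; rewrite setDDr setDv set0U; apply/setIidPr.
have eP T : ((S :\: T \subset S) && (S :\: (S :\: T) == T)) = (T \subset S).
  rewrite subsetDl /= setDDr setDv set0U.
  by apply/eqP/idP => [<-|/setIidPr//]; exact: subsetIl.
rewrite (eq_bigl _ _ eP); apply: eq_bigr => T TS.
have -> : S :\: (S :\: T) = T by rewrite setDDr setDv set0U; exact/setIidPr.
set U := S :\: T.
have [pT|nT] := eqVneq (odd #|T|) p; last by rewrite hf // !mulr0 mul0r.
have [qU|nU] := eqVneq (odd #|U|) q; last by rewrite hg // !mulr0 mul0r mulr0.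
have dTU : [disjoint T & U].
  by rewrite disjoint_sym disjoints_subset /U setDE subsetIr.
rewrite -pT -qU -oddM signr_odd -(ninvC dTU) exprD -!mulrA; congr (_ * _).
by rewrite !mulrA -exprD addnn -muln2 exprM sqrr_sign mul1r mulrC.
Qed.

End Grassmann.

Section GrassmannMap.
Variables (b : nat) (R S : comPzRingType) (h : {rmorphism R -> S}).

Definition gmap (f : grassmann b R) : grassmann b S :=
  [ffun T : {set 'I_b} => h (f T)].

Lemma gmap_is_zmod_morphism : zmod_morphism gmap.
Proof.
by move=> f g; apply/ffunP => T; rewrite gaddE goppE !ffunE rmorphB.
Qed.

Lemma gmap_const c : gmap (gconst b c) = gconst b (h c).
Proof. by apply/ffunP => T; rewrite !ffunE; case: ifP => // _; rewrite rmorph0. Qed.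

Lemma gmap_is_monoid_morphism : monoid_morphism gmap.
Proof.
split=> [|f g]; first by rewrite [1]/(gconst b 1) gmap_const rmorph1.
apply/ffunP => T; rewrite ffunE !gmE !gmulE rmorph_sum; apply: eq_bigr => U _.
by rewrite !rmorphM rmorphXn rmorphN1 !ffunE.
Qed.

HB.instance Definition _ :=
  GRing.isZmodMorphism.Build _ _ gmap gmap_is_zmod_morphism.
HB.instance Definition _ :=
  GRing.isMonoidMorphism.Build _ _ gmap gmap_is_monoid_morphism.

Lemma gmap_part p f : gpart p f -> gpart p (gmap f).
Proof. by move=> hf T pT; rewrite ffunE hf ?rmorph0. Qed.

End GrassmannMap.
From mathcomp Require Import all_classical all_reals all_analysis.
From mathcomp Require Import complex.
(* Only the canonical structures of multinomials are imported: its notations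
   clash with those of MathComp-Analysis. *)
From mathcomp Require Import (canonicals) mpoly.
Import numFieldNormedType.Exports.

Local Open Scope classical_set_scope.
Local Open Scope ring_scope.

(* Everything is developed over a numFieldType K, whose norm provides the
   topology and the notion of differentiability; the theorem is about the
   complex numbers K = R[i]. *)

(* [superalgebra K] is the type of Z/2-graded, supercommutative K-algebras.
   The ring may be the zero ring (sections of a sheaf over the empty set),
   hence pzRingType. [spart false] is the even part, [spart true] the odd one;
   the structure map [sscal] is automatically central, since its values are
   even. *)
Record superalgebra (K : numFieldType) := Superalgebra {
  sring :> pzRingType ;
  sscal : {rmorphism K -> sring} ;
  spart : bool -> set sring ;
  sscal_even : forall c, spart false (sscal c) ;
  spartB : forall p x y, spart p x -> spart p y -> spart p (x - y) ;
  spartM : forall p q x y, spart p x -> spart q y -> spart (p (+) q) (x * y) ;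
  spart_dec : forall x,
    exists x0 x1, [/\ spart false x0, spart true x1 & x = x0 + x1] ;
  spart_disj : forall x, spart false x -> spart true x -> x = 0 ;
  spartC : forall p q x y, spart p x -> spart q y ->
    x * y = (-1) ^+ (p && q) * (y * x) }.

Arguments sscal {K} s.
Arguments spart {K} s p.

Record smor (K : numFieldType) (A B : superalgebra K) := SMor {
  smor_fun :> {rmorphism A -> B} ;
  smor_scal : forall c, smor_fun (sscal A c) = sscal B c ;
  smor_part : forall p x, spart A p x -> spart B p (smor_fun x) }.

Section SuperalgebraTheory.
Variable K : numFieldType.
Implicit Types A B D : superalgebra K.

Lemma smor_ext A B (f g : smor A B) : f =1 g -> f = g.
Proof.
case: f g => [f fs fp] [g gs gp] /= fg.
have efg : f = g.
  have e : (f : A -> B) = g by apply/funext.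
  case: f g {fs fp gs gp fg} e => [f [[fa] [fm]]] [g [[ga] [gm]]] /= e.
  case: _ / e ga gm => ga gm.
  have -> : fa = ga by case: fa ga => ? ? [? ?]; congr (_, _); exact: Prop_irrelevance.
  have -> // : fm = gm.
  by case: fm gm => ? ? [? ?]; congr (_, _); exact: Prop_irrelevance.
subst g; congr SMor; exact: Prop_irrelevance.
Qed.

Lemma spart0 A p : spart A p 0.
Proof.
have [x0 [x1 [h0 h1 _]]] := spart_dec (0 : A).
by case: p; [rewrite -(subrr x1)|rewrite -(subrr x0)]; exact: spartB.
Qed.

Lemma spart1 A : spart A false 1.
Proof. by rewrite -(rmorph1 (sscal A)); exact: sscal_even. Qed.

Lemma spartN A p x : spart A p x -> spart A p (- x).
Proof. by move=> h; rewrite -sub0r; apply: spartB => //; exact: spart0. Qed.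

Lemma spartD A p x y : spart A p x -> spart A p y -> spart A p (x + y).
Proof. by move=> hx hy; rewrite -[y]opprK; apply: spartB => //; exact: spartN. Qed.

Lemma smor_id_scal A c : (idfun : {rmorphism A -> A}) (sscal A c) = sscal A c.
Proof. by []. Qed.
Lemma smor_id_part A p x :
  spart A p x -> spart A p ((idfun : {rmorphism A -> A}) x).
Proof. by []. Qed.
Definition smor_id A : smor A A := SMor (@smor_id_scal A) (@smor_id_part A).

Lemma smor_comp_scal A B D (g : smor B D) (f : smor A B) c :
  (g \o f : {rmorphism A -> D}) (sscal A c) = sscal D c.
Proof. by rewrite /= !smor_scal. Qed.
Lemma smor_comp_part A B D (g : smor B D) (f : smor A B) p x :
  spart A p x -> spart D p ((g \o f : {rmorphism A -> D}) x).
Proof. by move=> h; do 2! apply: smor_part. Qed.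
Definition smor_comp A B D (g : smor B D) (f : smor A B) : smor A D :=
  SMor (smor_comp_scal g f) (@smor_comp_part _ _ _ g f).

End SuperalgebraTheory.

Definition ring_ideal (A : pzRingType) (J : set A) : Prop :=
  [/\ J 0, forall x y, J x -> J y -> J (x + y)
    & forall a x, J x -> J (a * x) /\ J (x * a)].

Definition ideal_gen (A : pzRingType) (S : set A) : set A :=
  smallest (@ring_ideal A) S.

Definition homogeneous (K : numFieldType) (A : superalgebra K) (J : set A) :=
  forall x, J x -> exists x0 x1,
    [/\ spart A false x0, spart A true x1, x = x0 + x1, J x0 & J x1].

Record calg (K : numFieldType) := CAlg {
  cring :> comPzRingType ;
  cscal : {rmorphism K -> cring} }.


Record cmor (K : numFieldType) (R S : calg K) := CMor {
  cmor_fun :> {rmorphism R -> S} ;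
  cmor_scal : forall c, cmor_fun (cscal R c) = cscal S c }.

Section GrassmannSuperalgebra.
Variables (K : numFieldType) (b : nat).

Lemma gsa_scal_even (R : calg K) c :
  @gpart b R false ((@gconst b R \o cscal R : {rmorphism K -> grassmann b R}) c).
Proof. exact: gpart_const. Qed.

Lemma gsa_dec (R : calg K) (f : grassmann b R) :
  exists f0 f1, [/\ gpart false f0, gpart true f1 & f = f0 + f1].
Proof.
by exists (ghomog false f), (ghomog true f); split; [exact: ghomogP|exact: ghomogP|exact: ghomogD].
Qed.

Definition grassmann_sa (R : calg K) : superalgebra K :=
  @Superalgebra K (grassmann b R) (@gconst b R \o cscal R) (@gpart b R)
    (@gsa_scal_even R) (@gpartB b R) (@gpartM b R) (@gsa_dec R)
    (@gpart_disj b R) (@gpartC b R).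

Lemma gsa_map_scal (R S : calg K) (h : cmor R S) c :
  (gmap h : {rmorphism grassmann b R -> grassmann b S}) (sscal (grassmann_sa R) c) =
  sscal (grassmann_sa S) c.
Proof. by rewrite /= gmap_const cmor_scal. Qed.

Definition grassmann_map (R S : calg K) (h : cmor R S) :
    smor (grassmann_sa R) (grassmann_sa S) :=
  @SMor K (grassmann_sa R) (grassmann_sa S)
    (gmap h : {rmorphism grassmann b R -> grassmann b S})
    (gsa_map_scal h) (@gmap_part b R S h).

End GrassmannSuperalgebra.

Definition poly_calg (K : numFieldType) (a : nat) : calg K :=
  @CAlg K (mpoly.mpoly a K) (@mpoly.mpolyC a K).

Definition poly_superalgebra (K : numFieldType) (a b : nat) : superalgebra K :=
  grassmann_sa b (poly_calg K a).

Definition mpeval (K : numFieldType) (a : nat) (f : mpoly.mpoly a K)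
  (x : 'rV[K]_a) : K := mpoly.meval (fun i => x 0 i) f.

Record opens (T : topologicalType) := Opens {
  oset : set T ;
  oopen : open oset }.

Lemma opens_ext (T : topologicalType) (U V : opens T) : oset U = oset V -> U = V.
Proof.
by case: U V => [U oU] [V oV] /= e; subst V; congr Opens; exact: Prop_irrelevance.
Qed.

Definition opensT (T : topologicalType) : opens T := Opens openT.
Definition opensI (T : topologicalType) (U V : opens T) : opens T :=
  Opens (openI (oopen U) (oopen V)).
Definition opens_pre (S T : topologicalType) (f : S -> T) (cf : continuous f)
    (U : opens T) : opens S :=
  Opens (proj1 (continuousP f) cf _ (oopen U)).

Notation "U <=o V" := (oset U `<=` oset V) (at level 70, no associativity).

Record presheaf (K : numFieldType) (T : topologicalType) := Presheaf {
  psec :> opens T -> superalgebra K ;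
  pres : forall U V : opens T, V <=o U -> smor (psec U) (psec V) ;
  pres_id : forall U (h : U <=o U) s, pres h s = s ;
  pres_comp : forall U V W (h : V <=o U) (k : W <=o V) (l : W <=o U) s,
    pres k (pres h s) = pres l s }.

Arguments pres {K T} p {U V} h.

Definition subo_Il (T : topologicalType) (U V : opens T) : opensI U V <=o U :=
  @subIsetl _ (oset U) (oset V).
Definition subo_Ir (T : topologicalType) (U V : opens T) : opensI U V <=o V :=
  @subIsetr _ (oset U) (oset V).

Arguments subo_Il {T} U V.
Arguments subo_Ir {T} U V.

Definition is_sheaf (K : numFieldType) (T : topologicalType)
    (P : presheaf K T) : Prop :=
  forall (I : Type) (U : I -> opens T) (V : opens T) (UV : forall i, U i <=o V),
    oset V = \bigcup_i oset (U i) ->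
  forall s : forall i, P (U i),
    (forall i j, pres P (subo_Il (U i) (U j)) (s i) =
                 pres P (subo_Ir (U i) (U j)) (s j)) ->
  exists! t : P V, forall i, pres P (UV i) t = s i.

Record ideal_presheaf (K : numFieldType) (T : topologicalType)
    (P : presheaf K T) := IdealPresheaf {
  jsec :> forall U : opens T, set (P U) ;
  jsec_ideal : forall U, ring_ideal (@jsec U) ;
  jsec_homog : forall U, homogeneous (@jsec U) ;
  jsec_res : forall U V (h : V <=o U) s, @jsec U s -> @jsec V (pres P h s) }.

Arguments jsec {K T P} i U _.

Section RingIdeal.
Variables (A : pzRingType) (J : set A).
Hypothesis JI : ring_ideal J.
Lemma ideal0 : J 0. Proof. by case: JI. Qed.
Lemma idealD x y : J x -> J y -> J (x + y). Proof. by case: JI => _ + _; apply. Qed.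
Lemma idealMl a x : J x -> J (a * x). Proof. by case: JI => _ _ /(_ a x) + /[dup] => /[apply] -[]. Qed.
Lemma idealMr a x : J x -> J (x * a). Proof. by case: JI => _ _ /(_ a x) + /[dup] => /[apply] -[]. Qed.
Lemma idealN x : J x -> J (- x). Proof. by rewrite -mulN1r; exact: idealMl. Qed.
Lemma idealB x y : J x -> J y -> J (x - y).
Proof. by move=> hx hy; apply: idealD => //; exact: idealN. Qed.
End RingIdeal.

Section Germ.
Variables (K : numFieldType) (T : topologicalType) (P : presheaf K T).
Variables (J : ideal_presheaf P) (x : T).

Record germ_rep := GermRep {
  gdom : opens T ;
  gmem : oset gdom x ;
  gsec : P gdom }.

(* The type germ below is the stalk at x of the quotient of P by J: germs of
   sections of P at x, modulo germs of sections of J. *)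
Definition germ_eq (s t : germ_rep) : Prop :=
  exists (W : opens T) (hs : W <=o gdom s) (ht : W <=o gdom t),
    oset W x /\ J W (pres P hs (gsec s) - pres P ht (gsec t)).

Definition germ : Type :=
  {C : set germ_rep | exists s, C = [set t | germ_eq s t]}.

Definition germ_of_rep (s : germ_rep) : germ :=
  exist _ [set t | germ_eq s t] (ex_intro _ s erefl).

Definition germ_of (U : opens T) (Ux : oset U x) (s : P U) : germ :=
  germ_of_rep (GermRep Ux s).

HB.instance Definition _ := gen_eqMixin germ.
HB.instance Definition _ := gen_choiceMixin germ.

Lemma germ_eq_refl s : germ_eq s s.
Proof.
exists (gdom s), (@subset_refl _ _), (@subset_refl _ _); split; first exact: gmem.
by rewrite subrr; apply: ideal0; exact: (jsec_ideal J).
Qed.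

Lemma germ_eq_sym s t : germ_eq s t -> germ_eq t s.
Proof.
move=> [W [hs [ht [Wx Jst]]]]; exists W, ht, hs; split=> //.
by rewrite -opprB; apply: idealN => //; exact: (jsec_ideal J).
Qed.

Lemma germ_eq_trans s t u : germ_eq s t -> germ_eq t u -> germ_eq s u.
Proof.
move=> [W [hs [ht [Wx Jst]]]] [W' [ht' [hu [Wx' Jtu]]]].
have hs2 := subset_trans (@subo_Il _ W W') hs.
have hu2 := subset_trans (@subo_Ir _ W W') hu.
have ht2 := subset_trans (@subo_Il _ W W') ht.
exists (opensI W W'), hs2, hu2; split=> //.
have := idealD (jsec_ideal _ _) (jsec_res (@subo_Il _ W W') Jst)
  (jsec_res (@subo_Ir _ W W') Jtu).
rewrite !rmorphB /= (pres_comp _ _ hs2) !(pres_comp _ _ ht2) (pres_comp _ _ hu2).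
by rewrite addrA subrK.
Qed.

Lemma germ_of_repP s t : germ_of_rep s = germ_of_rep t <-> germ_eq s t.
Proof.
split=> [[] e|est].
  have : [set u | germ_eq s u] t by rewrite e; exact: germ_eq_refl.
  by [].
apply: eq_exist => /=; apply/seteqP; split=> u /=.
  by apply: germ_eq_trans; exact: germ_eq_sym.
exact: germ_eq_trans.
Qed.

Definition grepr (g : germ) : germ_rep := projT1 (cid (proj2_sig g)).

Lemma greprK g : germ_of_rep (grepr g) = g.
Proof.
rewrite /grepr; case: cid => s /= es.
by case: g es => C HC /= es; apply: eq_exist.
Qed.

Lemma germ_res (U V : opens T) (Ux : oset U x) (Vx : oset V x) (h : V <=o U) s :
  germ_of Vx (pres P h s) = germ_of Ux s.
Proof.
apply/germ_of_repP; exists V, (@subset_refl _ _), h; split=> //=.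
by rewrite pres_id subrr; apply: ideal0; exact: (jsec_ideal J).
Qed.

Lemma germ_eqJ (U : opens T) (Ux : oset U x) s t :
  J U (s - t) -> germ_of Ux s = germ_of Ux t.
Proof.
move=> Jst; apply/germ_of_repP; exists U, (@subset_refl _ _), (@subset_refl _ _).
by split=> //=; rewrite !pres_id.
Qed.

Lemma germW (g : germ) : exists (U : opens T) (Ux : oset U x) s, g = germ_of Ux s.
Proof. by rewrite -(greprK g); case: (grepr g) => U Ux s; exists U, Ux, s. Qed.

Lemma germ2W (g h : germ) : exists (U : opens T) (Ux : oset U x) s t,
  g = germ_of Ux s /\ h = germ_of Ux t.
Proof.
have [U [Ux [s ->]]] := germW g; have [V [Vx [t ->]]] := germW h.
have Ix : oset (opensI U V) x by split.
exists (opensI U V), Ix, (pres P (@subo_Il _ U V) s), (pres P (@subo_Ir _ U V) t).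
by rewrite !germ_res.
Qed.

Lemma germ3W (g h k : germ) : exists (U : opens T) (Ux : oset U x) s t u,
  [/\ g = germ_of Ux s, h = germ_of Ux t & k = germ_of Ux u].
Proof.
have [U [Ux [s [t [-> ->]]]]] := germ2W g h; have [V [Vx [u ->]]] := germW k.
have Ix : oset (opensI U V) x by split.
exists (opensI U V), Ix, (pres P (@subo_Il _ U V) s), (pres P (@subo_Il _ U V) t).
by exists (pres P (@subo_Ir _ U V) u); rewrite !germ_res.
Qed.

Definition germ_op2 (op : forall A : superalgebra K, A -> A -> A) (g h : germ) : germ :=
  let s := grepr g in let t := grepr h in
  @germ_of (opensI (gdom s) (gdom t)) (conj (gmem s) (gmem t))
    (op _ (pres P (@subo_Il _ _ _) (gsec s)) (pres P (@subo_Ir _ _ _) (gsec t))).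

Definition germ_add := germ_op2 (fun A => +%R).
Definition germ_mul := germ_op2 (fun A => *%R).
Definition germ_opp (g : germ) : germ := germ_of (gmem (grepr g)) (- gsec (grepr g)).
Definition germ_scal (c : K) : germ :=
  @germ_of (opensT T) Logic.I (sscal (P (opensT T)) c).

Lemma germ_op2E (op : forall A : superalgebra K, A -> A -> A) :
  (forall (A B : superalgebra K) (f : smor A B) a b, f (op A a b) = op B (f a) (f b)) ->
  (forall U (a a' b b' : P U), J U (a - a') -> J U (b - b') ->
     J U (op _ a b - op _ a' b')) ->
  forall (U : opens T) (Ux : oset U x) s t,
  germ_op2 op (germ_of Ux s) (germ_of Ux t) = germ_of Ux (op _ s t).
Proof.
move=> opM opJ U Ux s t; rewrite /germ_op2.
have := greprK (germ_of Ux s); have := greprK (germ_of Ux t).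
move: (grepr (germ_of Ux s)) (grepr (germ_of Ux t)) => [V Vx s'] [W Wx t'] /=.
move=> /germ_of_repP[/= M [hM [hM' [Mx JM]]]] /germ_of_repP[/= N [hN [hN' [Nx JN]]]].
apply/germ_of_repP => /=.
have hV := subset_trans (@subo_Ir _ M N) hN.
have hW := subset_trans (@subo_Il _ M N) hM.
have hU := subset_trans (@subo_Il _ M N) hM'.
have hVW : opensI M N <=o opensI V W by move=> y hy; split; [exact: hV|exact: hW].
exists (opensI M N), hVW, hU; split; first by split.
rewrite !opM (pres_comp _ _ hV) (pres_comp _ _ hW); apply: opJ.
  have := jsec_res (@subo_Ir _ M N) JN.
  by rewrite rmorphB /= (pres_comp _ _ hV) (pres_comp _ _ hU).
have := jsec_res (@subo_Il _ M N) JM.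
by rewrite rmorphB /= (pres_comp _ _ hW) (pres_comp _ _ hU).
Qed.

Lemma germ_addE (U : opens T) (Ux : oset U x) s t :
  germ_add (germ_of Ux s) (germ_of Ux t) = germ_of Ux (s + t).
Proof.
apply: (germ_op2E (op := fun A => +%R)) => [A B f u v|{Ux s t}U a a' b b' ha hb].
  by rewrite rmorphD.
by rewrite opprD addrACA; apply: idealD => //; exact: (jsec_ideal J).
Qed.

Lemma germ_mulE (U : opens T) (Ux : oset U x) s t :
  germ_mul (germ_of Ux s) (germ_of Ux t) = germ_of Ux (s * t).
Proof.
apply: (germ_op2E (op := fun A => *%R)) => [A B f u v|{Ux s t}U a a' b b' ha hb].
  by rewrite rmorphM.
have JU := jsec_ideal J U.
have -> : a * b - a' * b' = (a - a') * b + a' * (b - b').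
  by rewrite mulrBl mulrBr addrA subrK.
by apply: idealD => //; [exact: idealMr|exact: idealMl].
Qed.

Lemma germ_oppE (U : opens T) (Ux : oset U x) s :
  germ_opp (germ_of Ux s) = germ_of Ux (- s).
Proof.
rewrite /germ_opp; have := greprK (germ_of Ux s).
move: (grepr (germ_of Ux s)) => [V Vx s'] /= /germ_of_repP[/= M [hM [hM' [Mx JM]]]].
apply/germ_of_repP; exists M, hM, hM'; split=> //=.
by rewrite !rmorphN -opprD; apply: idealN => //; exact: (jsec_ideal J).
Qed.

Lemma germ_scalE c (U : opens T) (Ux : oset U x) :
  germ_scal c = germ_of Ux (sscal (P U) c).
Proof.
have h : U <=o opensT T by [].
by rewrite /germ_scal -(germ_res _ Ux h) smor_scal.
Qed.

Lemma germ_addA : associative germ_add.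
Proof.
move=> g h k; have [U [Ux [s [t [u [-> -> ->]]]]]] := germ3W g h k.
by rewrite !germ_addE addrA.
Qed.
Lemma germ_addC : commutative germ_add.
Proof.
move=> g h; have [U [Ux [s [t [-> ->]]]]] := germ2W g h.
by rewrite !germ_addE addrC.
Qed.
Lemma germ_add0 : left_id (germ_scal 0) germ_add.
Proof.
move=> g; have [U [Ux [s ->]]] := germW g.
by rewrite (germ_scalE 0 Ux) germ_addE rmorph0 add0r.
Qed.
Lemma germ_addN : left_inverse (germ_scal 0) germ_opp germ_add.
Proof.
move=> g; have [U [Ux [s ->]]] := germW g.
by rewrite (germ_scalE 0 Ux) germ_oppE germ_addE rmorph0 addNr.
Qed.
Lemma germ_mulA : associative germ_mul.
Proof.
move=> g h k; have [U [Ux [s [t [u [-> -> ->]]]]]] := germ3W g h k.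
by rewrite !germ_mulE mulrA.
Qed.
Lemma germ_mul1l : left_id (germ_scal 1) germ_mul.
Proof.
move=> g; have [U [Ux [s ->]]] := germW g.
by rewrite (germ_scalE 1 Ux) germ_mulE rmorph1 mul1r.
Qed.
Lemma germ_mul1r : right_id (germ_scal 1) germ_mul.
Proof.
move=> g; have [U [Ux [s ->]]] := germW g.
by rewrite (germ_scalE 1 Ux) germ_mulE rmorph1 mulr1.
Qed.
Lemma germ_mulDl : left_distributive germ_mul germ_add.
Proof.
move=> g h k; have [U [Ux [s [t [u [-> -> ->]]]]]] := germ3W g h k.
by rewrite !(germ_addE, germ_mulE) mulrDl.
Qed.
Lemma germ_mulDr : right_distributive germ_mul germ_add.
Proof.
move=> g h k; have [U [Ux [s [t [u [-> -> ->]]]]]] := germ3W g h k.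
by rewrite !(germ_addE, germ_mulE) mulrDr.
Qed.

HB.instance Definition _ :=
  GRing.isPzRing.Build germ germ_addA germ_addC germ_add0 germ_addN
    germ_mulA germ_mul1l germ_mul1r germ_mulDl germ_mulDr.

Lemma germ_of0 (U : opens T) (Ux : oset U x) : germ_of Ux 0 = 0.
Proof. by rewrite [RHS](germ_scalE 0 Ux) rmorph0. Qed.
Lemma germ_of1 (U : opens T) (Ux : oset U x) : germ_of Ux 1 = 1.
Proof. by rewrite [RHS](germ_scalE 1 Ux) rmorph1. Qed.
Lemma germ_ofD (U : opens T) (Ux : oset U x) s t :
  germ_of Ux (s + t) = germ_of Ux s + germ_of Ux t.
Proof. by rewrite -germ_addE. Qed.
Lemma germ_ofN (U : opens T) (Ux : oset U x) s : germ_of Ux (- s) = - germ_of Ux s.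
Proof. by rewrite -germ_oppE. Qed.
Lemma germ_ofB (U : opens T) (Ux : oset U x) s t :
  germ_of Ux (s - t) = germ_of Ux s - germ_of Ux t.
Proof. by rewrite germ_ofD germ_ofN. Qed.
Lemma germ_ofM (U : opens T) (Ux : oset U x) s t :
  germ_of Ux (s * t) = germ_of Ux s * germ_of Ux t.
Proof. by rewrite -germ_mulE. Qed.
Lemma germ_of_scal (U : opens T) (Ux : oset U x) c :
  germ_of Ux (sscal (P U) c) = germ_scal c.
Proof. by rewrite (germ_scalE c Ux). Qed.

Lemma germ_scal_is_zmod_morphism : zmod_morphism germ_scal.
Proof. by move=> a b; rewrite {1}/germ_scal rmorphB germ_ofB. Qed.
Lemma germ_scal_is_monoid_morphism : monoid_morphism germ_scal.
Proof. by split=> [//|a b]; rewrite {1}/germ_scal rmorphM germ_ofM. Qed.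
Definition germ_scal_rmorphism : {rmorphism K -> germ} :=
  HB.pack germ_scal
    (GRing.isZmodMorphism.Build K germ germ_scal germ_scal_is_zmod_morphism)
    (GRing.isMonoidMorphism.Build K germ germ_scal germ_scal_is_monoid_morphism).

Definition germ_part (p : bool) (g : germ) : Prop :=
  exists (U : opens T) (Ux : oset U x) s, spart (P U) p s /\ g = germ_of Ux s.

Lemma germ_part2 p q g h : germ_part p g -> germ_part q h ->
  exists (U : opens T) (Ux : oset U x) s t,
    [/\ spart (P U) p s, spart (P U) q t, g = germ_of Ux s & h = germ_of Ux t].
Proof.
move=> [U [Ux [s [ps ->]]]] [V [Vx [t [qt ->]]]].
have Ix : oset (opensI U V) x by split.
exists (opensI U V), Ix, (pres P (@subo_Il _ U V) s), (pres P (@subo_Ir _ U V) t).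
by rewrite !germ_res; split=> //; exact: smor_part.
Qed.

Lemma germ_scal_even c : germ_part false (germ_scal c).
Proof. by exists (opensT T), Logic.I, (sscal _ c); split=> //; exact: sscal_even. Qed.

Lemma germ_partB p g h : germ_part p g -> germ_part p h -> germ_part p (g - h).
Proof.
move=> pg ph; have [U [Ux [s [t [ps pt -> ->]]]]] := germ_part2 pg ph.
by exists U, Ux, (s - t); rewrite germ_ofB; split=> //; exact: spartB.
Qed.

Lemma germ_partM p q g h :
  germ_part p g -> germ_part q h -> germ_part (p (+) q) (g * h).
Proof.
move=> pg ph; have [U [Ux [s [t [ps pt -> ->]]]]] := germ_part2 pg ph.
by exists U, Ux, (s * t); rewrite germ_ofM; split=> //; exact: spartM.
Qed.

Lemma germ_part_dec g : exists g0 g1,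
  [/\ germ_part false g0, germ_part true g1 & g = g0 + g1].
Proof.
have [U [Ux [s ->]]] := germW g; have [s0 [s1 [h0 h1 ->]]] := spart_dec s.
exists (germ_of Ux s0), (germ_of Ux s1); rewrite germ_ofD.
by split=> //; [exists U, Ux, s0|exists U, Ux, s1].
Qed.

Lemma homog_disj (A : superalgebra K) (I : set A) s t :
  ring_ideal I -> homogeneous I ->
  spart A false s -> spart A true t -> I (s - t) -> I s.
Proof.
move=> II hI hs ht /hI[u0 [u1 [h0 h1 e I0 I1]]].
suff -> : s = u0 by [].
have e' : s - u0 = t + u1.
  by apply/eqP; rewrite subr_eq -addrA (addrC u1) -e addrCA subrr addr0.
apply/eqP; rewrite -subr_eq0; apply/eqP; apply: spart_disj.
  exact: spartB.
by rewrite e'; exact: spartD.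
Qed.

Lemma germ_part_disj g : germ_part false g -> germ_part true g -> g = 0.
Proof.
move=> h0 h1; have [U [Ux [s [t [ps pt e e']]]]] := germ_part2 h0 h1.
have /germ_of_repP[/= W [hs [ht [Wx JW]]]] : germ_of Ux s = germ_of Ux t by rewrite -e.
rewrite e -(germ_res Ux Wx hs) -(germ_of0 Wx); apply: germ_eqJ; rewrite subr0.
apply: homog_disj JW; [exact: (jsec_ideal J)|exact: jsec_homog|exact: smor_part|].
exact: smor_part.
Qed.

Lemma germ_partC p q g h : germ_part p g -> germ_part q h ->
  g * h = (-1) ^+ (p && q) * (h * g).
Proof.
move=> pg ph; have [U [Ux [s [t [ps pt -> ->]]]]] := germ_part2 pg ph.
rewrite -!germ_ofM (spartC ps pt).
by case: (p && q); rewrite ?expr0 ?mul1r // expr1 !mulN1r germ_ofN.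
Qed.

Definition stalk_mod : superalgebra K :=
  @Superalgebra K germ germ_scal_rmorphism germ_part germ_scal_even germ_partB germ_partM
    germ_part_dec germ_part_disj germ_partC.

End Germ.

Lemma ideal_gen_ideal (A : pzRingType) (S : set A) : ring_ideal (ideal_gen S).
Proof.
split=> [J [[J0 _ _] _]//|x y hx hy J JS|a x hx].
  by case: (JS) => -[_ JD _] _; apply: JD; [exact: hx|exact: hy].
by split=> J JS; case: (JS) => -[_ _ JM] _; have [] := JM a x (hx _ JS).
Qed.

Lemma ideal_gen_sub (A : pzRingType) (S : set A) : S `<=` ideal_gen S.
Proof. exact: sub_smallest. Qed.

Lemma ideal_gen_min (A : pzRingType) (S J : set A) :
  ring_ideal J -> S `<=` J -> ideal_gen S `<=` J.
Proof. by move=> JI SJ; exact: smallest_sub. Qed.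

Lemma ideal_gen_homog (K : numFieldType) (A : superalgebra K) (S : set A) :
  homogeneous S -> homogeneous (ideal_gen S).
Proof.
move=> hS; pose J : set A := [set x | exists x0 x1,
  [/\ spart A false x0, spart A true x1, x = x0 + x1,
      ideal_gen S x0 & ideal_gen S x1]].
have GI := ideal_gen_ideal S.
suff JI : ring_ideal J.
  have /(_ _)/= := ideal_gen_min JI; apply => x /hS[x0 [x1 [h0 h1 e S0 S1]]].
  by exists x0, x1; split=> //; exact: ideal_gen_sub.
split.
- by exists 0, 0; rewrite addr0; split=> //; (exact: spart0 || exact: (ideal0 GI)).
- move=> x y [x0 [x1 [px0 px1 -> Ix0 Ix1]]] [y0 [y1 [py0 py1 -> Iy0 Iy1]]].
  exists (x0 + y0), (x1 + y1); rewrite addrACA.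
  by split=> //; [exact: spartD|exact: spartD|exact: (idealD GI)|exact: (idealD GI)].
- move=> a x [x0 [x1 [px0 px1 -> Ix0 Ix1]]].
  have [a0 [a1 [pa0 pa1 ->]]] := spart_dec a.
  split.
    exists (a0 * x0 + a1 * x1), (a0 * x1 + a1 * x0); split.
    + by apply: spartD; [exact: (spartM pa0 px0)|exact: (spartM pa1 px1)].
    + by apply: spartD; [exact: (spartM pa0 px1)|exact: (spartM pa1 px0)].
    + by rewrite mulrDl !mulrDr [a1 * x0 + _]addrC addrACA.
    + by apply: (idealD GI) => //; exact: (idealMl GI).
    + by apply: (idealD GI) => //; exact: (idealMl GI).
  exists (x0 * a0 + x1 * a1), (x0 * a1 + x1 * a0); split.
  + by apply: spartD; [exact: (spartM px0 pa0)|exact: (spartM px1 pa1)].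
  + by apply: spartD; [exact: (spartM px0 pa1)|exact: (spartM px1 pa0)].
  + by rewrite mulrDl !mulrDr [x1 * a0 + _]addrC addrACA.
  + by apply: (idealD GI) => //; exact: (idealMr GI).
  + by apply: (idealD GI) => //; exact: (idealMr GI).
Qed.

Lemma ideal0_ideal (A : pzRingType) : ring_ideal [set 0 : A].
Proof.
split=> [//|x y -> ->|a x ->]; first by rewrite /= addr0.
by rewrite /= mulr0 mul0r.
Qed.

Lemma ideal0_homog (K : numFieldType) (A : superalgebra K) :
  homogeneous [set 0 : A].
Proof. by move=> x ->; exists 0, 0; split; rewrite ?addr0 //; exact: spart0. Qed.

Definition ideal_presheaf0 (K : numFieldType) (T : topologicalType)
    (P : presheaf K T) : ideal_presheaf P.
Proof.
apply: (@IdealPresheaf K T P (fun U => [set 0])) => [U|U|U V h s ->].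
- exact: ideal0_ideal.
- exact: ideal0_homog.
- by rewrite /= rmorph0.
Defined.

Definition stalk (K : numFieldType) (T : topologicalType) (P : presheaf K T)
  (x : T) : superalgebra K := stalk_mod (ideal_presheaf0 P) x.

Section QuotientSheaf.
Variables (K : numFieldType) (T : topologicalType) (P : presheaf K T).
Variables (J : ideal_presheaf P) (V : set T).

(* A section over W of the restriction to V of the sheaf associated with P / J:
   a family of elements of the stalks of P / J at the points of W that is
   locally induced by sections of P over open subsets of T. *)
Record quot_section (W : opens V) := QuotSection {
  qval : forall w : V, oset W w -> germ J (set_val w) ;
  qval_loc : forall v : V, oset W v ->
    exists (U : opens T) (f : P U), oset U (set_val v) /\
      forall (w : V) (Ww : oset W w) (Uw : oset U (set_val w)),
        qval Ww = germ_of J Uw f }.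

Section Sections.
Variable W : opens V.
Local Notation Q := (quot_section W).

Lemma quot_section_ext (s t : Q) :
  (forall w (Ww : oset W w), qval s Ww = qval t Ww) -> s = t.
Proof.
case: s t => [s ls] [t lt] /= st.
have est : s = t.
  by apply: functional_extensionality_dep => w;
     apply: functional_extensionality_dep => Ww.
by subst t; congr QuotSection; exact: Prop_irrelevance.
Qed.

HB.instance Definition _ := gen_eqMixin Q.
HB.instance Definition _ := gen_choiceMixin Q.

Lemma qscal_loc (c : K) : forall v : V, oset W v ->
  exists (U : opens T) (f : P U), oset U (set_val v) /\
    forall (w : V) (Ww : oset W w) (Uw : oset U (set_val w)),
      germ_scal J (set_val w) c = germ_of J Uw f.
Proof.
move=> v Wv; exists (opensT T), (sscal _ c); split=> // w Ww Uw.
by rewrite germ_of_scal.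
Qed.
Definition qscal c : Q := QuotSection (qscal_loc c).

Lemma qloc2 (s t : Q) (v : V) : oset W v ->
  exists (U : opens T) (f g : P U), oset U (set_val v) /\
    forall (w : V) (Ww : oset W w) (Uw : oset U (set_val w)),
      qval s Ww = germ_of J Uw f /\ qval t Ww = germ_of J Uw g.
Proof.
move=> Wv; have [U1 [f [U1v hf]]] := qval_loc s Wv.
have [U2 [g [U2v hg]]] := qval_loc t Wv.
exists (opensI U1 U2), (pres P (subo_Il U1 U2) f), (pres P (subo_Ir U1 U2) g).
split=> [//|w Ww Uw]; case: (Uw) => U1w U2w.
by rewrite (hf w Ww U1w) (hg w Ww U2w) !germ_res.
Qed.

Lemma qadd_loc (s t : Q) : forall v : V, oset W v ->
  exists (U : opens T) (f : P U), oset U (set_val v) /\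
    forall (w : V) (Ww : oset W w) (Uw : oset U (set_val w)),
      qval s Ww + qval t Ww = germ_of J Uw f.
Proof.
move=> v Wv; have [U [f [g [Uv h]]]] := qloc2 s t Wv.
exists U, (f + g); split=> // w Ww Uw; have [-> ->] := h w Ww Uw.
by rewrite germ_ofD.
Qed.
Definition qadd (s t : Q) : Q := QuotSection (qadd_loc s t).

Lemma qmul_loc (s t : Q) : forall v : V, oset W v ->
  exists (U : opens T) (f : P U), oset U (set_val v) /\
    forall (w : V) (Ww : oset W w) (Uw : oset U (set_val w)),
      qval s Ww * qval t Ww = germ_of J Uw f.
Proof.
move=> v Wv; have [U [f [g [Uv h]]]] := qloc2 s t Wv.
exists U, (f * g); split=> // w Ww Uw; have [-> ->] := h w Ww Uw.
by rewrite germ_ofM.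
Qed.
Definition qmul (s t : Q) : Q := QuotSection (qmul_loc s t).

Lemma qopp_loc (s : Q) : forall v : V, oset W v ->
  exists (U : opens T) (f : P U), oset U (set_val v) /\
    forall (w : V) (Ww : oset W w) (Uw : oset U (set_val w)),
      - qval s Ww = germ_of J Uw f.
Proof.
move=> v Wv; have [U [f [Uv h]]] := qval_loc s Wv.
by exists U, (- f); split=> // w Ww Uw; rewrite (h w Ww Uw) germ_ofN.
Qed.
Definition qopp (s : Q) : Q := QuotSection (qopp_loc s).

Lemma qaddA : associative qadd.
Proof. by move=> s t u; apply: quot_section_ext => w Ww /=; rewrite addrA. Qed.
Lemma qaddC : commutative qadd.
Proof. by move=> s t; apply: quot_section_ext => w Ww /=; rewrite addrC. Qed.
Lemma qadd0 : left_id (qscal 0) qadd.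
Proof.
by move=> s; apply: quot_section_ext => w Ww /=; rewrite [germ_scal _ _ _]/(0 : germ J (set_val w)) add0r.
Qed.
Lemma qaddN : left_inverse (qscal 0) qopp qadd.
Proof. by move=> s; apply: quot_section_ext => w Ww /=; rewrite addNr. Qed.
Lemma qmulA : associative qmul.
Proof. by move=> s t u; apply: quot_section_ext => w Ww /=; rewrite mulrA. Qed.
Lemma qmul1l : left_id (qscal 1) qmul.
Proof.
by move=> s; apply: quot_section_ext => w Ww /=; rewrite [germ_scal _ _ _]/(1 : germ J (set_val w)) mul1r.
Qed.
Lemma qmul1r : right_id (qscal 1) qmul.
Proof.
by move=> s; apply: quot_section_ext => w Ww /=; rewrite [germ_scal _ _ _]/(1 : germ J (set_val w)) mulr1.
Qed.
Lemma qmulDl : left_distributive qmul qadd.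
Proof. by move=> s t u; apply: quot_section_ext => w Ww /=; rewrite mulrDl. Qed.
Lemma qmulDr : right_distributive qmul qadd.
Proof. by move=> s t u; apply: quot_section_ext => w Ww /=; rewrite mulrDr. Qed.

Definition quot_section_ring : pzRingType :=
  HB.pack Q (GRing.isPzRing.Build Q qaddA qaddC qadd0 qaddN
               qmulA qmul1l qmul1r qmulDl qmulDr).
Local Notation QR := quot_section_ring.

Lemma qscal_is_zmod_morphism : zmod_morphism (qscal : K -> QR).
Proof.
move=> a b; apply: quot_section_ext => w Ww /=.
exact: (rmorphB (germ_scal_rmorphism J (set_val w))).
Qed.
Lemma qscal_is_monoid_morphism : monoid_morphism (qscal : K -> QR).
Proof.
split=> [//|a b]; apply: quot_section_ext => w Ww /=.
exact: (rmorphM (germ_scal_rmorphism J (set_val w))).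
Qed.
Definition qscal_rmorphism : {rmorphism K -> QR} :=
  HB.pack (qscal : K -> QR)
    (GRing.isZmodMorphism.Build K QR qscal qscal_is_zmod_morphism)
    (GRing.isMonoidMorphism.Build K QR qscal qscal_is_monoid_morphism).

Definition qpart (p : bool) (s : QR) : Prop :=
  forall w (Ww : oset W w), spart (stalk_mod J (set_val w)) p (qval s Ww).

Lemma qscal_even c : qpart false (qscal c).
Proof. by move=> w Ww; exact: germ_scal_even. Qed.
Lemma qpartB p (s t : QR) : qpart p s -> qpart p t -> qpart p (s - t).
Proof. by move=> ps pt w Ww; apply: germ_partB; [exact: ps|exact: pt]. Qed.
Lemma qpartM p q (s t : QR) : qpart p s -> qpart q t -> qpart (p (+) q) (s * t).
Proof. by move=> ps pt w Ww; apply: germ_partM; [exact: ps|exact: pt]. Qed.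
Lemma qpart_disj (s : QR) : qpart false s -> qpart true s -> s = 0.
Proof.
by move=> h0 h1; apply: quot_section_ext => w Ww; apply: germ_part_disj; [exact: h0|exact: h1].
Qed.
Lemma qpartC p q (s t : QR) : qpart p s -> qpart q t ->
  s * t = (-1) ^+ (p && q) * (t * s).
Proof.
move=> ps pt; apply: quot_section_ext => w Ww.
have := germ_partC (ps w Ww) (pt w Ww).
case: (p && q); first by rewrite !expr1 !mulN1r.
by rewrite !expr0 !mul1r.
Qed.

Lemma germ_dec_uniq (x : T) (a0 a1 b0 b1 : germ J x) :
  germ_part false a0 -> germ_part true a1 ->
  germ_part false b0 -> germ_part true b1 -> a0 + a1 = b0 + b1 ->
  a0 = b0 /\ a1 = b1.
Proof.
move=> pa0 pa1 pb0 pb1 e.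
have e' : a0 - b0 = b1 - a1.
  by apply/eqP; rewrite subr_eq addrAC -subr_eq opprK e addrC.
have h : a0 - b0 = 0.
  by apply: germ_part_disj; [|rewrite e']; exact: germ_partB.
split; first by apply/eqP; rewrite -subr_eq0 h.
by apply/esym/eqP; rewrite -subr_eq0 -e' h.
Qed.

Lemma qpart_dec (s : QR) : exists s0 s1, [/\ qpart false s0, qpart true s1 & s = s0 + s1].
Proof.
have dec w (Ww : oset W w) : {g : germ J (set_val w) * germ J (set_val w) |
    [/\ germ_part false g.1, germ_part true g.2 & qval s Ww = g.1 + g.2]}.
  by apply: cid; have [g0 [g1 h]] := germ_part_dec (qval s Ww); exists (g0, g1).
have loc v : oset W v -> exists (U : opens T) (f0 f1 : P U), oset U (set_val v) /\
    forall (w : V) (Ww : oset W w) (Uw : oset U (set_val w)),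
      (sval (dec w Ww)).1 = germ_of J Uw f0 /\ (sval (dec w Ww)).2 = germ_of J Uw f1.
  move=> Wv; have [U [f [Uv hf]]] := qval_loc s Wv.
  have [f0 [f1 [p0 p1 ef]]] := spart_dec f.
  exists U, f0, f1; split=> // w Ww Uw; case: (dec w Ww) => -[g0 g1] /= [q0 q1 e].
  apply: germ_dec_uniq => //; [by exists U, Uw, f0|by exists U, Uw, f1|].
  by rewrite -e (hf w Ww Uw) ef germ_ofD.
have loc0 v : oset W v -> exists (U : opens T) (f : P U), oset U (set_val v) /\
    forall (w : V) (Ww : oset W w) (Uw : oset U (set_val w)),
      (sval (dec w Ww)).1 = germ_of J Uw f.
  move=> /loc[U [f0 [f1 [Uv h]]]]; exists U, f0; split=> // w Ww Uw.
  by have [] := h w Ww Uw.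
have loc1 v : oset W v -> exists (U : opens T) (f : P U), oset U (set_val v) /\
    forall (w : V) (Ww : oset W w) (Uw : oset U (set_val w)),
      (sval (dec w Ww)).2 = germ_of J Uw f.
  move=> /loc[U [f0 [f1 [Uv h]]]]; exists U, f1; split=> // w Ww Uw.
  by have [] := h w Ww Uw.
exists (QuotSection loc0), (QuotSection loc1); split.
- by move=> w Ww /=; case: (dec w Ww) => -[g0 g1] /= [].
- by move=> w Ww /=; case: (dec w Ww) => -[g0 g1] /= [].
- by apply: quot_section_ext => w Ww /=; case: (dec w Ww) => -[g0 g1] /= [].
Qed.

Definition quot_section_sa : superalgebra K :=
  @Superalgebra K QR qscal_rmorphism qpart qscal_even qpartB qpartM qpart_dec
    qpart_disj qpartC.

End Sections.

Section Restriction.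
Variables (W W' : opens V) (h : W' <=o W).

Lemma qres_loc (s : quot_section W) : forall v : V, oset W' v ->
  exists (U : opens T) (f : P U), oset U (set_val v) /\
    forall (w : V) (Ww : oset W' w) (Uw : oset U (set_val w)),
      qval s (h Ww) = germ_of J Uw f.
Proof.
move=> v /h/(qval_loc s)[U [f [Uv hf]]]; exists U, f; split=> [//|w Ww Uw]; exact: hf.
Qed.
Definition qres (s : quot_section_sa W) : quot_section_sa W' :=
  QuotSection (qres_loc s).

Lemma qres_is_zmod_morphism : zmod_morphism qres.
Proof. by move=> s t; apply: quot_section_ext. Qed.
Lemma qres_is_monoid_morphism : monoid_morphism qres.
Proof. by split=> [|s t]; apply: quot_section_ext. Qed.
Definition qres_rmorphism : {rmorphism quot_section_sa W -> quot_section_sa W'} :=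
  HB.pack qres
    (GRing.isZmodMorphism.Build _ _ qres qres_is_zmod_morphism)
    (GRing.isMonoidMorphism.Build _ _ qres qres_is_monoid_morphism).

Lemma qres_scal c :
  qres_rmorphism (sscal (quot_section_sa W) c) = sscal (quot_section_sa W') c.
Proof. exact: quot_section_ext. Qed.
Lemma qres_part p s : spart (quot_section_sa W) p s ->
  spart (quot_section_sa W') p (qres_rmorphism s).
Proof. by move=> hs w Ww; exact: hs. Qed.
Definition qres_smor : smor (quot_section_sa W) (quot_section_sa W') :=
  SMor qres_scal qres_part.

End Restriction.

Lemma qres_id W (h : W <=o W) s : qres_smor h s = s.
Proof.
apply: quot_section_ext => w Ww /=; congr (qval s _); exact: Prop_irrelevance.
Qed.

Lemma qres_comp (U1 U2 U3 : opens V) (h : U2 <=o U1) (k : U3 <=o U2)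
  (l : U3 <=o U1) s : qres_smor k (qres_smor h s) = qres_smor l s.
Proof.
apply: quot_section_ext => w Ww /=; congr (qval s _); exact: Prop_irrelevance.
Qed.

Definition quotient_sheaf : presheaf K V := Presheaf qres_id qres_comp.

End QuotientSheaf.

Definition maximal_ideal (A : pzRingType) (M : set A) : Prop :=
  [/\ ring_ideal M, ~ M 1 &
      forall N : set A, ring_ideal N -> ~ N 1 -> M `<=` N -> N = M].

Definition local_ring (A : pzRingType) : Prop :=
  exists! M : set A, maximal_ideal M.

Record ringed_space (K : numFieldType) := RingedSpace {
  rspace :> topologicalType ;
  rsheaf : presheaf K rspace }.

Definition is_superspace (K : numFieldType) (X : ringed_space K) : Prop :=
  is_sheaf (rsheaf X) /\ forall x : X, local_ring (stalk (rsheaf X) x).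

Section OpenSubspace.
Variables (K : numFieldType) (X : ringed_space K) (U : opens X).

Lemma open_img (W : opens (oset U)) : open (set_val @` oset W).
Proof.
have [B oB BW] := oopen W.
suff -> : set_val @` oset W = oset U `&` B by apply: openI => //; exact: oopen.
rewrite -BW; apply/seteqP; split=> [_ [w Bw <-]|y [Uy By]].
  by split=> //; exact: set_valP.
by exists (exist _ y (mem_set Uy)).
Qed.
Definition opens_img (W : opens (oset U)) : opens X := Opens (open_img W).

Lemma sub_img (W W' : opens (oset U)) : W' <=o W -> opens_img W' <=o opens_img W.
Proof. by move=> h; exact: image_subset. Qed.

Definition open_sheaf : presheaf K (oset U) :=
  @Presheaf K (oset U) (fun W => rsheaf X (opens_img W))
    (fun W W' h => pres (rsheaf X) (sub_img h))
    (fun W h s => pres_id _ s)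
    (fun W1 W2 W3 h k l s => pres_comp _ _ _ s).

Definition open_subspace : ringed_space K := RingedSpace open_sheaf.
End OpenSubspace.

Definition space_iso (K : numFieldType) (X Y : ringed_space K) : Prop :=
  exists (f : X -> Y) (cf : continuous f) (g : Y -> X),
    [/\ continuous g, cancel f g, cancel g f &
     exists th : forall U : opens Y,
         smor (rsheaf Y U) (rsheaf X (opens_pre cf U)),
       (forall U, bijective (th U)) /\
       forall (U V : opens Y) (h : V <=o U)
         (h' : opens_pre cf V <=o opens_pre cf U) s,
         pres (rsheaf X) h' (th U s) = th V (pres (rsheaf Y) h s)].

Section Holomorphic.
Variables (K : numFieldType) (a : nat).
Implicit Types U V : opens 'rV[K]_a.

(* Complex differentiability at every point of U; since differentiable is about
   functions on the whole space, f is first extended arbitrarily outside U. *)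
Definition holomorphic U (f : oset U -> K) : Prop :=
  exists g : 'rV[K]_a -> K, (forall u : oset U, g (set_val u) = f u) /\
    forall x, oset U x -> differentiable g x.

Definition hol_pred U : {pred (oset U -> K)} := fun f => `[< holomorphic f >].

Record hol U := Hol { hfun :> oset U -> K ; hfunP : hfun \in @hol_pred U }.

Lemma hol_subring_closed U : subring_closed (@hol_pred U).
Proof.
split.
- apply/asboolP; exists (cst 1); split=> // x _; exact: differentiable_cst.
- move=> f g /asboolP[f' [ef df]] /asboolP[g' [eg dg]]; apply/asboolP.
  exists (f' - g'); split=> [u|x Ux]; first by rewrite /= !fctE ef eg.
  by apply: differentiableB; [exact: df|exact: dg].
- move=> f g /asboolP[f' [ef df]] /asboolP[g' [eg dg]]; apply/asboolP.
  exists (f' * g'); split=> [u|x Ux]; first by rewrite /= !fctE ef eg.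
  by apply: differentiableM; [exact: df|exact: dg].
Qed.

HB.instance Definition _ U := [isSub for @hfun U].
HB.instance Definition _ U := [Choice of hol U by <:].
HB.instance Definition _ U :=
  GRing.SubChoice_isSubComPzRing.Build _ _ (hol U) (hol_subring_closed U).

End Holomorphic.

Section HolomorphicAlgebra.
Variables (K : numFieldType) (a : nat).
Implicit Types U V W : opens 'rV[K]_a.

Lemma hol_ext U (f g : hol U) : hfun f =1 hfun g -> f = g.
Proof. by move=> fg; apply: val_inj; apply/funext. Qed.

Lemma hol_cst_subproof U (c : K) : (fun=> c) \in @hol_pred K a U.
Proof.
by apply/asboolP; exists (cst c); split=> // x _; exact: differentiable_cst.
Qed.
Definition hol_cst U (c : K) : hol U := Hol (hol_cst_subproof U c).

Lemma hol_cst_is_zmod_morphism U : zmod_morphism (hol_cst U).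
Proof. by move=> x y; apply: hol_ext. Qed.
Lemma hol_cst_is_monoid_morphism U : monoid_morphism (hol_cst U).
Proof. by split=> [|x y]; apply: hol_ext. Qed.
Definition hol_cst_rmorphism U : {rmorphism K -> hol U} :=
  HB.pack (hol_cst U)
    (GRing.isZmodMorphism.Build K (hol U) (hol_cst U) (@hol_cst_is_zmod_morphism U))
    (GRing.isMonoidMorphism.Build K (hol U) (hol_cst U) (@hol_cst_is_monoid_morphism U)).

Definition hol_calg U : calg K := CAlg (hol_cst_rmorphism U).

Section Res.
Variables (U V : opens 'rV[K]_a) (h : V <=o U).

Definition oincl (x : oset V) : oset U :=
  exist _ (set_val x) (mem_set (h (set_valP x))).

Lemma hol_res_subproof (f : hol U) : (f \o oincl) \in @hol_pred K a V.
Proof.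
apply/asboolP; case: f => f /= /asboolP[g [gf dg]]; exists g; split.
  by move=> u; rewrite /= -gf.
by move=> x /h; exact: dg.
Qed.
Definition hol_res (f : hol U) : hol V := Hol (hol_res_subproof f).

Lemma hol_res_is_zmod_morphism : zmod_morphism hol_res.
Proof. by move=> f g; apply: hol_ext. Qed.
Lemma hol_res_is_monoid_morphism : monoid_morphism hol_res.
Proof. by split=> [|f g]; apply: hol_ext. Qed.
Definition hol_res_rmorphism : {rmorphism hol U -> hol V} :=
  HB.pack hol_res
    (GRing.isZmodMorphism.Build _ _ hol_res hol_res_is_zmod_morphism)
    (GRing.isMonoidMorphism.Build _ _ hol_res hol_res_is_monoid_morphism).

Lemma hol_res_scal c :
  hol_res_rmorphism (cscal (hol_calg U) c) = cscal (hol_calg V) c.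
Proof. exact: hol_ext. Qed.
Definition hol_res_cmor : cmor (hol_calg U) (hol_calg V) :=
  @CMor K (hol_calg U) (hol_calg V) hol_res_rmorphism hol_res_scal.
End Res.

Lemma hol_res_id U (h : U <=o U) f : hol_res h f = f.
Proof. by apply: hol_ext => x /=; congr (hfun f _); apply: val_inj. Qed.

Lemma hol_res_comp U V W (h : V <=o U) (k : W <=o V) (l : W <=o U) f :
  hol_res k (hol_res h f) = hol_res l f.
Proof. by apply: hol_ext => x /=; congr (hfun f _); apply: val_inj. Qed.

Lemma mpeval_differentiable (f : mpoly.mpoly a K) (x : 'rV[K]_a) :
  differentiable (mpeval f : 'rV[K]_a -> K) x.
Proof.
have h0 : differentiable (mpeval (0 : mpoly.mpoly a K)) x.
  have -> : mpeval (0 : mpoly.mpoly a K) = cst 0.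
    by apply/funext => y; exact: rmorph0.
  exact: differentiable_cst.
have hM (g h : mpoly.mpoly a K) : differentiable (mpeval g) x ->
    differentiable (mpeval h) x -> differentiable (mpeval (g * h)) x.
  move=> dg dh; have -> : mpeval (g * h) = mpeval g * mpeval h.
    by apply/funext => y; exact: rmorphM.
  exact: differentiableM.
have hC c : differentiable (mpeval (mpoly.mpolyC a c)) x.
  have -> : mpeval (mpoly.mpolyC a c) = cst c.
    by apply/funext => y; exact: mpoly.mevalC.
  exact: differentiable_cst.
have hX i : differentiable (mpeval (mpoly.mpolyX K (mpoly.mnm1 i) : mpoly.mpoly a K)) x.
  have -> : mpeval (mpoly.mpolyX K (mpoly.mnm1 i)) = (fun y : 'rV[K]_a => y 0 i).
    by apply/funext => y; exact: mpoly.mevalXU.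
  exact: differentiable_coord.
elim/mpoly.mpolyind: f => [//|c m p _ _ dp].
have -> : mpeval (c *: mpoly.mpolyX K m + p) =
    mpeval (mpoly.mpolyC a c * mpoly.mpolyX K m) + mpeval p.
  by rewrite mpoly.mul_mpolyC; apply/funext => y; exact: rmorphD.
apply: differentiableD => //; apply: (hM) => //; rewrite mpoly.mpolyXE_id.
elim/big_ind: _ => [||i _]; [by rewrite -[1]/(mpoly.mpolyC a 1)|exact: (hM)|].
elim: (mpoly.fun_of_multinom m i) => [|k IHk]; first by rewrite expr0 -[1]/(mpoly.mpolyC a 1).
by rewrite exprS; exact: (hM).
Qed.

Section PolyEval.
Variable U : opens 'rV[K]_a.

Lemma hol_poly_subproof (f : mpoly.mpoly a K) :
  (fun x : oset U => mpeval f (set_val x)) \in @hol_pred K a U.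
Proof.
apply/asboolP; exists (mpeval f); split=> // x _; exact: mpeval_differentiable.
Qed.
Definition hol_poly (f : poly_calg K a) : hol_calg U := Hol (hol_poly_subproof f).

Lemma hol_poly_is_zmod_morphism : zmod_morphism hol_poly.
Proof. by move=> f g; apply: hol_ext => x; exact: rmorphB. Qed.
Lemma hol_poly_is_monoid_morphism : monoid_morphism hol_poly.
Proof.
split=> [|f g]; apply: hol_ext => x; [exact: rmorph1|exact: rmorphM].
Qed.
Definition hol_poly_rmorphism : {rmorphism poly_calg K a -> hol_calg U} :=
  HB.pack hol_poly
    (GRing.isZmodMorphism.Build _ _ hol_poly hol_poly_is_zmod_morphism)
    (GRing.isMonoidMorphism.Build _ _ hol_poly hol_poly_is_monoid_morphism).
Lemma hol_poly_scal c :
  hol_poly_rmorphism (cscal (poly_calg K a) c) = cscal (hol_calg U) c.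
Proof. by apply: hol_ext => x; exact: mpoly.mevalC. Qed.
Definition hol_poly_cmor : cmor (poly_calg K a) (hol_calg U) :=
  CMor hol_poly_scal.
End PolyEval.

Lemma hol_res_poly U V (h : V <=o U) f : hol_res h (hol_poly U f) = hol_poly V f.
Proof. exact: hol_ext. Qed.

End HolomorphicAlgebra.

Section AffineSuperspace.
Variables (K : numFieldType) (p q : nat).

Definition hol_sections (U : opens 'rV[K]_p) : superalgebra K :=
  grassmann_sa q (hol_calg U).

Definition hol_sheaf : presheaf K 'rV[K]_p.
Proof.
apply: (@Presheaf K 'rV[K]_p hol_sections
  (fun U V h => grassmann_map q (hol_res_cmor h))) => [U h s|U V W h k l s].
  by apply/ffunP => S; rewrite !ffunE; exact: hol_res_id.
by apply/ffunP => S; rewrite !ffunE; exact: hol_res_comp.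
Defined.

Definition affine_superspace : ringed_space K := RingedSpace hol_sheaf.
End AffineSuperspace.

Definition complex_supermanifold (K : numFieldType) (X : ringed_space K) : Prop :=
  is_superspace X /\
  exists p q : nat, forall x : X,
    exists (U : opens X) (D : opens (affine_superspace K p q)),
      oset U x /\ space_iso (open_subspace U) (open_subspace D).

Section AnalyticSpace.
Variables (K : numFieldType) (a b : nat).
Local Notation S := (poly_superalgebra K a b).
Variables (I : set S) (hI : homogeneous I).

(* The K-points of the supervariety K[x, xi] / I: the xi_j vanish on them. *)
Definition closed_points : set 'rV[K]_a :=
  [set x | forall f : S, I f ->
    mpeval (gbody (f : grassmann b (poly_calg K a))) x = 0].

Definition poly_section (U : opens 'rV[K]_a) : smor S (hol_sections b U) :=
  grassmann_map b (hol_poly_cmor U).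

Definition analytic_ideal_sections (U : opens 'rV[K]_a) : set (hol_sections b U) :=
  ideal_gen (poly_section U @` I).

Lemma analytic_ideal_homog U : homogeneous (@analytic_ideal_sections U).
Proof.
apply: ideal_gen_homog => _ [f /hI[f0 [f1 [h0 h1 -> I0 I1]]] <-].
exists (poly_section U f0), (poly_section U f1); rewrite rmorphD.
by split=> //; exact: smor_part.
Qed.

Lemma analytic_ideal_res (U V : opens 'rV[K]_a) (h : V <=o U) s :
  analytic_ideal_sections s ->
  analytic_ideal_sections (pres (hol_sheaf K a b) h s).
Proof.
move=> Is; pose J := [set t : hol_sections b U |
  analytic_ideal_sections (pres (hol_sheaf K a b) h t)].
have GI := ideal_gen_ideal (poly_section V @` I).
suff : ideal_gen (poly_section U @` I) `<=` J by apply.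
apply: ideal_gen_min.
  split=> [|x y Jx Jy|c x Jx]; rewrite /J /=.
  - by rewrite rmorph0; exact: (ideal0 GI).
  - by rewrite rmorphD; exact: (idealD GI).
  - by rewrite !rmorphM; split; [exact: (idealMl GI)|exact: (idealMr GI)].
move=> _ [f If <-]; apply: ideal_gen_sub; exists f => //.
by apply/ffunP => T; rewrite !ffunE; apply/esym; exact: hol_res_poly.
Qed.

Definition analytic_ideal : ideal_presheaf (hol_sheaf K a b) :=
  @IdealPresheaf K _ (hol_sheaf K a b) analytic_ideal_sections
    (fun U => ideal_gen_ideal _) analytic_ideal_homog analytic_ideal_res.

Definition analytic_space : ringed_space K :=
  @RingedSpace K closed_points (quotient_sheaf analytic_ideal closed_points).

End AnalyticSpace.

Definition algebraic_set (K : numFieldType) (N : nat) (Z : set 'rV[K]_N) : Prop :=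
  exists E : set (mpoly.mpoly N K), Z = [set z | forall f, E f -> mpeval f z = 0].

Definition regular_function (K : numFieldType) (N : nat) (Z : set 'rV[K]_N)
    (u : Z -> K) : Prop :=
  exists f : mpoly.mpoly N K, forall z, u z = mpeval f (set_val z).

Definition odd_ideal (K : numFieldType) (A : superalgebra K) : set A :=
  ideal_gen (spart A true).

(* The first conjunct says that rho induces an isomorphism of K-algebras from
   A / odd_ideal A onto the ring of regular functions on Z. *)
Definition affine_supervariety (K : numFieldType) (A : superalgebra K) : Prop :=
  (exists (N : nat) (Z : set 'rV[K]_N) (rho : {rmorphism A -> (Z -> K)}),
    [/\ algebraic_set Z,
        forall c, rho (sscal A c) = cst c,
        range rho = @regular_function K N Z &
        forall x, rho x = 0 <-> odd_ideal x])
  /\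
  (exists (k : nat) (e : 'I_k -> A),
    (forall i, spart A true (e i)) /\
    forall x, spart A true x ->
      exists c : 'I_k -> A,
        (forall i, spart A false (c i)) /\ x = \sum_i c i * e i).

Lemma ker_homog (K : numFieldType) (A B : superalgebra K) (f : smor A B) :
  homogeneous [set x | f x = 0].
Proof.
move=> x /= fx0; have [x0 [x1 [h0 h1 e]]] := spart_dec x.
have f0 : f x0 = 0.
  apply: spart_disj; first exact: smor_part.
  have -> : f x0 = - f x1.
    by apply/eqP; rewrite -addr_eq0 -rmorphD -e fx0.
  by apply: spartN; exact: smor_part.
exists x0, x1; split=> //=.
by have := fx0; rewrite e rmorphD f0 add0r.
Qed.

Arguments ker_homog {K A B} f : rename.

(* pi is a presentation of A as K[x_1..x_a, xi_1..xi_b] / I, with I = ker pi. *)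
Definition is_complex_supermanifold (K : numFieldType) (A : superalgebra K) : Prop :=
  exists (a b : nat) (pi : smor (poly_superalgebra K a b) A),
    (forall y, exists x, pi x = y) /\
    complex_supermanifold (analytic_space (ker_homog pi)).

Definition group_law (G : Type) (op : G -> G -> G) : Prop :=
  associative op /\
  exists (e : G) (inv : G -> G),
    [/\ left_id e op, right_id e op, left_inverse e inv op
      & right_inverse e inv op].

(* A group structure on Hom(A, D), functorial in D. *)
Definition supergroup_law (K : numFieldType) (A : superalgebra K)
    (mu : forall D : superalgebra K, smor A D -> smor A D -> smor A D) : Prop :=
  (forall D, group_law (mu D)) /\
  forall (D D' : superalgebra K) (f : smor D D') (u v : smor A D),
    smor_comp f (mu D u v) = mu D' (smor_comp f u) (smor_comp f v).

Definition affine_algebraic_supergroup (K : numFieldType) (A : superalgebra K)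
    (mu : forall D : superalgebra K, smor A D -> smor A D -> smor A D) : Prop :=
  affine_supervariety A /\ supergroup_law mu.

Section Linear.
Variables (K : numFieldType) (A : superalgebra K) (m n : nat).

Definition mx_inverse (k : nat) (s t : 'M[A]_k) : Prop :=
  s *m t = 1%:M /\ t *m s = 1%:M.

Definition mx_invertible (k : nat) (s : 'M[A]_k) : Prop :=
  exists t, mx_inverse s t.

(* The (necessarily unique) inverse of s when s is invertible; in that case it
   has even entries as soon as s has. *)
Definition mx_inv (k : nat) (s : 'M[A]_k) : 'M[A]_k :=
  xget 1%:M [set t | mx_inverse s t].

Definition mx_part (k l : nat) (p : bool) (s : 'M[A]_(k, l)) : Prop :=
  forall i j, spart A p (s i j).

Definition GL : set 'M[A]_(m + n) :=
  [set g | [/\ mx_part false (ulsubmx g), mx_part true (ursubmx g),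
              mx_part true (dlsubmx g) & mx_part false (drsubmx g)] /\
           mx_invertible (ulsubmx g) /\ mx_invertible (drsubmx g)].

(* The entries of the matrices whose determinants are taken are even, hence
   commute, when g is in GL. *)
Definition Ber (g : 'M[A]_(m + n)) : A :=
  let p := ulsubmx g in let q := ursubmx g in
  let r := dlsubmx g in let s := drsubmx g in
  \det (p - q *m mx_inv s *m r) * \det (mx_inv s).

Definition SL : set 'M[A]_(m + n) := [set g | GL g /\ Ber g = 1].

End Linear.

(* eta is an isomorphism of group valued functors from Hom(A, -) with the law mu
   onto SL m n; on morphisms, SL m n acts entrywise. *)
Definition represents_SL (K : numFieldType) (m n : nat) (A : superalgebra K)
    (mu : forall D : superalgebra K, smor A D -> smor A D -> smor A D) : Prop :=
  exists eta : forall D : superalgebra K, smor A D -> 'M[D]_(m + n),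
    [/\ forall D, injective (eta D),
        forall D, range (eta D) = @SL K D m n,
        forall (D D' : superalgebra K) (f : smor D D') (u : smor A D),
          eta D' (smor_comp f u) = map_mx f (eta D u) &
        forall (D : superalgebra K) (u v : smor A D),
          eta D (mu D u v) = eta D u *m eta D v].

(* Main.v *)
From HB Require Import structures.
Require Import Defs.
From mathcomp Require Import all_boot all_order all_algebra.
From mathcomp Require Import all_classical all_reals all_analysis.
From mathcomp Require Import complex.
From mathcomp Require Import (canonicals) mpoly.
From mathcomp Require Import ring lra.
Import Order.TTheory GRing.Theory Num.Theory.
Import numFieldNormedType.Exports.

Set Implicit Arguments.
Unset Strict Implicit.
Unset Printing Implicit Defensive.

Local Open Scope classical_set_scope.
Local Open Scope ring_scope.

(* Every g in GL(A) factors uniquely as U(x) diag(p, s) L(y), with x = q s^-1 and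
   y = s^-1 r odd and p the Schur complement; then Ber g = det p / det s. Writing
   t = s^-1, the points of SL over A are the (p, t, x, y) with p, t even,
   x, y odd and det p * det t = 1, so SL is represented by C[Z] tensor an exterior
   algebra, where Z is the hypersurface h = 1 for h = det p * det t. That the
   functions on Z are presented by the single relation h = 1 follows by scaling a
   row of p (or t), which multiplies h. Multiplicativity of Ber amounts to
   det (1 + x y) * det (1 + y x) = 1 for odd x, y, proved with Schur complements
   by reduction to 1 x 1 matrices.

   Since h is affine in each coordinate and a cofactor of p or t is nonzero
   wherever h = 1, Z is locally the graph of a holomorphic function. The
   projection forgetting the corresponding coordinate is a chart, provided that a
   holomorphic f vanishing on Z is locally (h - 1) g with g holomorphic. Taylor
   coefficients of f transversally to Z are uniform limits of difference
   quotients, by Cauchy's formula in one variable on a square, and this gives the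
   holomorphy of g along Z. *)

(** * One complex variable *)

(** Using [t] for the inverse of the lower block turns the condition on the Berezinian into a
    polynomial equation, and any solution of it over any superalgebra automatically has invertible
    [p] and [t].

    The analytic obstacle is that the structure sheaf is a quotient by the ideal generated by
    [h - 1], whereas geometry only provides values on Z. Holomorphic means complex differentiable at
    every point, with no regularity of the derivative granted, so the holomorphy of a derivative
    taken transversally to Z is itself a theorem. It rests on Taylor estimates whose constants
    depend on a bound of the function alone, since such estimates survive limits.

    The number 2 pi i never occurs: Cauchy's formula is used as f(z) k(z) = I(f, z), where k(z) is
    the same integral for the constant 1, and dividing the two expansions only uses that |k(0)| is
    at least 4.

    On the algebraic side the functions on Z are reduced by definition, while the points of SL take
    values in arbitrary, possibly nilpotent, rings. The scaling argument bridges this gap. It fails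
    for m = n = 0, where [h] is the constant 1. *)

Section Modulus.
Variable R : realType.
Implicit Types z w : R[i].

(** The norm of [R[i]] takes its values in [R[i]]; its real part is the modulus as an element of
    [R], where linear arithmetic and the order are available. *)
Definition cmod z : R := complex.Re `|z|.

Lemma cmodE z : `|z| = (cmod z)%:C%C.
Proof. by case: z => a b; rewrite /cmod normc_def. Qed.

Lemma cmod_ge0 z : 0 <= cmod z.
Proof. by have := normr_ge0 z; rewrite cmodE ler0c. Qed.

Lemma cmod0 : cmod 0 = 0.
Proof. by rewrite /cmod normr0. Qed.

Lemma cmod1 : cmod 1 = 1.
Proof. by rewrite /cmod normr1. Qed.

Lemma cmodD z w : cmod (z + w) <= cmod z + cmod w.
Proof. by have := ler_normD z w; rewrite !cmodE -rmorphD lecR. Qed.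

Lemma cmodM z w : cmod (z * w) = cmod z * cmod w.
Proof.
have := normrM z w.
by rewrite !cmodE -rmorphM => -[].
Qed.

Lemma cmodN z : cmod (- z) = cmod z.
Proof. by rewrite /cmod normrN. Qed.

Lemma cmodB z w : cmod (z - w) <= cmod z + cmod w.
Proof. by rewrite -(cmodN w) cmodD. Qed.

Lemma cmod_distC z w : cmod (z - w) = cmod (w - z).
Proof. by rewrite -cmodN opprB. Qed.

Lemma cmod_eq0 z : (cmod z == 0) = (z == 0).
Proof.
apply/eqP/eqP => [h|->]; last exact: cmod0.
by apply: normr0_eq0; rewrite cmodE h.
Qed.

Lemma cmod_gt0 z : (0 < cmod z) = (z != 0).
Proof. by rewrite lt_def cmod_ge0 andbT cmod_eq0. Qed.

Lemma cmodR (x : R) : cmod x%:C%C = `|x|.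
Proof.
rewrite /cmod normc_def /= expr0n /= addr0.
by rewrite sqrtr_sqr.
Qed.

Lemma cmod_i : cmod 'i%C = 1.
Proof. by rewrite /cmod normc_def /= expr0n /= add0r expr1n sqrtr1. Qed.

Lemma cmod_Re z : `|complex.Re z| <= cmod z.
Proof. by have := normc_ge_Re z; rewrite cmodE lecR. Qed.

Lemma complexW z : z = (complex.Re z)%:C%C + 'i%C * (complex.Im z)%:C%C.
Proof. by case: z => a b; simpc. Qed.

Lemma cmod_le z : cmod z <= `|complex.Re z| + `|complex.Im z|.
Proof.
rewrite [X in cmod X]complexW; apply: (le_trans (cmodD _ _)).
by rewrite cmodM cmod_i mul1r !cmodR.
Qed.

Lemma cmod_Im z : `|complex.Im z| <= cmod z.
Proof.
have := cmod_Re (- 'i%C * z); rewrite cmodM cmodN cmod_i mul1r.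
by case: z => a b /=; rewrite !(mul0r, oppr0, mulN1r, sub0r, add0r, opprK).
Qed.

Lemma cmodV z : cmod z^-1 = (cmod z)^-1.
Proof.
have := normfV z.
by rewrite !cmodE -fmorphV => -[].
Qed.

Lemma cmodX z k : cmod (z ^+ k) = cmod z ^+ k.
Proof.
by elim: k => [|k IH]; rewrite ?expr0 ?cmod1 // !exprS cmodM IH.
Qed.

End Modulus.

Section RealPrimitive.
Variable R : realType.

Lemma continuous_primitive (a : R) (u : R -> R) : continuous u ->
  exists U : R -> R, forall t, a < t -> is_derive t 1 U (u t).
Proof.
move=> cu; exists (fun x => \int[lebesgue_measure]_(t in `[a, x]) u t)%R => t at_.
have tt1 : t < t + 1 by rewrite ltrDl.
have iu : lebesgue_measure.-integrable [set` Interval (BLeft a) (BRight (t + 1))]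
   (EFin \o u).
  apply: continuous_compact_integrable; first exact: segment_compact.
  by move=> x; apply: continuous_subspaceT => y; exact: cu.
have [dF eF] := continuous_FTC1 tt1 iu at_ (cu t).
by rewrite derive1E in eF; exact: DeriveDef dF eF.
Qed.

Lemma primitive_increment (a b M : R) (U u : R -> R) : a <= b ->
  (forall t, a <= t <= b -> is_derive t 1 U (u t)) ->
  (forall t, a <= t <= b -> `|u t| <= M) -> `|U b - U a| <= M * (b - a).
Proof.
rewrite le_eqVlt => /orP[/eqP<-|ab] dU uM; first by rewrite !subrr normr0 mulr0.
have [||c cab ->] := @MVT _ U u a b ab.
- by move=> x xab; apply: dU; move: xab; rewrite in_itv /= => /andP[/ltW -> /ltW ->].
- apply: derivable_within_continuous => x; rewrite in_itv /= => xab.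
  by have [] := dU x xab.
rewrite normrM (gtr0_norm (_ : 0 < b - a)) ?subr_gt0 // ler_pM2r ?subr_gt0 //.
by apply: uM; move: cab; rewrite in_itv /= => /andP[/ltW -> /ltW ->].
Qed.

End RealPrimitive.

Section Continuity.
Variables (R : realType) (T : topologicalType).
Local Notation C := (Num.NumField.sort (complex_complex__canonical__Num_NumField R)).
Implicit Types f g : T -> C.

Lemma continuousC_cst (c : C) : continuous (fun _ : T => c).
Proof. by move=> x; exact: cvg_cst. Qed.

Lemma continuousC_add f g : continuous f -> continuous g ->
  continuous (fun x => f x + g x).
Proof. by move=> cf cg x; apply: (@cvgD C); [exact: cf|exact: cg]. Qed.

Lemma continuousC_opp f : continuous f -> continuous (fun x => - f x).
Proof. by move=> cf x; apply: (@cvgN C); exact: cf. Qed.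

Lemma continuousC_sub f g : continuous f -> continuous g ->
  continuous (fun x => f x - g x).
Proof. by move=> cf cg x; apply: (@cvgB C); [exact: cf|exact: cg]. Qed.

Lemma continuousC_mul f g : continuous f -> continuous g ->
  continuous (fun x => f x * g x).
Proof. by move=> cf cg x; apply: (@cvgM C); [exact: cf|exact: cg]. Qed.

Lemma continuousC_inv f : (forall x, f x != 0) -> continuous f ->
  continuous (fun x => (f x)^-1).
Proof. by move=> f0 cf x; apply: (@cvgV C); [exact: f0|exact: cf]. Qed.

End Continuity.

Section ComplexNbhs.
Variable R : realType.
Local Notation C := (Num.NumField.sort (complex_complex__canonical__Num_NumField R)).

Lemma nbhsCP (z : C) (P : set C) :
  nbhs z P <-> exists e : R, 0 < e /\ forall w : C, cmod (w - z) < e -> P w.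
Proof.
split=> [/(@nbhs_ballP C)[e /= e0 eP]|[e [e0 eP]]].
  have eE : e = (complex.Re e)%:C%C by rewrite RRe_real // ger0_real // ltW.
  exists (complex.Re e); split; first by rewrite -ltcR -eE.
  move=> w zw; apply: eP; rewrite -ball_normE /ball_ /=.
  by rewrite distrC cmodE eE ltcR.
apply/(@nbhs_ballP C); exists e%:C%C => /=; first by rewrite ltcR.
move=> w; rewrite -ball_normE /ball_ /= distrC => zw; apply: eP.
by rewrite -ltcR -cmodE.
Qed.

Lemma cvgCP (T : Type) (F : set_system T) (FF : Filter F) (f : T -> C) (z : C) :
  (forall e : R, 0 < e -> \forall t \near F, cmod (f t - z) < e) -> f @ F --> z.
Proof.
move=> h P /nbhsCP[e [e0 eP]]; have := h e e0.
by apply: filterS => t; exact: eP.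
Qed.

Lemma cvgC_cmod (T : Type) (F : set_system T) (f : T -> C) (z : C) :
  f @ F --> z -> forall e : R, 0 < e -> \forall t \near F, cmod (f t - z) < e.
Proof.
move=> h e e0; apply: (h [set w : C | cmod (w - z) < e]).
by apply/nbhsCP; exists e.
Qed.

End ComplexNbhs.

(** * Integrals over real segments, defined through primitives *)

Section Primitive.
Variable R : realType.
Local Notation C := (Num.NumField.sort (complex_complex__canonical__Num_NumField R)).
Implicit Types (g h : R -> C) (G H : R -> C).

(* The squares used below all lie in the half plane [-2 < Re z, Im z]. *)
Definition primitive g G := forall t : R, -2 < t ->
  is_derive t 1 (fun s => complex.Re (G s)) (complex.Re (g t)) /\
  is_derive t 1 (fun s => complex.Im (G s)) (complex.Im (g t)).

Lemma Re_is_continuous : continuous (fun z : C => complex.Re z : R).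
Proof.
move=> z; apply/(@cvgrPdist_lt _ _ _ _ (@nbhs_filter C z)) => e e0; apply/nbhsCP; exists e; split=> // w.
rewrite cmod_distC => /(le_lt_trans _); apply.
by rewrite -raddfB; exact: cmod_Re.
Qed.

Lemma Im_is_continuous : continuous (fun z : C => complex.Im z : R).
Proof.
move=> z; apply/(@cvgrPdist_lt _ _ _ _ (@nbhs_filter C z)) => e e0; apply/nbhsCP; exists e; split=> // w.
rewrite cmod_distC => /(le_lt_trans _); apply.
by rewrite -raddfB; exact: cmod_Im.
Qed.

Lemma real_complex_is_continuous : continuous (fun x : R => x%:C%C : C).
Proof.
move=> x; apply: cvgCP => e e0; near=> y.
rewrite -rmorphB cmodR distrC; near: y; exact: cvgr_dist_lt.
Unshelve. all: by end_near. Qed.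

Lemma primitive_exists g : continuous g -> exists G, primitive g G.
Proof.
move=> cg.
have [U dU] := @continuous_primitive R (-2) (fun t => complex.Re (g t))
  (fun t => continuous_comp (cg t) (@Re_is_continuous _)).
have [V dV] := @continuous_primitive R (-2) (fun t => complex.Im (g t))
  (fun t => continuous_comp (cg t) (@Im_is_continuous _)).
by exists (fun t => U t +i* V t)%C => t t2; split; [exact: dU|exact: dV].
Qed.

Lemma primitiveD g h G H : primitive g G -> primitive h H ->
  primitive (fun t => g t + h t) (fun t => G t + H t).
Proof.
move=> pG pH t t2; have [dG1 dG2] := pG t t2; have [dH1 dH2] := pH t t2.
have -> : (fun s => complex.Re (G s + H s)) =
    (fun s => complex.Re (G s) + complex.Re (H s)) by apply/funext => s; rewrite raddfD.
have -> : (fun s => complex.Im (G s + H s)) =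
    (fun s => complex.Im (G s) + complex.Im (H s)) by apply/funext => s; rewrite raddfD.
by rewrite !raddfD; split; exact: is_deriveD.
Qed.

Lemma primitiveZ c g G : primitive g G ->
  primitive (fun t => c * g t) (fun t => c * G t).
Proof.
case: c => x y pG t t2; have [dG1 dG2] := pG t t2.
have e z : ((x +i* y)%C * z) = ((x * complex.Re z - y * complex.Im z) +i*
    (x * complex.Im z + y * complex.Re z))%C by case: z.
have -> : (fun s => complex.Re ((x +i* y)%C * G s)) =
    x \*: (fun s => complex.Re (G s)) - y \*: (fun s => complex.Im (G s)).
  by apply/funext => s; rewrite e.
have -> : (fun s => complex.Im ((x +i* y)%C * G s)) =
    x \*: (fun s => complex.Im (G s)) + y \*: (fun s => complex.Re (G s)).
  by apply/funext => s; rewrite e.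
by rewrite !e /=; split; [apply: is_deriveB|apply: is_deriveD].
Qed.

Lemma primitive_affine (c0 c1 : C) :
  primitive (fun t => c0 + c1 * t%:C%C) (fun t => c0 * t%:C%C + c1 * (t ^+ 2 / 2)%:C%C).
Proof.
have d1 (t : R) : is_derive t 1 (fun s : R => s) 1 by exact: is_derive_id.
have d2 (t : R) : is_derive t 1 (fun s : R => s ^+ 2 / 2) t.
  have -> : (fun s : R => s ^+ 2 / 2) = 2^-1 \*: (@id R ^+ 2).
    by apply/funext => s; rewrite /= mulrC.
  by apply: is_derive_eq; rewrite /GRing.scale /= mulr1 mulrA mulVf ?mul1r.
have p1 : primitive (fun=> 1) (fun t => t%:C%C).
  by move=> t _; split=> /=; [exact: d1|exact: is_derive_cst].
have p2 : primitive (fun t => t%:C%C) (fun t => (t ^+ 2 / 2)%:C%C).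
  by move=> t _; split=> /=; [exact: d2|exact: is_derive_cst].
have := primitiveD (primitiveZ c0 p1) (primitiveZ c1 p2).
by under [X in primitive X]eq_fun do rewrite mulr1.
Qed.

(** The mean value theorem is applied to the real and imaginary parts separately; this costs the
    factor 2, which propagates to the later constants. *)
Lemma primitive_bound g G a b M : primitive g G -> -2 < a -> a <= b ->
  (forall t, a <= t <= b -> cmod (g t) <= M) ->
  cmod (G b - G a) <= 2 * M * (b - a).
Proof.
move=> pG a2 ab gM; apply: (le_trans (cmod_le _)).
rewrite !raddfB -mulrA mulr_natl mulr2n.
have t2 t : a <= t <= b -> -2 < t by move=> /andP[/(lt_le_trans a2)].
by apply: lerD;
   [apply: (@primitive_increment _ a b M (fun t => complex.Re (G t)) (fun t => complex.Re (g t))) |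
    apply: (@primitive_increment _ a b M (fun t => complex.Im (G t)) (fun t => complex.Im (g t)))] => // t tab;
  [have [] := pG t (t2 t tab)|exact: le_trans (cmod_Re _) (gM t tab)
  |have [] := pG t (t2 t tab)|exact: le_trans (cmod_Im _) (gM t tab)].
Qed.

Lemma primitive_unique g G H a b : primitive g G -> primitive g H ->
  -2 < a -> a <= b -> G b - G a = H b - H a.
Proof.
move=> pG pH a2 ab; apply/eqP; rewrite -subr_eq0 -cmod_eq0 eq_le cmod_ge0 andbT.
have -> : G b - G a - (H b - H a) = (G b + -1 * H b) - (G a + -1 * H a) by ring.
have h t : a <= t <= b -> cmod (g t + -1 * g t) <= 0 by rewrite mulN1r subrr cmod0.
apply: le_trans (primitive_bound (primitiveD pG (primitiveZ (-1) pH)) a2 ab h) _.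
by rewrite mulr0 mul0r.
Qed.

(** The increment of some primitive, the zero function being the default if there is none.
    Additivity in the interval thus holds for every [g], and by [cintE] the choice of the primitive
    does not matter on segments to the right of -2. *)
Definition cint g (a b : R) : C :=
  let G := xget (fun=> 0) [set G | primitive g G] in G b - G a.

Lemma cintE g G a b : primitive g G -> -2 < a -> a <= b -> cint g a b = G b - G a.
Proof.
move=> pG a2 ab; rewrite /cint; case: xgetP => [H _ pH|/(_ G)//].
exact: primitive_unique pH pG a2 ab.
Qed.

Lemma cint_cat g a b c : cint g a c = cint g a b + cint g b c.
Proof. by rewrite /cint /=; ring. Qed.

Lemma cintD g h a b : continuous g -> continuous h -> -2 < a -> a <= b ->
  cint (fun t => g t + h t) a b = cint g a b + cint h a b.
Proof.
move=> /primitive_exists[G pG] /primitive_exists[H pH] a2 ab.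
rewrite (cintE pG) // (cintE pH) // (cintE (primitiveD pG pH)) //.
by rewrite opprD addrACA.
Qed.

Lemma cintZ c g a b : continuous g -> -2 < a -> a <= b ->
  cint (fun t => c * g t) a b = c * cint g a b.
Proof.
move=> /primitive_exists[G pG] a2 ab.
by rewrite (cintE pG) // (cintE (primitiveZ c pG)) // mulrBr.
Qed.

Lemma cint_bound g a b M : continuous g -> -2 < a -> a <= b ->
  (forall t, a <= t <= b -> cmod (g t) <= M) ->
  cmod (cint g a b) <= 2 * M * (b - a).
Proof.
move=> /primitive_exists[G pG] a2 ab gM; rewrite (cintE pG) //.
exact: primitive_bound pG _ _ _.
Qed.

Lemma cint_affine c0 c1 a b : -2 < a -> a <= b ->
  cint (fun t => c0 + c1 * t%:C%C) a b =
  c0 * (b - a)%:C%C + c1 * ((b ^+ 2 - a ^+ 2) / 2)%:C%C.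
Proof.
move=> a2 ab; rewrite (cintE (primitive_affine c0 c1)) //.
by rewrite opprD addrACA -!mulrBr -!rmorphB mulrBl.
Qed.

(** Serves for [square_kernel0_ge4], where the integrand is purely imaginary. *)
Lemma cint_Im_ge g a b m : continuous g -> -2 < a -> a < b ->
  (forall t, a <= t <= b -> m <= complex.Im (g t)) ->
  m * (b - a) <= complex.Im (cint g a b).
Proof.
move=> /primitive_exists[G pG] a2 ab gm; rewrite (cintE pG) // ?(ltW ab) // raddfB.
have dG t : a <= t <= b -> is_derive t 1 (fun s => complex.Im (G s)) (complex.Im (g t)).
  by move=> /andP[/(lt_le_trans a2) t2 _]; have [] := pG t t2.
have [||c cab ->] := @MVT _ (fun s => complex.Im (G s)) (fun s => complex.Im (g s)) a b ab.
- by move=> x xab; apply: dG; move: xab; rewrite in_itv /= => /andP[/ltW -> /ltW ->].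
- apply: derivable_within_continuous => x; rewrite in_itv /= => xab.
  by have [] := dG x xab.
rewrite ler_pM2r ?subr_gt0 //; apply: gm.
by move: cab; rewrite in_itv /= => /andP[/ltW -> /ltW ->].
Qed.

End Primitive.

(** * Goursat's theorem for squares *)

Section Bisection.
Variable R : realType.
Implicit Types x y s h u v : R.

Lemma halving_small (s d : R) : 0 < d -> exists n, s / 2 ^+ n < d.
Proof.
move=> d0; have [n sn] : exists n : nat, s / d < n%:R.
  exists (Num.Def.archi_bound `|s / d|).
  exact: le_lt_trans (ler_norm _) (archi_boundP (normr_ge0 _)).
exists n; rewrite ltr_pdivrMr ?exprn_gt0 // mulrC -ltr_pdivrMr //.
by apply: (lt_trans sn); rewrite -natrX ltr_nat ltn_expl.
Qed.

(** [P x y s] speaks of the square with lower left corner (x, y) and side s. If it fails, it fails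
    on one of the four quarters; the nested failing squares shrink to a point, where the local
    hypothesis is contradicted. *)
Lemma square_bisection (P : R -> R -> R -> Prop) x0 y0 s0 : 0 < s0 ->
  (forall x y h, 0 < h -> P x y h -> P (x + h) y h -> P x (y + h) h ->
     P (x + h) (y + h) h -> P x y (h + h)) ->
  (forall u v, x0 <= u <= x0 + s0 -> y0 <= v <= y0 + s0 ->
     exists d, 0 < d /\ forall x y s, 0 < s < d ->
       x0 <= x -> x + s <= x0 + s0 -> y0 <= y -> y + s <= y0 + s0 ->
       x <= u <= x + s -> y <= v <= y + s -> P x y s) ->
  P x0 y0 s0.
Proof.
move=> s0_gt0 P4 Ploc; apply: contrapT => nP0.
pose sq n := s0 / 2 ^+ n.
have sq_gt0 n : 0 < sq n by rewrite divr_gt0 // exprn_gt0.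
have sqS n : sq n = sq n.+1 + sq n.+1.
  have p0 : (2 ^+ n : R) != 0 by rewrite expf_neq0 // pnatr_eq0.
  by rewrite /sq exprSr; field.
pose sub n (c c' : R * R) := (c.1 <= c'.1 /\ c'.1 + sq n.+1 <= c.1 + sq n) /\
  (c.2 <= c'.2 /\ c'.2 + sq n.+1 <= c.2 + sq n).
(* The failure of [P] is assumed under the existential, so that choice yields a total function [nx]
   on corners. *)
have step n (c : R * R) : exists c', ~ P c.1 c.2 (sq n) ->
    ~ P c'.1 c'.2 (sq n.+1) /\ sub n c c'.
  have [Pc|nPc] := pselect (P c.1 c.2 (sq n)); first by exists c.
  have q0 := ltW (sq_gt0 n.+1).
  have sub' a b : 0 <= a <= sq n.+1 -> 0 <= b <= sq n.+1 -> sub n c (c.1 + a, c.2 + b).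
    move=> /andP[a0 a1] /andP[b0 b1]; by rewrite /sub (sqS n) /=; split; split; lra.
  apply: contrapT => nex; apply: nPc; rewrite (sqS n).
  have all4 a b : 0 <= a <= sq n.+1 -> 0 <= b <= sq n.+1 ->
      P (c.1 + a) (c.2 + b) (sq n.+1).
    move=> ha hb; apply: contrapT => nPab; apply: nex.
    by exists (c.1 + a, c.2 + b) => _; split => //; exact: sub'.
  have h0 : 0 <= (0 : R) <= sq n.+1 by rewrite lexx.
  have h1 : 0 <= sq n.+1 <= sq n.+1 by rewrite lexx q0.
  apply: P4 => //.
  - by have := all4 0 0 h0 h0; rewrite !addr0.
  - by have := all4 _ 0 h1 h0; rewrite addr0.
  - by have := all4 0 _ h0 h1; rewrite addr0.
  - exact: all4.
pose nx n c := sval (cid (step n c)).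
pose fix cs n := if n is k.+1 then nx k (cs k) else (x0, y0).
have cP n : ~ P (cs n).1 (cs n).2 (sq n).
  elim: n => [|n IH]; first by rewrite /sq expr0 divr1.
  by have [] := svalP (cid (step n (cs n))) IH.
have cS n : sub n (cs n) (cs n.+1) by have [] := svalP (cid (step n (cs n))) (cP n).
(* Nested intervals in one coordinate: the supremum of the left ends lies in all of them. *)
have nest (f : nat -> R) : (forall n, f n <= f n.+1 /\ f n.+1 + sq n.+1 <= f n + sq n) ->
    exists u, forall n, f n <= u <= f n + sq n.
  move=> fS.
  have up n k : f n <= f (n + k)%N.
    by elim: k => [|k IH]; rewrite ?addn0 // addnS; exact: le_trans IH (fS _).1.
  have dn n k : f (n + k)%N + sq (n + k)%N <= f n + sq n.
    by elim: k => [|k IH]; rewrite ?addn0 // addnS; exact: le_trans (fS _).2 IH.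
  have ub n : ubound (range f) (f n + sq n).
    move=> _ [m _ <-]; have [mn|/ltnW nm] := leqP m n.
      rewrite -(subnKC mn); apply: (le_trans (up m (n - m)%N)).
      by rewrite lerDl ltW.
    rewrite -(subnKC nm); apply: le_trans (dn n (m - n)%N).
    by rewrite lerDl ltW.
  have hs : has_sup (range f) by split; [exists (f 0%N), 0%N|exists (f 0%N + sq 0%N); exact: ub].
  exists (sup (range f)) => n; apply/andP; split.
    by apply: sup_upper_bound => //; exists n.
  by apply: ge_sup; [case: hs|exact: ub].
have [u hu] := nest (fun n => (cs n).1) (fun n => (cS n).1).
have [v hv] := nest (fun n => (cs n).2) (fun n => (cS n).2).
have sq0 : sq 0%N = s0 by rewrite /sq expr0 divr1.
have [||d [d0 dP]] := Ploc u v.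
- by have := hu 0%N; rewrite sq0.
- by have := hv 0%N; rewrite sq0.
have [n nd] := halving_small s0 d0.
have mono n' : x0 <= (cs n').1 /\ (cs n').1 + sq n' <= x0 + s0 /\
    (y0 <= (cs n').2 /\ (cs n').2 + sq n' <= y0 + s0).
  elim: n' => [|k [h1 [h2 [h3 h4]]]]; first by rewrite sq0 /= !lexx.
  have [[g1 g2] [g3 g4]] := cS k.
  by split; [exact: le_trans g1|split; [exact: le_trans h2|split; [exact: le_trans g3|exact: le_trans h4]]].
have [h1 [h2 [h3 h4]]] := mono n.
by apply: (cP n); apply: dP => //; rewrite sq_gt0.
Qed.

End Bisection.

Section Goursat.
Variable R : realType.
Local Notation C := (Num.NumField.sort (complex_complex__canonical__Num_NumField R)).
Implicit Types (q : C -> C) (x y s t : R) (z w c d : C).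

Definition cpt x y : C := (x +i* y)%C.

Lemma cptE x y : cpt x y = x%:C%C + 'i%C * y%:C%C.
Proof. by rewrite [LHS]complexW. Qed.

Lemma continuous_hline y : continuous (fun t => cpt t y).
Proof.
move=> t; rewrite (_ : (fun t => cpt t y) = fun t => t%:C%C + 'i%C * y%:C%C).
  apply: continuousC_add; [exact: real_complex_is_continuous|exact: continuousC_cst].
by apply/funext => u; rewrite cptE.
Qed.

Lemma continuous_vline x : continuous (fun t => cpt x t).
Proof.
move=> t; rewrite (_ : (fun t => cpt x t) = fun t => x%:C%C + 'i%C * t%:C%C).
  apply: continuousC_add; first exact: continuousC_cst.
  apply: continuousC_mul; [exact: continuousC_cst|exact: real_complex_is_continuous].
by apply/funext => u; rewrite cptE.
Qed.

Lemma continuousC_comp (f : R -> C) q : continuous q -> continuous f ->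
  continuous (fun t => q (f t)).
Proof. by move=> cq cf t; apply: (@continuous_comp _ C C f q); [exact: cf|exact: cq]. Qed.

(** The contour integral of q(z) dz along the boundary, counterclockwise from the lower side; the
    vertical sides carry dz = i dt. *)
Definition square_integral q x y s : C :=
  cint (fun t => q (cpt t y)) x (x + s)
  + 'i%C * cint (fun t => q (cpt (x + s) t)) y (y + s)
  - cint (fun t => q (cpt t (y + s))) x (x + s)
  - 'i%C * cint (fun t => q (cpt x t)) y (y + s).

Lemma square_integral4 q x y h : square_integral q x y (h + h) =
  square_integral q x y h + square_integral q (x + h) y h
  + square_integral q x (y + h) h + square_integral q (x + h) (y + h) h.
Proof.
rewrite /square_integral (addrA x h h) (addrA y h h).
rewrite (cint_cat _ x (x + h) (x + h + h)) (cint_cat _ y (y + h) (y + h + h)).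
rewrite (cint_cat (fun t => q (cpt t (y + h + h))) x (x + h) (x + h + h)).
rewrite (cint_cat (fun t => q (cpt x t)) y (y + h) (y + h + h)).
ring.
Qed.

Lemma square_integral_affine c0 c1 x y s : -2 < x -> -2 < y -> 0 <= s ->
  square_integral (fun z => c0 + c1 * z) x y s = 0.
Proof.
move=> x2 y2 s0.
have xs : x <= x + s by rewrite lerDl.
have ys : y <= y + s by rewrite lerDl.
have hE u : (fun t => c0 + c1 * cpt t u) = (fun t => (c0 + c1 * ('i%C * u%:C%C)) + c1 * t%:C%C).
  by apply/funext => t; rewrite cptE; ring.
have vE u : (fun t => c0 + c1 * cpt u t) = (fun t => (c0 + c1 * u%:C%C) + (c1 * 'i%C) * t%:C%C).
  by apply/funext => t; rewrite cptE; ring.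
rewrite /square_integral !hE // !vE // !cint_affine //.
have -> : x + s - x = s by ring.
have -> : y + s - y = s by ring.
have e (u : R) : ((u + s) ^+ 2 - u ^+ 2) / 2 = u * s + s ^+ 2 / 2 by field.
rewrite !e !(rmorphD, rmorphM, rmorphXn) /=.
ring.
Qed.

Lemma square_integral_bound q x y s M : continuous q ->
  -2 < x -> -2 < y -> 0 <= s ->
  (forall u v, x <= u <= x + s -> y <= v <= y + s -> cmod (q (cpt u v)) <= M) ->
  cmod (square_integral q x y s) <= 8 * M * s.
Proof.
move=> cq x2 y2 s0 qM.
have xs : x <= x + s by rewrite lerDl.
have ys : y <= y + s by rewrite lerDl.
have ex (a : R) : a + s - a = s by ring.
have hb v : y <= v <= y + s -> cmod (cint (fun t => q (cpt t v)) x (x + s)) <= 2 * M * s.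
  move=> hv; rewrite -[X in _ <= _ * X](ex x); apply: cint_bound => //.
    by apply: continuousC_comp => //; exact: continuous_hline.
  by move=> t ht; exact: qM.
have vb u : x <= u <= x + s -> cmod ('i%C * cint (fun t => q (cpt u t)) y (y + s)) <= 2 * M * s.
  move=> hu; rewrite cmodM cmod_i mul1r -[X in _ <= _ * X](ex y); apply: cint_bound => //.
    by apply: continuousC_comp => //; exact: continuous_vline.
  by move=> t ht; exact: qM.
rewrite /square_integral.
have xx : x <= x <= x + s by rewrite lexx.
have xxs : x <= x + s <= x + s by rewrite lexx xs.
have yy : y <= y <= y + s by rewrite lexx.
have yys : y <= y + s <= y + s by rewrite lexx ys.
apply: le_trans (cmodB _ _) _; apply: (le_trans (lerD (le_trans (cmodB _ _)
  (lerD (le_trans (cmodD _ _) (lerD (hb _ yy) (vb _ xxs))) (hb _ yys))) (vb _ xx))).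
by lra.
Qed.

(** In Goursat's argument the tangent map at a point is removed from [q] in this way, so that only
    its remainder is integrated. *)
Lemma square_integral_sub_affine q c0 c1 x y s : continuous q ->
  -2 < x -> -2 < y -> 0 <= s ->
  square_integral (fun z => q z - (c0 + c1 * z)) x y s = square_integral q x y s.
Proof.
move=> cq x2 y2 s0.
have ca : continuous (fun z : C => - (c0 + c1 * z)).
  apply: continuousC_opp; apply: continuousC_add; first exact: continuousC_cst.
  by apply: continuousC_mul; [exact: continuousC_cst|move=> z; exact: cvg_id].
rewrite -[RHS]addr0 -(square_integral_affine (- c0) (- c1) x2 y2 s0) /square_integral.
have xs : x <= x + s by rewrite lerDl.
have ys : y <= y + s by rewrite lerDl.
have eq_ (f : R -> C) : (fun t => - c0 + - c1 * f t) = (fun t => - (c0 + c1 * f t)).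
  by apply/funext => t; ring.
have hD v : cint (fun t => q (cpt t v) - (c0 + c1 * cpt t v)) x (x + s) =
    cint (fun t => q (cpt t v)) x (x + s) + cint (fun t => - c0 + - c1 * cpt t v) x (x + s).
  rewrite (eq_ (fun t => cpt t v)).
  by apply: cintD => //; [apply: (@continuousC_comp _ q)|
    apply: (@continuousC_comp _ (fun z => - (c0 + c1 * z)))] => //; exact: continuous_hline.
have vD u : cint (fun t => q (cpt u t) - (c0 + c1 * cpt u t)) y (y + s) =
    cint (fun t => q (cpt u t)) y (y + s) + cint (fun t => - c0 + - c1 * cpt u t) y (y + s).
  rewrite (eq_ (fun t => cpt u t)).
  by apply: cintD => //; [apply: (@continuousC_comp _ q)|
    apply: (@continuousC_comp _ (fun z => - (c0 + c1 * z)))] => //; exact: continuous_vline.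
rewrite !hD !vD; ring.
Qed.

Lemma continuous_sub_affine q c0 c1 : continuous q ->
  continuous (fun z => q z - (c0 + c1 * z)).
Proof.
move=> cq; have cc c := @continuousC_cst R C c.
have cid : continuous (fun z : C => z) by move=> z; exact: cvg_id.
exact: (continuousC_sub cq (continuousC_add (cc c0) (continuousC_mul (cc c1) cid))).
Qed.

Definition has_cderiv q z d := forall e : R, 0 < e -> exists r : R, 0 < r /\
  forall w, cmod (w - z) < r -> cmod (q w - q z - d * (w - z)) <= e * cmod (w - z).

(** The sum of the indicators of the two half-open intervals with ends x and x + s: it is exactly
    additive under halving, and still at least 1 at every point of the closed interval. *)
Definition square_weight (u x s : R) : R :=
  (x <= u < x + s)%R%:R + (x < u <= x + s)%R%:R.

Lemma square_weight_half (u x h : R) : 0 < h ->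
  square_weight u x (h + h) = square_weight u x h + square_weight u (x + h) h.
Proof.
move=> h0; rewrite /square_weight addrA.
have xh : x < x + h by rewrite ltrDl.
have xhh : x + h < x + h + h by rewrite ltrDl.
case: (ltrgtP u x) => hux; case: (ltrgtP u (x + h)) => hu1;
  case: (ltrgtP u (x + h + h)) => hu2; rewrite /= ?addr0 ?add0r //; lra.
Qed.

Lemma square_weight_ge1 (u x s : R) : 0 < s -> x <= u <= x + s -> 1 <= square_weight u x s.
Proof.
move=> s0 /andP[]; rewrite /square_weight.
case: (ltrgtP x u) => // hxu _; case: (ltrgtP u (x + s)) => //= hux _; lra.
Qed.

Lemma square_weight_ge0 (u x s : R) : 0 <= square_weight u x s.
Proof. by rewrite addr_ge0. Qed.

Lemma square_weight_le2 (u x s : R) : square_weight u x s <= 2.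
Proof. by rewrite /square_weight; do 2 case: (_ && _); rewrite /=; lra. Qed.

(* A single point where q is merely continuous is allowed: in the bisection it
   is charged a fixed error, shared by the at most four squares of a
   generation that contain it. *)
Lemma goursat q x0 y0 s0 (z0 : C) : continuous q ->
  -2 < x0 -> -2 < y0 -> 0 < s0 ->
  (forall u v, x0 <= u <= x0 + s0 -> y0 <= v <= y0 + s0 -> cpt u v != z0 ->
     exists d, has_cderiv q (cpt u v) d) ->
  square_integral q x0 y0 s0 = 0.
Proof.
move=> cq x2 y2 s0_gt0 dq.
pose u0 := complex.Re z0; pose v0 := complex.Im z0.
have z0E : z0 = cpt u0 v0 by rewrite /cpt /u0 /v0; case: (z0).
suff main e : 0 < e -> cmod (square_integral q x0 y0 s0) <= e * (16 * s0 ^+ 2 + 4).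
  apply/eqP; rewrite -cmod_eq0 eq_le cmod_ge0 andbT.
  have B0 : 0 < 16 * s0 ^+ 2 + 4 by have := sqr_ge0 s0; lra.
  apply/ler_addgt0Pr => e e0; rewrite add0r.
  by have := main _ (divr_gt0 e0 B0); rewrite divfK // gt_eqF.
(* [nu] is exactly additive under division into four quarters: so is the area, and so is the product
   of the weights by [square_weight_half]. The 16 comes from the bound 8 M s with M = e * 2 s, the 4
   in the claim from weights at most 2. *)
move=> e0; pose nu x y s := e * (16 * s ^+ 2 + square_weight u0 x s * square_weight v0 y s).
apply: (@le_trans _ _ (nu x0 y0 s0)); last first.
  rewrite ler_pM2l // lerD2l.
  have := ler_pM (square_weight_ge0 u0 x0 s0) (square_weight_ge0 v0 y0 s0)
    (square_weight_le2 u0 x0 s0) (square_weight_le2 v0 y0 s0); lra.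
apply: (@square_bisection _ (fun x y s => cmod (square_integral q x y s) <= nu x y s)) => //.
  move=> x y h h0; rewrite square_integral4 /nu !square_weight_half //.
  set a := square_integral _ _ _ _; set b := square_integral _ _ _ _.
  set c := square_integral _ _ _ _; set d := square_integral _ _ _ _.
  have := cmodD (a + b + c) d; have := cmodD (a + b) c; have := cmodD a b.
  move=> h1 h2 h3 h4 h5 h6 h7; apply: (le_trans h3).
  apply: (le_trans (lerD (le_trans h2 (lerD (le_trans h1 (lerD h4 h5)) h6)) h7)).
  by lra.
move=> u v hu hv.
have sq_small x y s a b : 0 < s -> x <= u <= x + s -> y <= v <= y + s ->
    x <= a <= x + s -> y <= b <= y + s -> cmod (cpt a b - cpt u v) <= 2 * s.
  move=> s0' /andP[h1 h2] /andP[h3 h4] /andP[h5 h6] /andP[h7 h8].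
  apply: (le_trans (cmod_le _)) => /=.
  have := ler_norml (a - u) s; have := ler_norml (b - v) s.
  have -> : - s <= a - u <= s by apply/andP; split; lra.
  have -> : - s <= b - v <= s by apply/andP; split; lra.
  lra.
have [uv0|nuv0] := eqVneq (cpt u v) z0.
  have [uu vv] : u = u0 /\ v = v0 by move: uv0; rewrite z0E => -[].
  have /nbhsCP[r [r0 hr]] := @cvgC_cmod R C _ q _ (cq z0) 1 ltr01.
  (* At the exceptional point only |q - q(z0)| <= 1 is available; the resulting bound 8 s < e is
     absorbed by the product of the weights, which is at least 1 on this square. *)
  exists (Num.min (r / 2) (e / 8)); split; first by rewrite lt_min !divr_gt0.
  move=> x y s /andP[s_gt0]; rewrite lt_min => /andP[sr se] hx hxs hy hys hxu hyv.
  rewrite -(square_integral_sub_affine (q z0) 0) //; [|lra..].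
  apply: (@le_trans _ _ (8 * 1 * s)).
    apply: square_integral_bound; [| lra..|].
      exact: (continuous_sub_affine cq).
    move=> a b ha hb; rewrite mul0r addr0; apply: ltW; apply: hr.
    rewrite -uv0; apply: (le_lt_trans (@sq_small x y s a b _ _ _ _ _)) => //; lra.
  apply: (@le_trans _ _ e); first lra.
  rewrite /nu -{1}(mulr1 e) ler_pM2l // -uu -vv.
  have w1 := square_weight_ge1 s_gt0 hxu; have w2 := square_weight_ge1 s_gt0 hyv.
  have := ler_pM ler01 ler01 w1 w2; have := sqr_ge0 s; lra.
have [d hd] := dq u v hu hv nuv0.
have [r [r0 hr]] := hd e e0.
exists (r / 2); split; first by rewrite divr_gt0.
move=> x y s /andP[s_gt0 sr] hx hxs hy hys hxu hyv.
rewrite -(square_integral_sub_affine (q (cpt u v) - d * cpt u v) d) //; [|lra..].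
apply: (@le_trans _ _ (8 * (e * (2 * s)) * s)).
  apply: square_integral_bound; [| lra..|].
    exact: (continuous_sub_affine cq).
  move=> a b ha hb.
  have sab := sq_small x y s a b s_gt0 hxu hyv ha hb.
  have -> : q (cpt a b) - (q (cpt u v) - d * cpt u v + d * cpt a b) =
     q (cpt a b) - q (cpt u v) - d * (cpt a b - cpt u v) by ring.
  apply: (le_trans (hr _ _)); first by apply: (le_lt_trans sab); lra.
  by rewrite ler_pM2l.
rewrite /nu (_ : 8 * _ * _ = e * (16 * s ^+ 2)); last by ring.
rewrite ler_pM2l // lerDl mulr_ge0 //; exact: square_weight_ge0.
Qed.

End Goursat.

(** * Cauchy's formula on the square with vertices at 1 + i and its rotations *)

Section Cauchy.
Variable R : realType.
Local Notation C := (Num.NumField.sort (complex_complex__canonical__Num_NumField R)).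
Implicit Types (f g q : C -> C) (x y s t : R) (z w c d : C).

Lemma has_cderiv_continuous f z d : has_cderiv f z d -> {for z, continuous f}.
Proof.
move=> fd; apply: (@cvgCP R C _ (@nbhs_filter C z)) => e e0; apply/nbhsCP.
have [r [r0 hr]] := fd 1 ltr01.
have D0 : 0 < 1 + cmod d by have := cmod_ge0 d; lra.
exists (Num.min r (e / (1 + cmod d))); split; first by rewrite lt_min r0 divr_gt0.
move=> w; rewrite lt_min ltr_pdivlMr // => /andP[wr we].
have := hr w wr; have := cmodD (f w - f z - d * (w - z)) (d * (w - z)).
rewrite subrK cmodM; lra.
Qed.

(** The integrands of Cauchy's formula have a pole inside the square, so continuity is asked only
    along the four lines that carry its sides. *)
Definition side_continuous g :=
  [/\ continuous (fun t => g (cpt t (-1))), continuous (fun t => g (cpt 1 t)),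
      continuous (fun t => g (cpt t 1)) & continuous (fun t => g (cpt (-1) t))].

Lemma continuous_side g : continuous g -> side_continuous g.
Proof.
by move=> cg; split; apply: (@continuousC_comp _ _ g) => //;
  (exact: continuous_hline || exact: continuous_vline).
Qed.

Lemma side_continuousD f g : side_continuous f -> side_continuous g ->
  side_continuous (fun z => f z + g z).
Proof.
move=> [f1 f2 f3 f4] [g1 g2 g3 g4]; split;
  [exact: (continuousC_add f1 g1)|exact: (continuousC_add f2 g2)
  |exact: (continuousC_add f3 g3)|exact: (continuousC_add f4 g4)].
Qed.

Lemma side_continuousM f g : side_continuous f -> side_continuous g ->
  side_continuous (fun z => f z * g z).
Proof.
move=> [f1 f2 f3 f4] [g1 g2 g3 g4]; split;
  [exact: (continuousC_mul f1 g1)|exact: (continuousC_mul f2 g2)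
  |exact: (continuousC_mul f3 g3)|exact: (continuousC_mul f4 g4)].
Qed.

Definition on_side (P : C -> Prop) := forall t, -1 <= t <= 1 ->
  [/\ P (cpt t (-1)), P (cpt 1 t), P (cpt t 1) & P (cpt (-1) t)].

Lemma cpt_sub_neq0 x y z : cmod z < 1 -> (`|x| == 1) || (`|y| == 1) -> cpt x y - z != 0.
Proof.
move=> z1 xy1; apply/eqP => /eqP; rewrite subr_eq0 => /eqP exy.
have := cmod_Re z; have := cmod_Im z; rewrite -exy /=.
by case/orP: xy1 => /eqP ->; move: z1; rewrite -exy; lra.
Qed.

Lemma side_continuousV z : cmod z < 1 -> side_continuous (fun w => (w - z)^-1).
Proof.
move=> z1; split; apply: continuousC_inv.
1,3,5,7: by move=> t; apply: cpt_sub_neq0 => //; rewrite ?normrN !normr1 eqxx ?orbT.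
all: apply: continuousC_sub; last exact: continuousC_cst.
all: (exact: continuous_hline || exact: continuous_vline).
Qed.

(** The four sides are gathered in a single integral over [-1, 1], so that linearity and bounds are
    established once. *)
Definition unit_square_integral g := cint (fun t =>
  g (cpt t (-1)) + 'i%C * g (cpt 1 t) + -1 * g (cpt t 1) + - 'i%C * g (cpt (-1) t)) (-1) 1.

Lemma unit_square_integrandE g : side_continuous g -> continuous (fun t =>
  g (cpt t (-1)) + 'i%C * g (cpt 1 t) + -1 * g (cpt t 1) + - 'i%C * g (cpt (-1) t) : C).
Proof.
move=> [c1 c2 c3 c4]; have cc c := @continuousC_cst R R c.
have := continuousC_add (continuousC_add (continuousC_add c1 (continuousC_mul (cc 'i%C) c2))
  (continuousC_mul (cc (-1)) c3)) (continuousC_mul (cc (- 'i%C)) c4).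
exact.
Qed.

Lemma unit_square_integralE g : side_continuous g ->
  unit_square_integral g = square_integral g (-1) (-1) 2.
Proof.
move=> [c1 c2 c3 c4]; have cc c := @continuousC_cst R R c.
rewrite /unit_square_integral /square_integral (_ : -1 + 2 = 1); last by ring.
have m2 : -2 < -1 :> R by lra.
have m1 : -1 <= 1 :> R by lra.
have d2 := continuousC_mul (cc 'i%C) c2; have d3 := continuousC_mul (cc (-1)) c3.
have d4 := continuousC_mul (cc (- 'i%C)) c4.
rewrite (cintD (continuousC_add (continuousC_add c1 d2) d3) d4) //.
rewrite (cintD (continuousC_add c1 d2) d3) // (cintD c1 d2) //.
by rewrite (cintZ _ c2) // (cintZ _ c3) // (cintZ _ c4) //; ring.
Qed.

Lemma unit_square_integralZD c f g : side_continuous f -> side_continuous g ->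
  unit_square_integral (fun z => c * f z + g z) =
  c * unit_square_integral f + unit_square_integral g.
Proof.
move=> cf cg; have cc (a : C) := @continuousC_cst R R a.
have m2 : -2 < -1 :> R by lra.
have m1 : -1 <= 1 :> R by lra.
have If := unit_square_integrandE cf; have Ig := unit_square_integrandE cg.
rewrite /unit_square_integral -(cintZ c If) // -(cintD (continuousC_mul (cc c) If) Ig) //.
by congr cint; apply/funext => t; ring.
Qed.

Lemma unit_square_integral_bound g M : side_continuous g ->
  on_side (fun z => cmod (g z) <= M) -> cmod (unit_square_integral g) <= 16 * M.
Proof.
move=> cg gM; have -> : 16 * M = 2 * (4 * M) * (1 - -1) by ring.
apply: cint_bound; [exact: unit_square_integrandE| lra | lra |] => t /gM[h1 h2 h3 h4].
apply: le_trans (cmodD _ _) _; apply: le_trans (lerD (le_trans (cmodD _ _)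
  (lerD (cmodD _ _) (lexx _))) (lexx _)) _.
by rewrite !cmodM !cmodN cmod_i cmod1 !mul1r; lra.
Qed.

Lemma quotient_has_cderiv f z w d : z != w -> has_cderiv f w d ->
  exists d', has_cderiv (fun u => (f u - f z) / (u - z)) w d'.
Proof.
move=> zw fd.
have wz0 : w - z != 0 by rewrite subr_eq0 eq_sym.
have wzm : 0 < cmod (w - z) by rewrite cmod_gt0.
set A := f w - f z.
exists (d / (w - z) - A / (w - z) ^+ 2) => e e0.
set m := cmod (w - z) in wzm *.
have D0 : 0 < 1 + cmod d / m + cmod A / m ^+ 2.
  by have := divr_ge0 (cmod_ge0 d) (ltW wzm);
     have := divr_ge0 (cmod_ge0 A) (exprn_ge0 2 (ltW wzm)); lra.
set K := 1 + _ + _ in D0.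
have em0 : 0 < e * m / 4 by rewrite divr_gt0 // mulr_gt0.
have [r [r0 hr]] := fd _ em0.
(* [m / 2] keeps [u] at distance at least [m / 2] from [z]; the other two radii bound the remainder
   of [f] and the quadratic term by [e * m / 4 * cmod (u - w)] each. *)
exists (Num.min r (Num.min (m / 2) (e * m / (4 * K)))).
split; first by rewrite !lt_min r0 !divr_gt0 // ?mulr_gt0.
move=> u; rewrite !lt_min => /andP[ur /andP[um ue]].
have := hr u ur.
set E := f u - f w - d * (u - w) => hE.
have uz : m / 2 <= cmod (u - z).
  have := cmodB (u - z) (u - w).
  have -> : u - z - (u - w) = w - z by ring.
  rewrite -/m; lra.
have uz0 : u - z != 0 by rewrite -cmod_gt0; apply: lt_le_trans uz; rewrite divr_gt0.
have -> : (f u - f z) / (u - z) - A / (w - z) -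
   (d / (w - z) - A / (w - z) ^+ 2) * (u - w) =
   (E - (d / (w - z) - A / (w - z) ^+ 2) * (u - w) ^+ 2) / (u - z).
  rewrite /E /A; field; apply/andP; split=> //.
rewrite cmodM cmodV ler_pdivrMr; last by apply: lt_le_trans uz; rewrite divr_gt0.
apply: (le_trans (cmodB _ _)).
have h1 : cmod ((d / (w - z) - A / (w - z) ^+ 2) * (u - w) ^+ 2) <=
    K * cmod (u - w) ^+ 2.
  rewrite cmodM cmodX ler_wpM2r ?exprn_ge0 ?cmod_ge0 //.
  apply: (le_trans (cmodB _ _)); rewrite !cmodM !cmodV cmodX -/m /K; lra.
have h2 : K * cmod (u - w) ^+ 2 <= e * m / 4 * cmod (u - w).
  rewrite expr2 mulrA ler_wpM2r ?cmod_ge0 //.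
  have : 4 * K * cmod (u - w) <= e * m by rewrite mulrC -ler_pdivlMr ?mulr_gt0 // ltW.
  lra.
have h3 : e * cmod (u - w) * (m / 2) <= e * cmod (u - w) * cmod (u - z).
  by rewrite ler_wpM2l // mulr_ge0 ?cmod_ge0 // ltW.
lra.
Qed.

(** Classically this is 2 pi i for |z| < 1. It is kept as an unevaluated function of [z], bounded
    away from 0 near 0. *)
Definition square_kernel z := unit_square_integral (fun w => (w - z)^-1).

(** Goursat's theorem is applied to the difference quotient of [f] at [z], completed by the
    derivative. At [z] itself this function is only known to be continuous, which is the reason for
    the exceptional point in [goursat]. *)
Lemma cauchy_formula f z : continuous f -> cmod z < 1 ->
  (forall u v, -1 <= u <= 1 -> -1 <= v <= 1 -> exists d, has_cderiv f (cpt u v) d) ->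
  unit_square_integral (fun w => f w / (w - z)) = f z * square_kernel z.
Proof.
move=> cf z1 df.
have [dz fdz] : exists d, has_cderiv f z d.
  rewrite (_ : z = cpt (complex.Re z) (complex.Im z)); last by case: (z).
  by apply: df; rewrite -ler_norml; apply: ltW; apply: le_lt_trans z1;
    [exact: cmod_Re|exact: cmod_Im].
pose q w := if w == z then dz else (f w - f z) / (w - z).
have qE w : w != z -> q w = (f w - f z) / (w - z) by rewrite /q => /negPf ->.
have cder u v : cpt u v != z -> (exists d, has_cderiv f (cpt u v) d) ->
    exists d, has_cderiv q (cpt u v) d.
  move=> uvz [d fd]; have zuv : z != cpt u v by rewrite eq_sym.
  have [d' hd'] := quotient_has_cderiv zuv fd; exists d' => e e0.
  have [r [r0 hr]] := hd' e e0.
  exists (Num.min r (cmod (cpt u v - z))).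
  split; first by rewrite lt_min r0 cmod_gt0 subr_eq0.
  move=> w; rewrite lt_min => /andP[wr wz]; rewrite !qE //; first exact: hr.
  by apply/eqP => wz'; move: wz; rewrite wz' cmod_distC ltxx.
have cq : continuous q.
  move=> w; have [->|wz] := eqVneq w z.
    apply: (@cvgCP R C _ (@nbhs_filter C z)) => e e0; apply/nbhsCP.
    have e20 : 0 < e / 2 by rewrite divr_gt0.
    have [r [r0 hr]] := fdz _ e20; exists r; split=> // w' wr.
    rewrite {2}/q eqxx.
    have [->|wz] := eqVneq w' z; first by rewrite /q eqxx subrr cmod0.
    have wz0 : w' - z != 0 by rewrite subr_eq0.
    rewrite qE // (_ : _ - dz = (f w' - f z - dz * (w' - z)) / (w' - z)); last by field.
    rewrite cmodM cmodV ltr_pdivrMr ?cmod_gt0 //.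
    apply: (le_lt_trans (hr _ wr)); rewrite ltr_pM2r ?cmod_gt0 //; lra.
  have h1 : {for w, continuous (fun u : C => (f u - f z) / (u - z))}.
    have wz0 : w - z != 0 by rewrite subr_eq0.
    have idz := @continuousC_sub R C id (fun=> z) (fun u => cvg_id) (@continuousC_cst R C z) w.
    have fz := @continuousC_sub R C f (fun=> f z) cf (@continuousC_cst R C (f z)) w.
    exact: (@cvgM C C _ _ (fun u => f u - f z) (fun u => (u - z)^-1) _ _ fz
      (@cvgV C C _ _ (fun u => u - z) _ wz0 idz)).
  rewrite /prop_for /continuous_at qE //.
  apply: (@cvgCP R C _ (@nbhs_filter C w)) => e e0; apply/nbhsCP.
  have /nbhsCP[r [r0 hr]] := @cvgC_cmod R C _ _ _ h1 e e0.
  exists (Num.min r (cmod (w - z))); split; first by rewrite lt_min r0 cmod_gt0 subr_eq0.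
  move=> w'; rewrite lt_min => /andP[w'r w'z]; rewrite qE; first exact: hr.
  by apply/eqP => wz'; move: w'z; rewrite wz' cmod_distC ltxx.
have q0 : unit_square_integral q = 0.
  rewrite unit_square_integralE; last exact: continuous_side.
  apply: (@goursat R q (-1) (-1) 2 z) => //; [lra..|] => u v hu hv uvz.
  by apply: cder => //; apply: df; lra.
have cV := side_continuousV z1.
have cfV := side_continuousM (continuous_side cf) cV.
apply/eqP; rewrite -subr_eq0 -q0; apply/eqP.
rewrite /square_kernel addrC -mulNr -unit_square_integralZD //.
have m0 (x y : R) : (`|x| == 1) || (`|y| == 1) -> - f z * (cpt x y - z)^-1 + f (cpt x y) / (cpt x y - z) = q (cpt x y).
  move=> /(cpt_sub_neq0 z1) h; rewrite qE; last by rewrite -subr_eq0.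
  by rewrite mulrBl addrC mulNr.
congr cint; apply/funext => t.
by rewrite !m0 ?normrN ?normr1 ?eqxx ?orbT.
Qed.

End Cauchy.

(** * Second-order Taylor expansion with uniform constants *)

Section Taylor.
Variable R : realType.
Local Notation C := (Num.NumField.sort (complex_complex__canonical__Num_NumField R)).
Implicit Types (f g q : C -> C) (x y s t M : R) (z w c d : C).

Lemma on_side_cmod (P : C -> Prop) : (forall w, 1 <= cmod w -> P w) -> on_side P.
Proof.
move=> h t _; split; apply: h;
  [apply: le_trans (cmod_Im _)|apply: le_trans (cmod_Re _)
  |apply: le_trans (cmod_Im _)|apply: le_trans (cmod_Re _)];
  by rewrite /= ?normrN normr1.
Qed.

(** For z = 0 the four sides together contribute 4 i / (t^2 + 1) at parameter t, and 4 / (t^2 + 1)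
    is at least 2 on [-1, 1]. *)
Lemma square_kernel0_ge4 : 4 <= cmod (square_kernel (0 : C)).
Proof.
apply: le_trans (le_trans (ler_norm _) (cmod_Im _)).
have c0 : side_continuous (fun w : C => (w - 0)^-1) by apply: side_continuousV; rewrite cmod0.
have := @cint_Im_ge R _ (-1) 1 2 (unit_square_integrandE c0).
rewrite (_ : 2 * (1 - -1) = 4); last by ring.
apply; [lra|lra|] => t /andP[t1 t2].
have D0 : t ^+ 2 + 1 != 0 by apply: lt0r_neq0; have := sqr_ge0 t; lra.
rewrite [X in complex.Im X](_ : _ = cpt 0 (4 / (t ^+ 2 + 1))); last first.
  have D1 : 1 + t ^+ 2 != 0 by rewrite addrC.
  rewrite !subr0 /cpt; simpc; rewrite /= !sqrrN !expr1n ; congr (_ +i* _)%C; field;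
    by rewrite ?D0 ?D1.
rewrite /= ler_pdivlMr; last by have := sqr_ge0 t; lra.
have : t ^+ 2 <= 1 by rewrite -real_normK ?num_real // exprn_ile1 // ler_norml t1.
lra.
Qed.

(** Integrate 1/(w - z) = 1/w + z/w^2 + z^2/w^3 + z^3/(w^3 (w - z)) against [g]. On the sides |w| >=
    1, hence |w - z| >= 1/2 for |z| <= 1/2, which doubles the bound of the last term. *)
Lemma cauchy_integral_expansion g M : side_continuous g ->
  on_side (fun w => cmod (g w) <= M) -> exists A0 A1 A2 : C,
  [/\ cmod A0 <= 16 * M, cmod A1 <= 16 * M, cmod A2 <= 16 * M &
   forall z, cmod z <= 1 / 2 -> exists E : C, cmod E <= 32 * M /\
     unit_square_integral (fun w => g w / (w - z)) =
     A0 + A1 * z + A2 * z ^+ 2 + E * z ^+ 3].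
Proof.
move=> cg gM.
have c0 : side_continuous (fun w : C => (w - 0)^-1) by apply: side_continuousV; rewrite cmod0.
have V1 : on_side (fun w : C => w != 0 /\ cmod (w - 0)^-1 <= 1).
  apply: on_side_cmod => w w1; split.
    by rewrite -cmod_gt0; apply: lt_le_trans w1.
  by rewrite subr0 cmodV invf_le1 //; apply: lt_le_trans w1.
have MM w a b : cmod (g w) <= M -> 0 <= a -> cmod b <= a -> cmod (g w * b) <= M * a.
  by move=> h1 h2 h3; rewrite cmodM ler_pM ?cmod_ge0.
pose g1 w := g w * (w - 0)^-1; pose g2 w := g1 w * (w - 0)^-1; pose g3 w := g2 w * (w - 0)^-1.
have cg1 : side_continuous g1 := side_continuousM cg c0.
have cg2 : side_continuous g2 := side_continuousM cg1 c0.
have cg3 : side_continuous g3 := side_continuousM cg2 c0.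
have gS (h : C -> C) : on_side (fun w => cmod (h w) <= M) ->
    on_side (fun w => cmod (h w * (w - 0)^-1) <= M).
  have hh (w : C) : cmod (h w) <= M -> w != 0 /\ cmod (w - 0)^-1 <= 1 -> cmod (h w * (w - 0)^-1) <= M.
    by move=> h1 [_ h2]; rewrite cmodM -[M]mulr1 ler_pM ?cmod_ge0.
  by move=> hM t ht; have [a1 a2 a3 a4] := hM t ht; have [b1 b2 b3 b4] := V1 t ht;
    split; exact: hh.
have b1 := gS _ gM; have b2 := gS _ b1; have b3 := gS _ b2.
exists (unit_square_integral g1), (unit_square_integral g2), (unit_square_integral g3).
split; [exact: unit_square_integral_bound..|] => z z2.
have z1 : cmod z < 1 by lra.
have cz := side_continuousV z1.
pose e w := g3 w * (w - z)^-1.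
have ce : side_continuous e := side_continuousM cg3 cz.
exists (unit_square_integral e); split.
  rewrite (_ : 32 * M = 16 * (M * 2)); last by ring.
  apply: unit_square_integral_bound => // t ht.
  have hz : on_side (fun w : C => cmod (w - z)^-1 <= 2).
    apply: on_side_cmod => w w1; rewrite cmodV invf_ple ?posrE //; last first.
      by have := cmodB (w - z) (- z); rewrite opprK subrK cmodN; lra.
    by have := cmodB (w - z) (- z); rewrite opprK subrK cmodN; lra.
  have [a1 a2 a3 a4] := b3 t ht; have [h1 h2 h3 h4] := hz t ht.
  by split; rewrite cmodM ler_pM ?cmod_ge0.
rewrite (_ : unit_square_integral (fun w => g w / (w - z)) = unit_square_integral (fun w =>
  z ^+ 3 * e w + (z ^+ 2 * g3 w + (z * g2 w + g1 w)))).
  have cZ c h : side_continuous h -> side_continuous (fun w => c * h w).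
    exact: (side_continuousM (continuous_side (@continuousC_cst R C c))).
  have z2' : side_continuous (fun w => z * g2 w + g1 w).
    exact: (side_continuousD (cZ z _ cg2) cg1).
  have z3' : side_continuous (fun w => z ^+ 2 * g3 w + (z * g2 w + g1 w)).
    exact: (side_continuousD (cZ (z ^+ 2) _ cg3) z2').
  rewrite (unit_square_integralZD _ ce z3') (unit_square_integralZD _ cg3 z2').
  by rewrite (unit_square_integralZD _ cg2 cg1); ring.
have pw (w : C) : w != 0 -> w - z != 0 -> g w / (w - z) =
    z ^+ 3 * e w + (z ^+ 2 * g3 w + (z * g2 w + g1 w)).
  move=> w0 wz; rewrite /e /g3 /g2 /g1 !subr0; field; exact/andP.
have pxy (x y : R) : (`|x| == 1) || (`|y| == 1) -> g (cpt x y) / (cpt x y - z) =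
    z ^+ 3 * e (cpt x y) + (z ^+ 2 * g3 (cpt x y) + (z * g2 (cpt x y) + g1 (cpt x y))).
  move=> h; apply: pw; last exact: cpt_sub_neq0.
  by rewrite -[cpt x y]subr0; apply: cpt_sub_neq0 => //; rewrite cmod0.
congr cint; apply/funext => t.
by rewrite !pxy ?normrN ?normr1 ?eqxx ?orbT.
Qed.

(** Both integrals in Cauchy's formula, for [f] and for the constant 1, are expanded to third order,
    and the first expansion is divided by the second. *)
Lemma taylor2_unit f M : continuous f ->
  (forall u v, -1 <= u <= 1 -> -1 <= v <= 1 -> exists d, has_cderiv f (cpt u v) d) ->
  (forall u v, -1 <= u <= 1 -> -1 <= v <= 1 -> cmod (f (cpt u v)) <= M) ->
  exists d0 d1 d2 : C, [/\ cmod d1 <= 20 * M, cmod d2 <= 100 * M &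
    forall z, cmod z <= 1 / 32 ->
    cmod (f z - (d0 + d1 * z + d2 * z ^+ 2)) <= 10000 * M * cmod z ^+ 3].
Proof.
move=> cf df fM.
have M0 : 0 <= M by apply: le_trans (cmod_ge0 _) (fM 0 0 _ _); lra.
have sM : on_side (fun w => cmod (f w) <= M).
  by move=> t ht; split; apply: fM => //; lra.
have s1 : on_side (fun w : C => cmod (1 : C) <= 1).
  by move=> t ht; rewrite cmod1; split.
have [A0 [A1 [A2 [a0 a1 a2 hA]]]] := cauchy_integral_expansion (continuous_side cf) sM.
have cc : side_continuous (fun=> 1 : C) by apply: continuous_side; exact: continuousC_cst.
have [c0 [c1 [c2 [b0 b1 b2 hc]]]] := cauchy_integral_expansion cc s1.
have kE z : square_kernel z = unit_square_integral (fun w => 1 / (w - z)).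
  by rewrite /square_kernel; under [in RHS]eq_fun do rewrite mul1r.
have c0E : square_kernel (0 : C) = c0.
  have [|E [_]] := hc 0; first by rewrite cmod0; lra.
  by rewrite -kE => ->; rewrite !expr0n /= !mulr0 !addr0.
have c04 : 4 <= cmod c0 by rewrite -c0E; exact: square_kernel0_ge4.
have c0n0 : c0 != 0 by rewrite -cmod_gt0; lra.
have divc0 (x : C) m : cmod x <= 4 * m -> cmod (x / c0) <= m.
  move=> hx; rewrite cmodM cmodV ler_pdivrMr; last lra.
  have := cmod_ge0 x; have : 0 <= m * (cmod c0 - 4); last lra.
  by rewrite mulr_ge0 //; have := cmod_ge0 x; lra.
(* The first three coefficients of the quotient of power series (A0 + A1 z + A2 z^2) / (c0 + c1 z +
   c2 z^2). *)
pose d0 := A0 / c0; pose d1 := (A1 - d0 * c1) / c0.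
pose d2 := (A2 - d0 * c2 - d1 * c1) / c0.
have CM (x y : C) (m k : R) : cmod x <= m -> cmod y <= k -> cmod (x * y) <= m * k.
  by move=> hx hy; rewrite cmodM ler_pM ?cmod_ge0.
have hd0 : cmod d0 <= 4 * M by apply: divc0; lra.
have hd1 : cmod d1 <= 20 * M.
  by apply: divc0; have := CM _ _ _ _ hd0 b1; have := cmodB A1 (d0 * c1); lra.
have hd2 : cmod d2 <= 100 * M.
  apply: divc0; have := CM _ _ _ _ hd0 b2; have := CM _ _ _ _ hd1 b1.
  have := cmodB (A2 - d0 * c2) (d1 * c1); have := cmodB A2 (d0 * c2); lra.
exists d0, d1, d2; split=> // z zs.
have z2 : cmod z <= 1 / 2 by lra.
have [E [hE eE]] := hA z z2; have [e [he ee]] := hc z z2.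
rewrite -kE in ee.
have z1 : cmod z < 1 by lra.
have cau := cauchy_formula cf z1 df; rewrite eE in cau.
have z0 := cmod_ge0 z.
have zz : cmod (z ^+ 2) <= 1 / 32.
  by rewrite cmodX expr2; have := ler_pM z0 z0 zs zs; lra.
have zzz : cmod (z ^+ 3) <= 1 / 32.
  rewrite exprS; have := CM _ _ _ _ zs zz; lra.
(* For |z| <= 1/32 the terms after [c0] add up to at most 1/2 + 1/2 + 1, against |c0| >= 4. *)
have k1 : 1 <= cmod (square_kernel z).
  have := CM _ _ _ _ b1 zs; have := CM _ _ _ _ b2 zz; have := CM _ _ _ _ he zzz.
  have := cmodB (c0 + c1 * z + c2 * z ^+ 2 + e * z ^+ 3) (c1 * z + c2 * z ^+ 2 + e * z ^+ 3).
  have := cmodD (c1 * z + c2 * z ^+ 2) (e * z ^+ 3); have := cmodD (c1 * z) (c2 * z ^+ 2).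
  rewrite -ee (_ : square_kernel z - _ = c0); last by rewrite ee; ring.
  lra.
have kn0 : square_kernel z != 0 by rewrite -cmod_gt0; lra.
(* [N * z ^+ 3] is the Taylor remainder multiplied by the kernel: the choice of d0, d1, d2 cancels
   all terms of lower order. *)
set N := E - (d1 * c2 + d2 * c1) - d2 * c2 * z - (d0 + d1 * z + d2 * z ^+ 2) * e.
have -> : f z - (d0 + d1 * z + d2 * z ^+ 2) = N * z ^+ 3 / square_kernel z.
  apply: (mulIf kn0); rewrite divfK // mulrBl -cau ee /N /d2 /d1 /d0; field.
  exact: c0n0.
rewrite cmodM cmodV ler_pdivrMr; last lra.
rewrite cmodM (cmodX z).
have Nb : cmod N <= 10000 * M.
  have := CM _ _ _ _ hd1 b2; have := CM _ _ _ _ hd2 b1.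
  have h1 := CM _ _ _ _ hd2 b2; have := CM _ _ _ _ h1 zs.
  have := CM _ _ _ _ hd1 zs; have := CM _ _ _ _ hd2 zz.
  have := cmodD (d0 + d1 * z) (d2 * z ^+ 2); have := cmodD d0 (d1 * z).
  set P := d0 + d1 * z + d2 * z ^+ 2 in N *.
  move=> h2 h3 h4 h5 h6 h7 h8.
  have hP : cmod P <= 30 * M by lra.
  have := CM _ _ _ _ hP he.
  have := cmodB (E - (d1 * c2 + d2 * c1) - d2 * c2 * z) (P * e).
  have := cmodB (E - (d1 * c2 + d2 * c1)) (d2 * c2 * z).
  have := cmodB E (d1 * c2 + d2 * c1).
  have := cmodD (d1 * c2) (d2 * c1).
  rewrite -/N; lra.
have p0 : 0 <= cmod z ^+ 3 by rewrite exprn_ge0.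
apply: (le_trans (ler_wpM2r p0 Nb)).
have K0 : 0 <= 10000 * M by lra.
exact: (ler_peMr (mulr_ge0 K0 p0) k1).
Qed.

End Taylor.

Section LocalTaylor.
Variable R : realType.
Local Notation C := (Num.NumField.sort (complex_complex__canonical__Num_NumField R)).
Implicit Types (f g q : C -> C) (x y s t M : R) (z w c d : C).

Lemma has_cderiv_unique f z d d' : has_cderiv f z d -> has_cderiv f z d' -> d = d'.
Proof.
move=> fd fd'; apply/eqP; rewrite -subr_eq0 -cmod_eq0 eq_le cmod_ge0 andbT.
apply/ler_addgt0Pr => e e0; rewrite add0r.
have e20 : 0 < e / 2 by rewrite divr_gt0.
have [r [r0 hr]] := fd _ e20; have [r' [r'0 hr']] := fd' _ e20.
pose u := (Num.min r r' / 2)%:C%C : C.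
have rr0 : 0 < Num.min r r' by rewrite lt_min r0.
have ur : cmod u < Num.min r r' by rewrite cmodR gtr0_norm; lra.
have u0 : 0 < cmod u by rewrite cmodR gtr0_norm; lra.
move: ur; rewrite lt_min => /andP[ur ur'].
have := hr (z + u); have := hr' (z + u); rewrite addrAC subrr add0r => /(_ ur') h1 /(_ ur) h2.
have := cmodB (f (z + u) - f z - d' * u) (f (z + u) - f z - d * u).
have -> : f (z + u) - f z - d' * u - (f (z + u) - f z - d * u) = (d - d') * u by ring.
rewrite cmodM => h3; rewrite -(ler_pM2r u0); lra.
Qed.

(* Composing with cclamp makes f continuous on the whole plane, as the integrals
   over segments require. *)
Definition clamp t : R := Num.max (-2) (Num.min t 2).

Lemma clampE t : clamp t = if t < 2 then (if -2 < t then t else -2) else 2.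
Proof.
rewrite /clamp minElt maxElt; case: (ltP t 2) => // _.
by rewrite (_ : -2 < 2) //; lra.
Qed.

Lemma clamp_dist t s : `|clamp t - clamp s| <= `|t - s|.
Proof.
rewrite !clampE; have := ler_norm (t - s); have := ler_norm (s - t); rewrite (distrC s t).
by case: (ltP t 2) => t2; case: (ltP s 2) => s2; case: (ltP (-2) t) => t3;
  case: (ltP (-2) s) => s3 h1 h2; rewrite ler_norml; lra.
Qed.

Lemma clamp_norm t : `|clamp t| <= 2.
Proof.
by rewrite clampE; case: (ltP t 2) => t2; case: (ltP (-2) t) => t3; rewrite ler_norml; lra.
Qed.

Lemma clamp_id t : `|t| <= 2 -> clamp t = t.
Proof.
by rewrite ler_norml clampE => h; case: (ltP t 2) => t2; case: (ltP (-2) t) => t3; lra.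
Qed.

Definition cclamp z : C := cpt (clamp (complex.Re z)) (clamp (complex.Im z)).

Lemma cclamp_dist z w : cmod (cclamp z - cclamp w) <= 2 * cmod (z - w).
Proof.
apply: (le_trans (cmod_le _)) => /=.
have := clamp_dist (complex.Re z) (complex.Re w); have := clamp_dist (complex.Im z) (complex.Im w).
have := cmod_Re (z - w); have := cmod_Im (z - w); rewrite !raddfB; lra.
Qed.

Lemma cclamp_cmod z : cmod (cclamp z) <= 4.
Proof.
apply: (le_trans (cmod_le _)) => /=.
have := clamp_norm (complex.Re z); have := clamp_norm (complex.Im z); lra.
Qed.

Lemma cclamp_id z : `|complex.Re z| <= 2 -> `|complex.Im z| <= 2 -> cclamp z = z.
Proof. by case: z => a b /= ha hb; rewrite /cclamp /= !clamp_id. Qed.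

(** One constant, independent of [f], bounds the coefficients and the remainder, and its inverse is
    the radius of validity. The disc of radius 4 contains the square onto which [cclamp]
    projects. *)
Lemma taylor2 : exists K : R, 1 <= K /\ forall f M,
  (forall z, cmod z <= 4 -> exists d, has_cderiv f z d) ->
  (forall z, cmod z <= 4 -> cmod (f z) <= M) ->
  exists d1 d2 : C, [/\ cmod d1 <= K * M, cmod d2 <= K * M &
    forall z, cmod z <= K^-1 ->
      cmod (f z - (f 0 + d1 * z + d2 * z ^+ 2)) <= K * M * cmod z ^+ 3].
Proof.
(* K stays abstract to keep the unary numeral 10000 out of unification. *)
have : exists K : R, 10000 <= K by exists 10000.
move=> [K hK]; have hK100 : 100 <= K by apply: le_trans hK; rewrite ler_nat.
have {}hK m : 0 <= m -> 10000 * m <= K * m by move=> m0; rewrite ler_wpM2r.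
exists K; split; first lra.
move=> f M df fM.
pose g z := f (cclamp z).
have cg : continuous g.
  move=> z; apply: (@cvgCP R C _ (@nbhs_filter C z)) => e e0; apply/nbhsCP.
  have [d hd] := df _ (cclamp_cmod z).
  have /nbhsCP[r [r0 hr]] := @cvgC_cmod R C _ f _ (has_cderiv_continuous hd) e e0.
  exists (r / 2); split; first by rewrite divr_gt0.
  by move=> w wz; apply: hr; apply: (le_lt_trans (cclamp_dist _ _)); lra.
have M0 : 0 <= M by apply: le_trans (cmod_ge0 _) (fM 0 _); rewrite cmod0; lra.
have cptC (u v : R) : -1 <= u <= 1 -> -1 <= v <= 1 -> `|u| <= 1 /\ `|v| <= 1.
  by move=> hu hv; rewrite !ler_norml.
have g_id (z : C) : `|complex.Re z| <= 2 -> `|complex.Im z| <= 2 -> g z = f z.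
  by move=> h1 h2; rewrite /g cclamp_id.
have dg (u v : R) : -1 <= u <= 1 -> -1 <= v <= 1 -> exists d, has_cderiv g (cpt u v) d.
  move=> hu hv; have [u1 v1] := cptC u v hu hv.
  have [|d hd] := df (cpt u v).
    by apply: (le_trans (cmod_le _)) => /=; lra.
  exists d => e e0; have [r [r0 hr]] := hd e e0.
  exists (Num.min r 1); split; first by rewrite lt_min r0 ltr01.
  move=> w; rewrite lt_min => /andP[wr w1].
  have a1 : `|complex.Re w| <= 2.
    have := cmod_Re (w - cpt u v); rewrite raddfB /=.
    have := ler_normD (complex.Re w - u) u; rewrite subrK; lra.
  have a2 : `|complex.Im w| <= 2.
    have := cmod_Im (w - cpt u v); rewrite raddfB /=.
    have := ler_normD (complex.Im w - v) v; rewrite subrK; lra.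
  have b1 : `|complex.Re (cpt u v)| <= 2 by apply: (le_trans u1); lra.
  have b2 : `|complex.Im (cpt u v)| <= 2 by apply: (le_trans v1); lra.
  by rewrite (g_id w) // (g_id (cpt u v)) //; exact: hr.
have gM (u v : R) : -1 <= u <= 1 -> -1 <= v <= 1 -> cmod (g (cpt u v)) <= M.
  by move=> _ _; apply: fM; exact: cclamp_cmod.
have [d0 [d1 [d2 [b1 b2 h]]]] := taylor2_unit cg dg gM.
have d0E : d0 = f 0.
  have := h 0; rewrite cmod0 expr0n /= !mulr0 !addr0 => h0.
  have /h0 : (0 : R) <= 1 / 32 by lra.
  rewrite expr0n /= mulr0 => h1; have : cmod (g 0 - d0) = 0 by apply/eqP; rewrite eq_le h1 cmod_ge0.
  by move/eqP; rewrite cmod_eq0 subr_eq0 => /eqP <-; rewrite g_id //= normr0.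
exists d1, d2; split.
- by apply: (le_trans b1); rewrite ler_wpM2r //; lra.
- by apply: (le_trans b2); rewrite ler_wpM2r //; lra.
move=> z zK.
have z32 : cmod z <= 1 / 32.
  apply: (le_trans zK); rewrite mul1r lef_pV2 ?posrE //; lra.
rewrite -d0E -(g_id z); last 2 first.
- by have := cmod_Re z; lra.
- by have := cmod_Im z; lra.
apply: (le_trans (h z z32)); rewrite ler_wpM2r ?exprn_ge0 ?cmod_ge0 //.
exact: hK.
Qed.

End LocalTaylor.

(** * Division by the equation of a hypersurface *)

Section VectorModulus.
Variable R : realType.
Local Notation CF := (complex_complex__canonical__Num_NumField R).
Local Notation C := (Num.NumField.sort CF).
Variable V : normedModType CF.
Implicit Types (u v w x : V).

Definition vmod v : R := complex.Re `|v|.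

Lemma vmodE v : `|v| = (vmod v)%:C%C.
Proof. by rewrite /vmod RRe_real // ger0_real. Qed.

Lemma vmod_ge0 v : 0 <= vmod v.
Proof. by have := normr_ge0 v; rewrite vmodE ler0c. Qed.

Lemma vmod0 : vmod 0 = 0.
Proof. by rewrite /vmod normr0. Qed.

Lemma vmodD v w : vmod (v + w) <= vmod v + vmod w.
Proof. by have := ler_normD v w; rewrite !vmodE -rmorphD lecR. Qed.

Lemma vmodZ (c : C) v : vmod (c *: v) = cmod c * vmod v.
Proof.
have h : `|c *: v| = (cmod c)%:C%C * `|v| by rewrite -cmodE; exact: normrZ.
by rewrite /vmod h vmodE -rmorphM.
Qed.

Lemma vmod_eq0 v : (vmod v == 0) = (v == 0).
Proof.
apply/eqP/eqP => [h|->]; last exact: vmod0.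
by apply: normr0_eq0; rewrite vmodE h.
Qed.

Lemma nbhsVP x (P : set V) :
  nbhs x P <-> exists e : R, 0 < e /\ forall y, vmod (y - x) < e -> P y.
Proof.
split=> [/(@nbhs_ballP CF)[e /= e0 eP]|[e [e0 eP]]].
  have eE : e = (complex.Re e)%:C%C by rewrite RRe_real // ger0_real // ltW.
  exists (complex.Re e); split; first by rewrite -ltcR -eE.
  move=> y xy; apply: eP; rewrite -ball_normE /ball_ /=.
  by rewrite distrC vmodE eE ltcR.
apply/(@nbhs_ballP CF); exists e%:C%C => /=; first by rewrite ltcR.
move=> y; rewrite -ball_normE /ball_ /= distrC => xy; apply: eP.
by rewrite -ltcR -vmodE.
Qed.

Lemma continuousVP (f : V -> C) x : {for x, continuous f} <->
  forall e : R, 0 < e -> exists r : R, 0 < r /\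
    forall y, vmod (y - x) < r -> cmod (f y - f x) < e.
Proof.
split=> [cf e e0|h].
  by apply/nbhsVP; exact: (@cvgC_cmod R V _ f _ cf e e0).
apply: (@cvgCP R V _ (@nbhs_filter V x)) => e e0; apply/nbhsVP; exact: h.
Qed.

(** The case of a zero differential. Later proofs first subtract a function known to be
    differentiable, so that this is the only form in which the definition has to be met. *)
Lemma differentiable0P (f : V -> C) x :
  (forall e : R, 0 < e -> exists r : R, 0 < r /\
    forall y, vmod (y - x) < r -> cmod (f y - f x) <= e * vmod (y - x)) ->
  differentiable f x.
Proof.
move=> h.
have c0 : continuous (\0 : {linear V -> C}) by move=> y; exact: cvg_cst.
have e0 : f \o shift x = cst (f x) + (\0 : {linear V -> C}) +o_ (0 : V) id.
  apply/eqaddoP => e /= e0; apply/nbhsVP.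
  have eE : e = (complex.Re e)%:C%C by rewrite RRe_real // ger0_real // ltW.
  have [|r [r0 hr]] := h (complex.Re e); first by rewrite -ltcR -eE.
  exists r; split=> // y; rewrite subr0 => yr.
  have := hr (y + x); rewrite addrK => /(_ yr).
  by rewrite -lecR rmorphM /= -eE -vmodE -cmodE /= !fctE /= addr0.
apply/diff_locallyP; rewrite (diff_unique c0 e0); split=> //.
Qed.

Lemma differentiable_bound (f : V -> C) x : differentiable f x ->
  forall e : R, 0 < e -> exists r : R, 0 < r /\
    forall y, vmod (y - x) < r ->
      cmod (f y - f x - 'd f x (y - x)) <= e * vmod (y - x).
Proof.
move=> /diff_locallyP[_ /eqaddoP h] e e0.
have /h/nbhsVP[r [r0 hr]] : 0 < e%:C%C by rewrite ltcR.
exists r; split=> // y yx.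
have := hr (y - x); rewrite subr0 => /(_ yx) /=; rewrite !fctE /= subrK.
by rewrite opprD addrA vmodE -rmorphM cmodE lecR.
Qed.

Lemma differentiable_line (f : V -> C) x v (z : C) : differentiable f (x + z *: v) ->
  has_cderiv (fun t : C => f (x + t *: v)) z ('d f (x + z *: v) v).
Proof.
move=> /differentiable_bound df e e0.
have D0 : 0 < vmod v + 1 by have := vmod_ge0 v; lra.
have [r [r0 hr]] := df _ (divr_gt0 e0 D0).
exists (r / (vmod v + 1)); split; first by rewrite divr_gt0.
move=> w; rewrite ltr_pdivlMr // => wz.
have e1 : x + w *: v - (x + z *: v) = (w - z) *: v by rewrite scalerBl opprD addrACA subrr add0r.
have := hr (x + w *: v); rewrite e1 vmodZ linearZ /= => hh.
have cz := cmod_ge0 (w - z); have vz := vmod_ge0 v.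
have cD : cmod (w - z) * vmod v <= cmod (w - z) * (vmod v + 1) by rewrite ler_wpM2l //; lra.
rewrite [X in _ - X]mulrC; apply: (le_trans (hh _)); first exact: le_lt_trans wz.
apply: (le_trans (ler_wpM2l (ltW (divr_gt0 e0 D0)) cD)).
by rewrite [cmod _ * _]mulrC mulrA divfK // gt_eqF.
Qed.

End VectorModulus.

Section UniformLimit.
Variable R : realType.
Local Notation CF := (complex_complex__canonical__Num_NumField R).
Local Notation C := (Num.NumField.sort CF).

Lemma real_cauchy_converges (a : nat -> R) :
  (forall e : R, 0 < e -> exists N, forall n m, (N <= n)%N -> (N <= m)%N -> `|a n - a m| <= e) ->
  exists l : R, forall e : R, 0 < e -> exists N, forall n, (N <= n)%N -> `|a n - l| <= e.
Proof.
move=> h; have /cvg_ex[l al] : cvgn a.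
  apply/cauchy_cvgP; apply: cauchy_exP => e e0.
  have [|N hN] := h (e / 2); first by rewrite divr_gt0.
  exists (a N); exists N => // n /= Nn.
  rewrite -ball_normE /ball_ /=.
  by apply: (le_lt_trans (hN N n (leqnn N) Nn)); lra.
exists l => e e0.
have /cvgrPdist_le/(_ e e0)[N _ hN] := al.
by exists N => n Nn; rewrite distrC; exact: hN.
Qed.

Lemma complex_cauchy_converges (a : nat -> C) :
  (forall e : R, 0 < e -> exists N, forall n m, (N <= n)%N -> (N <= m)%N ->
     cmod (a n - a m) <= e) ->
  exists l : C, forall e : R, 0 < e -> exists N, forall n, (N <= n)%N -> cmod (a n - l) <= e.
Proof.
move=> h.
have [|x hx] := @real_cauchy_converges (fun n => complex.Re (a n)).
  move=> e e0; have [N hN] := h e e0; exists N => n m hn hm.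
  by apply: le_trans (hN n m hn hm); rewrite -raddfB; exact: cmod_Re.
have [|y hy] := @real_cauchy_converges (fun n => complex.Im (a n)).
  move=> e e0; have [N hN] := h e e0; exists N => n m hn hm.
  by apply: le_trans (hN n m hn hm); rewrite -raddfB; exact: cmod_Im.
exists (cpt x y) => e e0; have e20 : 0 < e / 2 by rewrite divr_gt0.
have [N hN] := hx _ e20; have [M hM] := hy _ e20.
exists (maxn N M) => n; rewrite geq_max => /andP[nN nM].
apply: (le_trans (cmod_le _)); rewrite !raddfB /=.
have := hN n nN; have := hM n nM; lra.
Qed.

End UniformLimit.

(** * Locally uniform limits of holomorphic functions of several variables *)

Section Weierstrass.
Variable R : realType.
Local Notation CF := (complex_complex__canonical__Num_NumField R).
Local Notation C := (Num.NumField.sort CF).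

Lemma quadratic_has_cderiv (f : C -> C) (d : C) (B r : R) : 0 < r -> 0 <= B ->
  (forall z, cmod z <= r -> cmod (f z - f 0 - d * z) <= B * cmod z ^+ 2) ->
  has_cderiv f 0 d.
Proof.
move=> r0 B0 h e e0.
have D0 : 0 < B + 1 by lra.
exists (Num.min r (e / (B + 1))); split; first by rewrite lt_min r0 divr_gt0.
move=> w; rewrite !subr0 lt_min ltr_pdivlMr // => /andP[/ltW wr we].
apply: (le_trans (h w wr)); rewrite expr2 mulrA ler_wpM2r ?cmod_ge0 //.
by have := cmod_ge0 w; lra.
Qed.

(** [taylor2] on a complex line, with the quadratic and cubic terms merged. The first coefficient is
    the differential because one-variable derivatives are unique. *)
Lemma taylor1_line : exists K : R, 1 <= K /\
  forall (V : normedModType CF) (f : V -> C) (M : R) (w v : V),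
  (forall z : C, cmod z <= 4 -> differentiable f (w + z *: v)) ->
  (forall z : C, cmod z <= 4 -> cmod (f (w + z *: v)) <= M) ->
  forall z : C, cmod z <= K^-1 ->
    cmod (f (w + z *: v) - f w - 'd f w (z *: v)) <= K * M * cmod z ^+ 2.
Proof.
have [K [K1 hK]] := taylor2 R; exists (2 * K); split; first lra.
move=> V f M w v df fM z zK.
have dF z' : cmod z' <= 4 -> exists d, has_cderiv (fun t : C => f (w + t *: v)) z' d.
  by move=> z4; exists ('d f (w + z' *: v) v); apply: differentiable_line; exact: df.
have [d1 [d2 [b1 b2 h]]] := hK _ M dF fM.
have M0 : 0 <= M by apply: le_trans (cmod_ge0 _) (fM 0 _); rewrite cmod0.
have K0 : 0 < K by lra.
have Ki1 : K^-1 <= 1 by rewrite invf_le1.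
have hq z' : cmod z' <= K^-1 ->
    cmod (f (w + z' *: v) - f (w + 0 *: v) - d1 * z') <= 2 * K * M * cmod z' ^+ 2.
  move=> z'K; have := h z' z'K.
  have := cmodD (f (w + z' *: v) - (f (w + 0 *: v) + d1 * z' + d2 * z' ^+ 2)) (d2 * z' ^+ 2).
  have -> : f (w + z' *: v) - (f (w + 0 *: v) + d1 * z' + d2 * z' ^+ 2) + d2 * z' ^+ 2 =
    f (w + z' *: v) - f (w + 0 *: v) - d1 * z' by ring.
  rewrite cmodM cmodX; set t := cmod z' in z'K * => h1 h2.
  have t0 : 0 <= t := cmod_ge0 _.
  have h3 : cmod d2 * t ^+ 2 <= K * M * t ^+ 2 by rewrite ler_wpM2r ?exprn_ge0.
  have h4 : K * M * t ^+ 3 <= K * M * t ^+ 2.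
    rewrite exprSr mulrA; apply: ler_piMr; last lra.
    by rewrite !mulr_ge0 ?exprn_ge0 // ltW.
  lra.
have d1E : d1 = 'd f w v.
  apply: (@has_cderiv_unique R (fun t : C => f (w + t *: v)) 0).
    apply: (quadratic_has_cderiv _ _ hq); first by rewrite invr_gt0.
    by rewrite !mulr_ge0 // ltW.
  rewrite -[X in 'd f X]addr0 -(scale0r v); apply: differentiable_line.
  by apply: df; rewrite cmod0.
have dE : 'd f w (z *: v) = d1 * z by rewrite linearZ d1E mulrC.
have := hq z; rewrite scale0r addr0 dE; apply.
by apply: (le_trans zK); rewrite lef_pV2 ?posrE; lra.
Qed.

(** The order of the quantifiers is the point: [B] and [rho] are fixed before [f], hence are common
    to a whole sequence of functions bounded by [M]. *)
Lemma taylor1_ball (V : normedModType CF) (M r : R) (w : V) : 0 < r ->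
  exists B rho : R, [/\ 0 <= B, 0 < rho, rho <= r & forall f : V -> C,
  (forall x, vmod (x - w) <= r -> differentiable f x) ->
  (forall x, vmod (x - w) <= r -> cmod (f x) <= M) ->
  forall u, vmod u <= rho -> cmod (f (w + u) - f w - 'd f w u) <= B * vmod u ^+ 2].
Proof.
move=> r0; have [K [K1 hK]] := taylor1_line.
have K0 : 0 < K by lra.
have K0' := ltW K0; have r0' := ltW r0.
exists (K * `|M| * (4 / r) ^+ 2), (r / (4 * K)); split.
- by rewrite mulr_ge0 ?exprn_ge0 ?divr_ge0 // mulr_ge0.
- by rewrite divr_gt0 // mulr_gt0.
- by rewrite ler_pdivrMr ?mulr_gt0 // ler_peMr ?(ltW r0) //; lra.
move=> f df fM u uK.
have [u0|un0] := eqVneq u 0.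
  by rewrite u0 addr0 subrr linear0 subr0 cmod0 vmod0 expr0n /= mulr0.
have u_gt0 : 0 < vmod u by rewrite lt_def vmod_ge0 vmod_eq0 un0.
(* Write u = t v with |v| = r / 4, so that the disc of radius 4 on the line through [w] stays in the
   ball. *)
pose t : R := 4 * vmod u / r; have t0 : 0 < t by rewrite divr_gt0 // mulr_gt0.
pose v := (t%:C%C : C)^-1 *: u.
have tn0 : (t%:C%C : C) != 0 by rewrite -cmod_gt0 cmodR gtr0_norm.
have vE : (t%:C%C : C) *: v = u by rewrite /v scalerA divff // scale1r.
have ct : cmod (t%:C%C : C) = t by rewrite cmodR gtr0_norm.
have vv : vmod v = r / 4.
  by rewrite /v vmodZ cmodV ct /t; field; rewrite !gt_eqF.
have inb (z : C) : cmod z <= 4 -> vmod (w + z *: v - w) <= r.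
  move=> z4; rewrite addrAC subrr add0r vmodZ vv.
  by have := ler_wpM2r (ltW r0) z4; lra.
have := hK V f `|M| w v (fun z z4 => df _ (inb z z4))
  (fun z z4 => le_trans (fM _ (inb z z4)) (ler_norm M)) (t%:C%C).
rewrite vE ct; have tK : t <= K^-1.
  rewrite /t ler_pdivrMr // -ler_pdivlMl // mulrA.
  by move: uK; rewrite invfM mulrA => uK; apply: (le_trans uK); lra.
move=> /(_ tK) h; apply: (le_trans h).
by rewrite /t le_eqVlt; apply/orP; left; apply/eqP; field; rewrite gt_eqF.
Qed.

Lemma quadratic_step (B t v e : R) : 0 <= B -> 0 < t -> 0 <= v ->
  t * (4 * B * (v + 1) ^+ 2 + 1) <= e -> B * (t ^+ 2 * v ^+ 2) <= e * t / 4.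
Proof.
move=> B0 t0 v0 h.
have vv : v ^+ 2 <= (v + 1) ^+ 2 by lra.
have h1 := ler_wpM2l (mulr_ge0 B0 (exprn_ge0 2 (ltW t0))) vv.
have h2 := ler_wpM2l (ltW t0) h.
have h3 : 0 <= t ^+ 2 by rewrite exprn_ge0 // ltW.
lra.
Qed.

(** By the common estimate of [taylor1_ball], uniform closeness of the functions forces closeness of
    their differentials at [w]. These converge to a linear form [L], and the estimate passes to the
    limit. *)
Lemma differentiable_uniform_limit (a : nat) (w : 'rV[CF]_a) (r M : R)
    (us : nat -> 'rV[CF]_a -> C) (u : 'rV[CF]_a -> C) : 0 < r ->
  (forall n x, vmod (x - w) <= r -> differentiable (us n) x) ->
  (forall n x, vmod (x - w) <= r -> cmod (us n x) <= M) ->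
  (forall e : R, 0 < e -> exists N, forall n x, (N <= n)%N -> vmod (x - w) <= r ->
     cmod (us n x - u x) <= e) ->
  differentiable u w.
Proof.
move=> r0 dus usM usu.
have [B [rho [B0 rho0 rhor hB]]] := taylor1_ball M w r0.
have T1 n := hB (us n) (dus n) (usM n).
have ball0 : vmod (w - w) <= r by rewrite subrr vmod0 ltW.
have ballV v : vmod v <= rho -> vmod (w + v - w) <= r.
  by move=> hv; rewrite addrAC subrr add0r (le_trans hv).
have cau (v : 'rV[CF]_a) (e : R) : 0 < e -> exists N, forall n m, (N <= n)%N -> (N <= m)%N ->
    cmod ('d (us n) w v - 'd (us m) w v) <= e.
  move=> e0; have V0 := vmod_ge0 v.
  have A0 : 0 < 4 * B * (vmod v + 1) ^+ 2 + 1.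
    by have := mulr_ge0 B0 (exprn_ge0 2 (_ : 0 <= vmod v + 1)); lra.
  (* Compare at the point w + t v: the two Taylor errors cost at most e t / 4 each and the four
     uniform errors e t / 8 each, in total e t, which is then divided by t. *)
  pose t : R := Num.min (rho / (vmod v + 1)) (e / (4 * B * (vmod v + 1) ^+ 2 + 1)).
  have t0 : 0 < t by rewrite lt_min !divr_gt0 //; lra.
  have ct : cmod (t%:C%C : C) = t by rewrite cmodR gtr0_norm.
  have tv : vmod ((t%:C%C : C) *: v) <= rho.
    rewrite vmodZ ct; apply: (@le_trans _ _ (t * (vmod v + 1))); first by rewrite ler_pM2l //; lra.
    by rewrite -ler_pdivlMr ?ge_min ?lexx //; lra.
  have et0 : 0 < e * t / 8 by rewrite divr_gt0 // mulr_gt0.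
  have [N hN] := usu _ et0; exists N => n m Nn Nm.
  have h1 := T1 n _ tv; have h2 := T1 m _ tv.
  have h3 := hN n _ Nn (ballV _ tv); have h4 := hN m _ Nm (ballV _ tv).
  have h5 := hN n _ Nn ball0; have h6 := hN m _ Nm ball0.
  have dZ k : 'd (us k) w ((t%:C%C : C) *: v) = t%:C%C * 'd (us k) w v by rewrite linearZ.
  rewrite dZ in h1; rewrite dZ in h2.
  have key (xn xm un um ux uw D D' T : C) : T * (D - D') =
     (xm - um - T * D') - (xn - un - T * D) + (xn - ux) - (xm - ux) - (un - uw) + (um - uw).
    by ring.
  rewrite -(ler_pM2l t0) -[X in X * _]ct -cmodM (key (us n (w + (t%:C%C : C) *: v)) (us m (w + (t%:C%C : C) *: v))
    (us n w) (us m w) (u (w + (t%:C%C : C) *: v)) (u w)).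
  apply: (le_trans (cmodD _ _)); apply: (le_trans (lerD (cmodB _ _) (lexx _))).
  apply: (le_trans (lerD (lerD (cmodB _ _) (lexx _)) (lexx _))).
  apply: (le_trans (lerD (lerD (lerD (cmodD _ _) (lexx _)) (lexx _)) (lexx _))).
  apply: (le_trans (lerD (lerD (lerD (lerD (cmodB _ _) (lexx _)) (lexx _)) (lexx _)) (lexx _))).
  have h7 : B * vmod ((t%:C%C : C) *: v) ^+ 2 <= e * t / 4.
    rewrite vmodZ ct exprMn.
    apply: quadratic_step => //.
    by rewrite -ler_pdivlMr // ge_min lexx orbT.
  apply: (le_trans (lerD (lerD (lerD (lerD (lerD h2 h1) h3) h4) h5) h6)).
  by move: h7; clear; set X := B * _; lra.
have [l hl] : exists l : 'I_a -> C, forall i (e : R), 0 < e -> exists N, forall n, (N <= n)%N ->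
    cmod ('d (us n) w (delta_mx 0 i) - l i) <= e.
  have ex i := complex_cauchy_converges (cau (delta_mx 0 i)).
  exists (fun i => sval (cid (ex i))) => i; exact: svalP (cid (ex i)).
(* Limits are taken on the basis vectors only, so [L] is linear and differentiable by its
   formula. *)
pose L (v : 'rV[CF]_a) : C := \sum_i v 0 i * l i.
have limL (v : 'rV[CF]_a) (e : R) : 0 < e -> exists N, forall n, (N <= n)%N ->
    cmod ('d (us n) w v - L v) <= e.
  move=> e0; pose S := \sum_i cmod (v 0 i).
  have S0 : 0 <= S by apply: sumr_ge0 => i _; exact: cmod_ge0.
  have eS : 0 < e / (S + 1) by rewrite divr_gt0 //; lra.
  have ex i := hl i _ eS.
  exists (\max_i sval (cid (ex i)))%N => n hn.
  rewrite [X in 'd (us n) w X](row_sum_delta v) linear_sum /L -sumrB.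
  apply: (@le_trans _ _ (\sum_i cmod (v 0 i) * (e / (S + 1)))).
    elim/big_ind2: _ => [|x1 x2 y1 y2 hx hy|i _]; first by rewrite cmod0.
      by apply: (le_trans (cmodD _ _)); exact: lerD.
    have dZ : 'd (us n) w (v 0 i *: delta_mx 0 i) = v 0 i * 'd (us n) w (delta_mx 0 i).
      by rewrite linearZ.
    rewrite dZ -mulrBr cmodM ler_wpM2l ?cmod_ge0 //.
    apply: (svalP (cid (ex i))); apply: leq_trans hn.
    exact: (@leq_bigmax _ (fun i => sval (cid (ex i)))).
  rewrite -mulr_suml -/S mulrA ler_pdivrMr; last lra.
  by rewrite mulrC ler_pM2l //; lra.
have main (v : 'rV[CF]_a) : vmod v <= rho -> cmod (u (w + v) - u w - L v) <= B * vmod v ^+ 2.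
  move=> hv; apply/ler_addgt0Pr => e e0.
  have e30 : 0 < e / 3 by rewrite divr_gt0.
  have [N1 hN1] := usu _ e30; have [N2 hN2] := limL v _ e30.
  pose n := maxn N1 N2.
  have h1 := T1 n _ hv; have h2 := hN1 n _ (leq_maxl _ _) (ballV _ hv).
  have h3 := hN1 n _ (leq_maxl _ _) ball0; have h4 := hN2 n (leq_maxr _ _).
  have -> : u (w + v) - u w - L v = (us n (w + v) - us n w - 'd (us n) w v)
    - (us n (w + v) - u (w + v)) + (us n w - u w) + ('d (us n) w v - L v) by ring.
  apply: (le_trans (cmodD _ _)); apply: (le_trans (lerD (cmodD _ _) (lexx _))).
  apply: (le_trans (lerD (lerD (cmodB _ _) (lexx _)) (lexx _))).
  apply: (le_trans (lerD (lerD (lerD h1 h2) h3) h4)); lra.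
have LD x y : L (x - y) = L x - L y.
  by rewrite /L -sumrB; apply: eq_bigr => i _; rewrite !mxE mulrBl.
have dL x : differentiable L x.
  rewrite (_ : L = \sum_i (fun v : 'rV[CF]_a => v 0 i * l i)); last first.
    by apply/funext => v; rewrite /L fct_sumE.
  apply: differentiable_sum => i; apply: differentiableM; last exact: differentiable_cst.
  exact: differentiable_coord.
rewrite (_ : u = (fun x => u x - L x) + L); last by apply/funext => x /=; rewrite !fctE subrK.
apply: differentiableD; last exact: dL.
apply: differentiable0P => e e0.
have D0 : 0 < B + 1 by lra.
exists (Num.min rho (e / (B + 1))); split; first by rewrite lt_min rho0 divr_gt0.
move=> y; rewrite lt_min ltr_pdivlMr // => /andP[/ltW yr ye].
have := main _ yr; rewrite (addrC w) subrK LD => h.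
rewrite (_ : _ - _ - _ = u y - u w - (L y - L w)); last by ring.
apply: (le_trans h); rewrite expr2 mulrA ler_wpM2r ?vmod_ge0 //.
by have := vmod_ge0 (y - w); lra.
Qed.

End Weierstrass.

(** * Division along a direction transversal to the hypersurface *)

Section Division.
Variable R : realType.
Local Notation CF := (complex_complex__canonical__Num_NumField R).
Local Notation C := (Num.NumField.sort CF).

Lemma differentiable_lipschitz (V : normedModType CF) (f : V -> C) (x : V) :
  differentiable f x -> exists k r : R, [/\ 0 < k, 0 < r & forall y, vmod (y - x) < r ->
    cmod (f y - f x) <= k * vmod (y - x)].
Proof.
move=> df; have [k k0 hk] := linear_lipschitz (diff_continuous df).
have kE : k = (complex.Re k)%:C%C by rewrite RRe_real // ger0_real // ltW.
have [r [r0 hr]] := differentiable_bound df ltr01.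
exists (1 + complex.Re k), r; split => //.
  by have : 0 < complex.Re k; [rewrite -ltcR -kE|lra].
move=> y yx; have := hr y yx; have : cmod ('d f x (y - x)) <= complex.Re k * vmod (y - x).
  by have := hk (y - x); rewrite kE (vmodE (y - x)) -rmorphM cmodE lecR.
have := cmodD (f y - f x - 'd f x (y - x)) ('d f x (y - x)); rewrite subrK.
set X := cmod _; set Y := cmod _; set Z := cmod _; set T := vmod _; lra.
Qed.

Lemma scaled_small (K e : R) : 1 <= K -> 0 < e -> exists t : R, [/\ 0 < t, t <= K^-1 & t <= e].
Proof.
by move=> K1 e0; exists (Num.min K^-1 e);
  rewrite lt_min e0 invr_gt0 !ge_min !lexx orbT; split => //; rewrite andbT; lra.
Qed.

Lemma division_identity1 (F S D1 D2 : C) : S != 0 ->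
  F * S^-1 - D1 = (F - (D1 * S + D2 * S ^+ 2) + D2 * S ^+ 2) / S.
Proof. by move=> S0; field. Qed.

Lemma division_identity2 (F G S D1 D2 : C) : S != 0 ->
  D2 - (F + G) * (2 * S ^+ 2)^-1 =
  - ((F - (D1 * S + D2 * S ^+ 2)) + (G - (D1 * (- S) + D2 * (- S) ^+ 2))) / (2 * S ^+ 2).
Proof. by move=> S0; field. Qed.

(* x = ppi x + z x *: e exhibits the points near w as moved along e from the
   hypersurface z = 0, on which f vanishes; the first Taylor coefficient of f
   along e is a uniform limit of difference quotients, hence differentiable. *)
Lemma division_scaled (a : nat) (f z : 'rV[CF]_a -> C) (ppi : 'rV[CF]_a -> 'rV[CF]_a)
    (w e : 'rV[CF]_a) (r M : R) : 0 < r -> 8 * vmod e <= r ->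
  (forall y, vmod (y - w) < r -> differentiable f y) ->
  (forall y, vmod (y - w) < r -> cmod (f y) <= M) ->
  (forall x, vmod (x - w) < r -> differentiable ppi x) ->
  differentiable z w ->
  (forall x, vmod (x - w) < r -> x = ppi x + z x *: e) ->
  (forall x, vmod (x - w) < r -> f (ppi x) = 0) ->
  z w = 0 ->
  differentiable (fun x => if z x == 0 then 'd f x e else f x / z x) w.
Proof.
move=> r0 er df fM dpi dz xE fpi zw.
set k := fun x => _.
have [K [K1 hK]] := taylor2 R.
have K0 : 0 < K by lra.
have ball0 : vmod (w - w) < r by rewrite subrr vmod0.
have M0 : 0 <= M by apply: le_trans (cmod_ge0 _) (fM w ball0).
have piw : ppi w = w by have := xE w ball0; rewrite zw scale0r addr0.
have [r1 [r10 hr1]] : exists r1 : R, 0 < r1 /\ forall y, vmod (y - w) < r1 ->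
    vmod (ppi y - w) < r / 4.
  have cpi : {for w, continuous ppi} := differentiable_continuous (dpi w ball0).
  have /cpi/nbhsVP : nbhs (ppi w) [set y | vmod (y - w) < r / 4].
    by apply/nbhsVP; exists (r / 4); split; [lra|rewrite piw].
  by move=> [r1 [r10 h]]; exists r1.
pose r2 := Num.min r1 r / 2.
have r20 : 0 < r2 by rewrite divr_gt0 // lt_min r10.
have r2r x : vmod (x - w) <= r2 -> vmod (x - w) < r1 /\ vmod (x - w) < r.
  move=> h; have : r2 < Num.min r1 r by rewrite /r2; have : 0 < Num.min r1 r; [rewrite lt_min r10|lra].
  by move/(le_lt_trans h); rewrite lt_min => /andP.
(* The foot [ppi x] is within r / 4 of [w], and 8 |e| <= r leaves room for the disc |t| <= 4
   required by [taylor2]. *)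
have inb x (t : C) : vmod (x - w) <= r2 -> cmod t <= 4 -> vmod (ppi x + t *: e - w) < r.
  move=> /r2r[/hr1 h1 _] t4; rewrite addrAC; apply: (le_lt_trans (vmodD _ _)).
  rewrite vmodZ; have := ler_wpM2r (vmod_ge0 e) t4.
  by move: h1 er r0; set X := cmod _ * _; clear; lra.
(* The Taylor coefficients of [f] along [e] at the foot of [x]; there is no constant term since [f]
   vanishes at the foot. Outside the ball the pair is a dummy. *)
have tay x : exists d : C * C, vmod (x - w) <= r2 -> [/\ cmod d.1 <= K * M, cmod d.2 <= K * M,
    (forall t, cmod t <= K^-1 -> cmod (f (ppi x + t *: e) - (d.1 * t + d.2 * t ^+ 2)) <= K * M * cmod t ^+ 3)
    & d.1 = 'd f (ppi x) e].
  have [hx|nx] := pselect (vmod (x - w) <= r2); last by exists (0, 0).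
  have dF (t : C) : cmod t <= 4 -> exists d, has_cderiv (fun s : C => f (ppi x + s *: e)) t d.
    by move=> t4; exists ('d f (ppi x + t *: e) e); apply: differentiable_line; apply: df; exact: inb.
  have bF (t : C) : cmod t <= 4 -> cmod (f (ppi x + t *: e)) <= M.
    by move=> t4; apply: fM; exact: inb.
  have [d1 [d2 [b1 b2 h]]] := hK _ M dF bF.
  have h' t : cmod t <= K^-1 -> cmod (f (ppi x + t *: e) - (d1 * t + d2 * t ^+ 2)) <= K * M * cmod t ^+ 3.
    by move=> tK; have := h t tK; rewrite scale0r addr0 fpi ?add0r //; case: (r2r x hx).
  exists (d1, d2) => _; split=> //=.
  apply: (@has_cderiv_unique R (fun s : C => f (ppi x + s *: e)) 0); last first.
    rewrite -[X in 'd f X]addr0 -(scale0r e); apply: differentiable_line.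
    by apply: df; apply: inb => //; rewrite cmod0.
  have KM0 : 0 <= K * M by rewrite mulr_ge0 // ltW.
  apply: (@quadratic_has_cderiv R _ _ (K * M + K * M) K^-1); [by rewrite invr_gt0|lra|].
  move=> t tK; rewrite scale0r addr0 (fpi x (r2r x hx).2) subr0.
  have -> : f (ppi x + t *: e) - d1 * t = (f (ppi x + t *: e) - (d1 * t + d2 * t ^+ 2)) + d2 * t ^+ 2.
    by ring.
  apply: (le_trans (cmodD _ _)); apply: (le_trans (lerD (h' t tK) (lexx _))).
  rewrite cmodM cmodX mulrDl; apply: lerD; last by rewrite ler_wpM2r ?exprn_ge0 ?cmod_ge0.
  rewrite ler_wpM2l // exprSr ler_piMr ?exprn_ge0 ?cmod_ge0 //.
  by apply: (le_trans tK); rewrite invf_le1.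
pose d1 x := (sval (cid (tay x))).1; pose d2 x := (sval (cid (tay x))).2.
have dP x (hx : vmod (x - w) <= r2) := svalP (cid (tay x)) hx.
have ball0' : vmod (w - w) <= r2 by rewrite subrr vmod0 ltW.
have KM0 : 0 <= K * M by rewrite mulr_ge0 // ltW.
have dd1 : differentiable d1 w.
  pose s n : C := (K^-1 / n.+1%:R)%:C%C.
  have cs n : cmod (s n) = K^-1 / n.+1%:R.
    by rewrite cmodR ger0_norm // divr_ge0 // invr_ge0 ltW.
  have s0 n : 0 < cmod (s n) by rewrite cs divr_gt0 // invr_gt0.
  have sK n : cmod (s n) <= K^-1.
    by rewrite cs ler_pdivrMr // ler_peMr ?invr_ge0 ?(ltW K0) // ler1n.
  have Ki1 : K^-1 <= 1 by rewrite invf_le1.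
  pose us n x := f (ppi x + s n *: e) * (s n)^-1.
  have close n x : vmod (x - w) <= r2 -> cmod (us n x - d1 x) <= 2 * (K * M) * cmod (s n).
    move=> hx; have [b1 b2 h _] := dP x hx.
    have sn0 : s n != 0 by rewrite -cmod_gt0.
    rewrite (_ : us n x - d1 x = (f (ppi x + s n *: e) -
      (d1 x * s n + d2 x * s n ^+ 2) + d2 x * s n ^+ 2) / s n); last first.
      exact: division_identity1.
    rewrite cmodM cmodV ler_pdivrMr //; apply: (le_trans (cmodD _ _)).
    apply: (le_trans (lerD (h _ (sK n)) (lexx _))); rewrite cmodM cmodX.
    have h3 : cmod (s n) ^+ 3 <= cmod (s n) ^+ 2.
      by rewrite exprSr ler_piMr ?exprn_ge0 ?(ltW (s0 n)) // (le_trans (sK n)).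
    have := ler_wpM2l KM0 h3; have := ler_wpM2r (exprn_ge0 2 (ltW (s0 n))) b2.
    rewrite -/(d2 x) expr2; set S := cmod (s n); set D := cmod (d2 x); set Q := S ^+ 3.
    by clear; lra.
  apply: (@differentiable_uniform_limit R a w r2 (3 * (K * M)) us d1 r20).
  - move=> n x hx; apply: differentiableM; last exact: differentiable_cst.
    apply: (@differentiable_comp CF _ _ _ (fun x => ppi x + s n *: e) f).
      by apply: differentiableD; [apply: dpi; case: (r2r x hx)|exact: differentiable_cst].
    by apply: df; apply: inb => //; apply: (le_trans (sK n)); lra.
  - move=> n x hx; have [b1 _ _ _] := dP x hx; have := close n x hx.
    have := cmodD (us n x - d1 x) (d1 x); rewrite subrK -/(d1 x) in b1 *.
    have : 2 * (K * M) * cmod (s n) <= 2 * (K * M) by apply: ler_piMr; [exact: mulr_ge0|exact: le_trans (sK n) Ki1].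
    move: b1; set A := cmod (us n x); set B := cmod (d1 x); set D := cmod (_ - _); set S := _ * cmod _.
    by clear; lra.
  - move=> eps eps0; pose B := 2 * (K * M) * K^-1.
    have B0 : 0 <= B.
      by rewrite /B; apply: mulr_ge0; [exact: mulr_ge0|rewrite invr_ge0; exact: ltW].
    have [N hN] : exists N : nat, B / eps < N%:R.
      by exists (Num.Def.archi_bound (B / eps)); apply: archi_boundP; rewrite divr_ge0 // ltW.
    exists N => n x Nn hx; apply: (le_trans (close n x hx)); rewrite cs.
    rewrite (_ : 2 * (K * M) * (K^-1 / n.+1%:R) = B / n.+1%:R); last by rewrite /B -[RHS]mulrA.
    rewrite ler_pdivrMr // mulrC -ler_pdivrMr //; apply: (le_trans (ltW hN)).
    by rewrite ler_nat leqW.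
(* The second coefficient is only shown to be continuous at [w]: it is uniformly close to the
   symmetric second difference quotient [G], in which the odd terms cancel. *)
have d2c (eps : R) : 0 < eps -> exists r3 : R, 0 < r3 /\ forall x, vmod (x - w) < r3 ->
    cmod (d2 x - d2 w) <= eps.
  move=> eps0.
  have [t [t0 tK te]] : exists t : R, [/\ 0 < t, t <= K^-1 & t <= eps / (4 * (K * M) + 4)].
    by apply: scaled_small => //; rewrite divr_gt0 //; lra.
  pose T : C := t%:C%C; have cT : cmod T = t by rewrite cmodR gtr0_norm.
  have T0 : T != 0 by rewrite -cmod_gt0 cT.
  pose G x := (f (ppi x + T *: e) + f (ppi x + (- T) *: e)) * (2 * T ^+ 2)^-1.
  have t4 : t <= 4.
    apply: (le_trans tK); apply: (@le_trans _ _ 1); last lra.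
    by rewrite invf_le1.
  have closeG x : vmod (x - w) <= r2 -> cmod (d2 x - G x) <= eps / 4.
    move=> hx; have [_ _ h _] := dP x hx.
    have h1 := h T; have h2 := h (- T); rewrite cmodN cT in h1 h2.
    rewrite (_ : d2 x - G x = - ((f (ppi x + T *: e) - (d1 x * T + d2 x * T ^+ 2)) +
       (f (ppi x + (- T) *: e) - (d1 x * (- T) + d2 x * (- T) ^+ 2))) / (2 * T ^+ 2)); last first.
      exact: division_identity2.
    rewrite cmodM cmodN cmodV cmodM cmodX cT.
    have -> : cmod (2 : C) = 2 by rewrite -[2]/(2%:R) -(rmorph_nat (real_complex R)) cmodR ger0_norm.
    rewrite ler_pdivrMr ?mulr_gt0 ?exprn_gt0 //; apply: (le_trans (cmodD _ _)).
    apply: (le_trans (lerD (h1 tK) (h2 tK))).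
    have := te; rewrite ler_pdivlMr; last lra.
    move=> te'; have := ler_wpM2l (exprn_ge0 2 (ltW t0)) te'.
    have := exprn_ge0 3 (ltW t0); set Q := K * M; clear; lra.
  have dG : differentiable G w.
    have dt (s : C) : cmod s = t -> differentiable (fun x => f (ppi x + s *: e)) w.
      move=> st; apply: (@differentiable_comp CF _ _ _ (fun x => ppi x + s *: e) f).
        by apply: differentiableD; [exact: dpi|exact: differentiable_cst].
      by apply: df; apply: inb => //; rewrite st.
    apply: differentiableM; last exact: differentiable_cst.
    by apply: differentiableD; apply: dt; rewrite ?cmodN.
  have /continuousVP/(_ (eps / 4))[|r3 [r30 hr3]] := differentiable_continuous dG.
    by rewrite divr_gt0.
  exists (Num.min r2 r3); split; first by rewrite lt_min r20.
  move=> x; rewrite lt_min => /andP[/ltW xr2 xr3].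
  rewrite (_ : d2 x - d2 w = (d2 x - G x) + (G x - G w) - (d2 w - G w)); last by ring.
  apply: (le_trans (cmodB _ _)); apply: (le_trans (lerD (cmodD _ _) (lexx _))).
  apply: (le_trans (lerD (lerD (closeG _ xr2) (ltW (hr3 _ xr3))) (closeG _ ball0'))); lra.
have [kz [rz [kz0 rz0 hz]]] := differentiable_lipschitz dz.
have kE x : vmod (x - w) <= r2 -> cmod (z x) <= K^-1 ->
    cmod (k x - d1 x - d2 x * z x) <= K * M * cmod (z x) ^+ 2.
  move=> hx zK; have [_ _ h dE] := dP x hx; have [_ xr] := r2r x hx.
  rewrite /k; case: eqP => [zx|/eqP zx].
    have xpi : x = ppi x by rewrite {1}(xE x xr) zx scale0r addr0.
    have e1 : d1 x = 'd f x e by rewrite [RHS](congr1 (fun y => 'd f y e) xpi).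
    by rewrite e1 zx subrr mulr0 subr0 !cmod0 expr0n mulr0.
  have := h (z x) zK; rewrite -(xE x xr) => hh.
  have -> : f x / z x - d1 x - d2 x * z x = (f x - (d1 x * z x + d2 x * z x ^+ 2)) / z x.
    by field.
  rewrite cmodM cmodV ler_pdivrMr ?cmod_gt0 //; apply: (le_trans hh).
  by rewrite exprSr mulrA.
(* Freezing [d2] at [w] makes the second summand differentiable. The first is o(|y - w|): k = d1 +
   d2 z + O(z^2), [z] is Lipschitz at [w], and [d2] is continuous there. *)
rewrite (_ : k = (fun x => k x - (d1 x + d2 w * z x)) + (fun x => d1 x + d2 w * z x)); last first.
  by apply/funext => x /=; rewrite !fctE subrK.
apply: differentiableD; last first.
  apply: differentiableD => //; apply: differentiableM => //; exact: differentiable_cst.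
apply: differentiable0P => eps eps0.
have ek0 : 0 < eps / (2 * kz) by rewrite divr_gt0 // mulr_gt0.
have [r3 [r30 hr3]] := d2c _ ek0.
have [t [t0 tK te]] : exists t : R, [/\ 0 < t, t <= K^-1 & t <= eps / (2 * kz) / (K * M + 1)].
  by apply: scaled_small => //; rewrite divr_gt0 //; lra.
exists (Num.min (Num.min r2 r3) (Num.min rz (t / kz))).
split; first by rewrite !lt_min r20 r30 rz0 divr_gt0.
move=> y; rewrite !lt_min => /andP[/andP[/ltW yr2 yr3] /andP[yrz yt]].
have zyl := hz y yrz; rewrite zw subr0 in zyl.
have zt : cmod (z y) <= t.
  by apply: (le_trans zyl); rewrite mulrC -ler_pdivlMr // ltW.
have h1 := kE y yr2 (le_trans zt tK).
have kw : k w - d1 w = 0.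
  have := kE w ball0'; rewrite zw cmod0 mulr0 subr0 expr0n /= mulr0 => h.
  apply/eqP; rewrite -cmod_eq0 eq_le cmod_ge0 andbT; apply: h.
  by rewrite invr_ge0 ltW.
rewrite zw mulr0 addr0 kw subr0.
have -> : k y - (d1 y + d2 w * z y) = (k y - d1 y - d2 y * z y) + (d2 y - d2 w) * z y by ring.
apply: (le_trans (cmodD _ _)); rewrite cmodM.
apply: (le_trans (lerD h1 (ler_wpM2r (cmod_ge0 _) (hr3 _ yr3)))).
have h4 : K * M * cmod (z y) ^+ 2 <= eps / (2 * kz) * cmod (z y).
  rewrite expr2 mulrA ler_wpM2r ?cmod_ge0 //.
  apply: (le_trans (ler_wpM2l KM0 (le_trans zt te))).
  rewrite mulrA ler_pdivrMr; last lra.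
  by rewrite mulrC ler_wpM2l ?(ltW ek0) //; lra.
apply: (le_trans (lerD h4 (lexx _))).
rewrite -mulrDl.
apply: (le_trans (ler_wpM2l (_ : 0 <= eps / (2 * kz) + eps / (2 * kz)) zyl)); first lra.
rewrite le_eqVlt; apply/orP; left; apply/eqP; field; exact: lt0r_neq0.
Qed.

End Division.

Section Hypersurface.
Variable R : realType.
Local Notation CF := (complex_complex__canonical__Num_NumField R).
Local Notation C := (Num.NumField.sort CF).

Lemma differentiable_near_eq (V : normedModType CF) (f g : V -> C) (x : V) (r : R) :
  0 < r -> (forall y, vmod (y - x) < r -> f y = g y) ->
  differentiable f x -> differentiable g x.
Proof.
move=> r0 fg df; rewrite (_ : g = (fun y => g y - f y) + f); last first.
  by apply/funext => y /=; rewrite !fctE subrK.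
apply: differentiableD; last exact: df.
apply: differentiable0P => e e0; exists r; split=> // y yr.
have fx : f x = g x by apply: fg; rewrite subrr vmod0.
by rewrite (fg y yr) fx !subrr cmod0 mulr_ge0 ?vmod_ge0 // ltW.
Qed.

(** Removes the normalisations of [division_scaled]: on a smaller ball [f] is bounded by continuity,
    and replacing [e] by [c *: e] and [z] by [z / c] makes the direction short. *)
Lemma division_at (a : nat) (f z : 'rV[CF]_a -> C) (ppi : 'rV[CF]_a -> 'rV[CF]_a)
    (w e : 'rV[CF]_a) (r : R) : 0 < r ->
  (forall y, vmod (y - w) < r -> differentiable f y) ->
  (forall x, vmod (x - w) < r -> differentiable ppi x) ->
  differentiable z w ->
  (forall x, vmod (x - w) < r -> x = ppi x + z x *: e) ->
  (forall x, vmod (x - w) < r -> f (ppi x) = 0) ->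
  z w = 0 ->
  differentiable (fun x => if z x == 0 then 'd f x e else f x / z x) w.
Proof.
move=> r0 df dpi dz xE fpi zw.
have dfw : differentiable f w by apply: df; rewrite subrr vmod0.
have /continuousVP/(_ 1 ltr01)[r1 [r10 hr1]] := differentiable_continuous dfw.
pose r' := Num.min r r1; have r'0 : 0 < r' by rewrite lt_min r0.
have E0 : 0 < 8 * (vmod e + 1) by have := vmod_ge0 e; lra.
pose c : C := (r' / (8 * (vmod e + 1)))%:C%C.
have c_gt0 : 0 < r' / (8 * (vmod e + 1)) by rewrite divr_gt0.
have c0 : c != 0 by rewrite -cmod_gt0 cmodR gtr0_norm.
have ce : 8 * vmod (c *: e) <= r'.
  rewrite vmodZ cmodR gtr0_norm // mulrCA mulrAC ler_pdivrMr // ler_pM2l //.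
  by have := vmod_ge0 e; lra.
have dz' : differentiable (fun x => z x * c^-1) w.
  by apply: differentiableM => //; exact: differentiable_cst.
have ballr x : vmod (x - w) < r' -> vmod (x - w) < r by rewrite lt_min => /andP[].
have := @division_scaled R a f (fun x => z x * c^-1) ppi w (c *: e) r' (cmod (f w) + 1)
  r'0 ce (fun y hy => df y (ballr y hy)).
have bf y : vmod (y - w) < r' -> cmod (f y) <= cmod (f w) + 1.
  rewrite lt_min => /andP[_ /hr1 h]; have := cmodD (f y - f w) (f w).
  by rewrite subrK; lra.
have xE' x : vmod (x - w) < r' -> x = ppi x + (z x * c^-1) *: (c *: e).
  by move=> /ballr/xE {1}->; rewrite scalerA divfK.
move=> /(_ bf (fun y hy => dpi y (ballr y hy)) dz' xE' (fun y hy => fpi y (ballr y hy))).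
rewrite zw mul0r => /(_ erefl) dk.
rewrite (_ : (fun x => _) = (fun x => c^-1 : C) * (fun x => if z x * c^-1 == 0 then 'd f x (c *: e) else f x / (z x * c^-1))).
  by apply: differentiableM => //; exact: differentiable_cst.
apply/funext => x; rewrite !fctE mulf_eq0 invr_eq0 (negPf c0) orbF.
case: ifP => [_|_]; last by rewrite invfM invrK (mulrC _ c) (mulrCA (f x)) mulKf.
have -> : 'd f x (c *: e) = c * 'd f x e by rewrite linearZ.
by rewrite mulKf.
Qed.

(** As [H] is affine along [e], moving [x] by [- z x] with z = (H - 1) / A lands on H = 1. Division
    of [f] by [z] gives [k], and g = k / A. *)
Lemma hypersurface_division (a : nat) (H A : 'rV[CF]_a -> C) (e w : 'rV[CF]_a)
    (U : set 'rV[CF]_a) (f : 'rV[CF]_a -> C) :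
  (forall x, differentiable H x) -> (forall x, differentiable A x) ->
  (forall x (t : C), H (x + t *: e) = H x + t * A x) ->
  open U -> U w -> H w = 1 -> A w != 0 ->
  (forall x, U x -> differentiable f x) ->
  (forall x, U x -> H x = 1 -> f x = 0) ->
  exists (W : set 'rV[CF]_a) (g : 'rV[CF]_a -> C),
    [/\ open W, W w, W `<=` U & forall x, W x -> differentiable g x /\ f x = g x * (H x - 1)].
Proof.
move=> dH dA HE oU Uw Hw Aw df f0.
pose z x := (H x - 1) * (A x)^-1.
pose ppi x := x - z x *: e.
have dz x : A x != 0 -> differentiable z x.
  move=> Ax; apply: differentiableM; last exact: differentiableV.
  by apply: differentiableB => //; exact: differentiable_cst.
have dpi x : A x != 0 -> differentiable ppi x.
  move=> Ax; apply: differentiableB; first exact: ex_diff.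
  by apply: differentiableZl; exact: dz.
have xE x : x = ppi x + z x *: e by rewrite subrK.
have HZ x : A x != 0 -> H (ppi x) = 1.
  by move=> Ax; rewrite /ppi -scaleNr HE /z mulNr divfK //; ring.
have zw : z w = 0 by rewrite /z Hw subrr mul0r.
have piw : ppi w = w by rewrite /ppi zw scale0r subr0.
have [r0 [r00 hr0]] : exists r : R, 0 < r /\ forall y, vmod (y - w) < r -> U y.
  by apply/nbhsVP; exact: open_nbhs_nbhs.
have [r1 [r10 hr1]] : exists r : R, 0 < r /\ forall y, vmod (y - w) < r -> A y != 0.
  have Aw' : 0 < cmod (A w) by rewrite cmod_gt0.
  have /continuousVP/(_ _ Aw')[r [rg hr]] := differentiable_continuous (dA w).
  exists r; split=> // y /hr; apply: contraTneq => ->.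
  by rewrite sub0r cmodN ltxx.
have [r2 [r20 hr2]] : exists r : R, 0 < r /\ forall y, vmod (y - w) < r -> U (ppi y).
  have cpi : {for w, continuous ppi} := differentiable_continuous (dpi w Aw).
  have /cpi/nbhsVP : nbhs (ppi w) U by rewrite piw; exact: open_nbhs_nbhs.
  by move=> [r [rg h]]; exists r.
pose r := Num.min r0 (Num.min r1 r2).
have rg : 0 < r by rewrite !lt_min r00 r10.
have inr x : vmod (x - w) < r -> [/\ U x, A x != 0 & U (ppi x)].
  by rewrite !lt_min => /andP[/hr0 h0 /andP[/hr1 h1 /hr2 h2]].
pose k x := if z x == 0 then 'd f x e else f x / z x.
have dk x : vmod (x - w) < r / 2 -> differentiable k x.
  move=> xr; have ball y : vmod (y - x) < r / 2 -> vmod (y - w) < r.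
    move=> yx; have := vmodD (y - x) (x - w); rewrite addrA subrK; lra.
  have xx : vmod (x - x) < r / 2 by rewrite subrr vmod0 divr_gt0.
  have [Ux Ax _] := inr x (ball x xx).
  (* At points of the hypersurface the division is recentred at [x], the radius r / 2 keeping its
     ball inside that of [w]; elsewhere [k] is an ordinary quotient near [x]. *)
  have [zx|zx] := eqVneq (z x) 0.
    have rr0 : 0 < r / 2 by rewrite divr_gt0.
    have d1 y : vmod (y - x) < r / 2 -> differentiable f y by move=> /ball/inr[]/df.
    have d2 y : vmod (y - x) < r / 2 -> differentiable ppi y by move=> /ball/inr[_ /dpi].
    have d3 y : vmod (y - x) < r / 2 -> f (ppi y) = 0.
      by move=> /ball/inr[_ Ay Uy]; apply: f0 => //; exact: HZ.
    exact: (@division_at a f z ppi x e (r / 2) rr0 d1 d2 (dz x Ax) (fun y _ => xE y) d3 zx).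
  have zx0 : 0 < cmod (z x) by rewrite cmod_gt0.
  have /continuousVP/(_ _ zx0)[s [s0 hs]] := differentiable_continuous (dz x Ax).
  apply: (@differentiable_near_eq _ (fun y => f y * (z y)^-1) k x s s0) => [y /hs h|].
    rewrite /k; case: eqP => // zy; move: h; rewrite zy sub0r cmodN ltxx //.
  apply: differentiableM; first exact: df.
  by apply: differentiableV => //; exact: dz.
exists [set x | vmod (x - w) < r / 2], (fun x => k x * (A x)^-1); split.
- rewrite openE => x xr; apply/nbhsVP; exists (r / 2 - vmod (x - w)).
  split; first by rewrite subr_gt0.
  by move=> y yx; have := vmodD (y - x) (x - w); rewrite addrA subrK /=; lra.
- by rewrite /= subrr vmod0 divr_gt0.
- by move=> x xr; have [] := inr x; first by move: xr => /=; lra.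
- move=> x xr; have [Ux Ax Upx] : [/\ U x, A x != 0 & U (ppi x)].
    by apply: inr; move: xr => /=; lra.
  split.
    by apply: differentiableM; [exact: dk|exact: differentiableV].
  rewrite /k; case: eqP => [zx|/eqP zx].
    have xp : x = ppi x by rewrite {1}(xE x) zx scale0r addr0.
    have Hx : H x = 1 by rewrite xp HZ.
    by rewrite Hx subrr mulr0 f0.
  rewrite /z in zx *; move: zx; rewrite mulf_eq0 negb_or => /andP[Hx _].
  by field; apply/andP.
Qed.

End Hypersurface.

(** * Germs, stalks and quotient sheaves *)

Section GrassmannInverse.
Variables (b : nat) (R : comPzRingType).
Local Notation G := (grassmann b R).
Implicit Types (f g : G) (S T : {set 'I_b}).

Lemma gconst_comm c f : f * gconst b c = gconst b c * f.
Proof.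
rewrite (ghomogD f) mulrDl mulrDr.
rewrite (gpartC (@ghomogP b R false f) (@gpart_const b R c)).
by rewrite (gpartC (@ghomogP b R true f) (@gpart_const b R c)) !expr0 !mul1r.
Qed.

Lemma gbodyM f g : gbody (f * g) = gbody f * gbody g.
Proof.
rewrite /gbody gmE gmulE (bigD1 finset.set0) ?finset.sub0set //= ninv0l expr0 mul1r finset.setD0.
by rewrite big1 ?addr0 // => T /andP[]; rewrite finset.subset0 => /eqP ->; rewrite eqxx.
Qed.

(** By induction [f ^+ k] has no coefficient at sets of fewer than k elements. *)
Lemma gbody_nilpotent f : gbody f = 0 -> f ^+ b.+1 = 0.
Proof.
move=> f0; have fk k S : (#|S| < k)%N -> (f ^+ k) S = 0.
  elim: k S => // k IH S; rewrite ltnS => Sk; rewrite exprSr gmE gmulE big1 // => T TS.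
  have [->|TnS] := eqVneq T S.
    by rewrite finset.setDv -[f finset.set0]/(gbody f) f0 mulr0.
  rewrite IH ?mulr0 ?mul0r //; apply: leq_trans Sk.
  by apply: fintype.proper_card; rewrite finset.properEneq TnS.
apply/ffunP => S; rewrite gzeroE; apply: fk; rewrite ltnS.
by rewrite -[X in (_ <= X)%N](card_ord b) max_card.
Qed.

(** After multiplication by [c] the element is 1 minus a nilpotent, inverted by a finite geometric
    series. *)
Lemma ginvertible f c : c * gbody f = 1 -> exists g, f * g = 1 /\ g * f = 1.
Proof.
move=> cf; pose n := 1 - gconst b c * f.
have n0 : n ^+ b.+1 = 0.
  apply: gbody_nilpotent; rewrite /n /gbody gaddE goppE gconst_mulE -/(gbody f) cf.
  by rewrite [1]/(gconst b 1) ffunE eqxx subrr.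
pose s := \sum_(i < b.+1) n ^+ i.
have e1 : (1 - n) * s = 1.
  have := subrX1 n b.+1; rewrite n0 sub0r -/s => h.
  by rewrite -opprB mulNr -h opprK.
have ns : GRing.comm n s.
  by apply: commr_sum => i _; apply: commrX.
have e2 : s * (1 - n) = 1.
  by rewrite -[RHS]e1 mulrBr mulrBl mulr1 mul1r ns.
have nE : 1 - n = gconst b c * f by rewrite opprB addrC subrK.
exists (gconst b c * s); split.
  by rewrite mulrA gconst_comm -nE e1.
by rewrite -gconst_comm -mulrA -nE.
Qed.

End GrassmannInverse.

(** A proper ideal contains no right invertible element, so it lies in the kernel of [v]. *)
Lemma local_ring_of_value (A : pzRingType) (K : fieldType) (v : A -> K) :
  v 0 = 0 -> v 1 = 1 -> (forall x y, v (x + y) = v x + v y) ->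
  (forall x y, v (x * y) = v x * v y) ->
  (forall x, v x != 0 -> exists y, x * y = 1) -> local_ring A.
Proof.
move=> v0 v1 vD vM vU; pose M := [set x | v x = 0].
have MI : ring_ideal M.
  split=> [//|x y|c x]; rewrite /M /= ?vD ?vM; first by move=> -> ->; rewrite addr0.
  by move=> ->; rewrite mulr0 mul0r.
have sub N : ring_ideal N -> ~ N 1 -> N `<=` M.
  move=> NI N1 x Nx; apply: contrapT => /eqP vx; have [y xy] := vU x vx.
  by apply: N1; rewrite -xy; exact: (Defs.idealMr NI).
have M1 : ~ M 1 by rewrite /M /= v1; apply/eqP; exact: oner_neq0.
exists M; split.
  by split=> // N NI N1 MN; apply/seteqP; split=> //; exact: sub.
by move=> N [NI N1 Nmax]; rewrite (Nmax M) //; exact: sub.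
Qed.

Section QuotientSheafIsSheaf.
Variables (K : numFieldType) (T : topologicalType) (P : presheaf K T).
Variables (J : ideal_presheaf P) (V : set T).

Lemma germ_of_irr (x : T) (U : opens T) (Ux Ux' : oset U x) (s : P U) :
  germ_of J Ux s = germ_of J Ux' s.
Proof. by rewrite (Prop_irrelevance Ux Ux'). Qed.

(** Sections are families of germs, so they glue pointwise; only the local origin of the glued
    family in sections over ambient open sets has to be checked. *)
Lemma quotient_sheaf_is_sheaf : is_sheaf (quotient_sheaf J V).
Proof.
move=> I U W UW eW s compat.
have cov w : oset W w -> exists i, oset (U i) w.
  by rewrite eW => -[i _ Uw]; exists i.
have agree i j w (Ui : oset (U i) w) (Uj : oset (U j) w) :
    qval (s i) Ui = qval (s j) Uj.
  have := congr1 (fun t : quot_section J (opensI (U i) (U j)) => qval t (conj Ui Uj)) (compat i j).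
  rewrite /= => e.
  have irr k (p p' : oset (U k) w) : qval (s k) p = qval (s k) p'.
    by congr (qval _ _); exact: Prop_irrelevance.
  by rewrite (irr i Ui (subo_Il (U i) (U j) w (conj Ui Uj))) e; exact: irr.
pose tv w (Ww : oset W w) := qval (s (sval (cid (cov w Ww)))) (svalP (cid (cov w Ww))).
have tloc v : oset W v -> exists (B : opens T) (f : P B), oset B (set_val v) /\
    forall (w : V) (Ww : oset W w) (Bw : oset B (set_val w)), tv w Ww = germ_of J Bw f.
  move=> Wv; have [i Uv] := cov v Wv.
  have [B [f [Bv hf]]] := qval_loc (s i) Uv.
  (* [U i] is the trace of an ambient open set [N]; restricting the representative of [s i] to [N]
     makes it valid at all points met. *)
  have [N oN NU] := oopen (U i).
  pose N' := Opens oN.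
  have N'U w : oset N' (set_val w) -> oset (U i) w by move=> h; rewrite -NU.
  exists (opensI B N'), (pres P (subo_Il B N') f); split.
    by split=> //; move: Uv; rewrite -NU.
  move=> w Ww [Bw Nw]; rewrite germ_res /tv (agree _ i w _ (N'U w Nw)).
  exact: hf.
exists (QuotSection tloc); split.
  move=> i; apply: quot_section_ext => w Uw /=; exact: agree.
move=> t ht; apply: quot_section_ext => w Ww /=.
have [i Uw] := cov w Ww.
rewrite /tv (agree _ i w _ Uw).
have := congr1 (fun t : quot_section J (U i) => qval t Uw) (ht i) => /= <-.
by congr (qval t _); exact: Prop_irrelevance.
Qed.

End QuotientSheafIsSheaf.

Section HolomorphicValues.
Variables (R : realType) (a : nat).
Local Notation CF := (complex_complex__canonical__Num_NumField R).
Local Notation C := (Num.NumField.sort CF).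
Local Notation V := 'rV[CF]_a.
Implicit Types (U W : opens V) (x : V).

Lemma opens_ballP U x : oset U x ->
  exists r : R, 0 < r /\ forall y, vmod (y - x) < r -> oset U y.
Proof. by move=> Ux; apply/nbhsVP; apply: open_nbhs_nbhs; split=> //; exact: oopen. Qed.

(** Extension by 0, so that sections over different open sets are compared as functions on the whole
    space; differentiability is claimed only at points of [U]. *)
Definition hev U (f : hol U) (x : V) : C :=
  if pselect (oset U x) is left Ux then f (exist _ x (mem_set Ux)) else 0.

Lemma hevE U (f : hol U) (u : oset U) : hev f (set_val u) = f u.
Proof.
rewrite /hev; case: pselect => [Ux|]; last by case; exact: set_valP.
by congr (hfun f _); exact: val_inj.
Qed.

Lemma hev_exist U (f : hol U) x (Ux : oset U x) : exists u : oset U, set_val u = x.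
Proof. by exists (exist _ x (mem_set Ux)). Qed.

Lemma hev_ext U (f g : hol U) : (forall x, oset U x -> hev f x = hev g x) -> f = g.
Proof.
by move=> fg; apply: hol_ext => u; rewrite -!hevE; apply: fg; exact: set_valP.
Qed.

Lemma hev_differentiable U (f : hol U) x : oset U x -> differentiable (hev f) x.
Proof.
move=> Ux; have /asboolP[g [gf dg]] := hfunP f.
have [r [r0 hr]] := opens_ballP Ux.
apply: (@differentiable_near_eq R _ g _ x r r0); last exact: dg.
move=> y /hr Uy; have [u <-] := hev_exist f Uy.
by rewrite hevE gf.
Qed.

Lemma mkhol_subproof U (g : V -> C) : (forall x, oset U x -> differentiable g x) ->
  (fun u : oset U => g (set_val u)) \in @hol_pred CF a U.
Proof. by move=> dg; apply/asboolP; exists g; split. Qed.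

Definition mkhol U (g : V -> C) (dg : forall x, oset U x -> differentiable g x) : hol U :=
  Hol (mkhol_subproof dg).

Lemma hev_mkhol U g (dg : forall x, oset U x -> differentiable g x) x :
  oset U x -> hev (mkhol dg) x = g x.
Proof. by move=> Ux; rewrite /hev; case: pselect. Qed.

Lemma hev0 U x : hev (0 : hol U) x = 0.
Proof. by rewrite /hev; case: pselect. Qed.

Lemma hevD U (f g : hol U) x : hev (f + g) x = hev f x + hev g x.
Proof. by rewrite /hev; case: pselect => // _; rewrite addr0. Qed.

Lemma hevN U (f : hol U) x : hev (- f) x = - hev f x.
Proof. by rewrite /hev; case: pselect => // _; rewrite oppr0. Qed.

Lemma hevM U (f g : hol U) x : hev (f * g) x = hev f x * hev g x.
Proof. by rewrite /hev; case: pselect => // _; rewrite mulr0. Qed.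

Lemma hev1 U x : oset U x -> hev (1 : hol U) x = 1.
Proof. by rewrite /hev; case: pselect. Qed.

Lemma hev_sum U (T : Type) (r : seq T) (P : pred T) (F : T -> hol U) x :
  hev (\sum_(i <- r | P i) F i) x = \sum_(i <- r | P i) hev (F i) x.
Proof. by apply: (big_morph (fun f => hev f x)) => [f g|]; [exact: hevD|exact: hev0]. Qed.

Lemma hev_res U W (h : W <=o U) (f : hol U) x : oset W x -> hev (hol_res h f) x = hev f x.
Proof.
move=> Wx; rewrite /hev; case: pselect => // Wx'; case: pselect => [Ux|]; last by case; exact: h.
by rewrite /=; congr (hfun f _); exact: val_inj.
Qed.

Lemma hev_poly U (f : poly_calg CF a) x : oset U x -> hev (hol_poly U f) x = mpeval f x.
Proof. by rewrite /hev; case: pselect. Qed.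

End HolomorphicValues.

Section PolynomialValues.
Variables (K : numFieldType) (a : nat).
Implicit Types (f g : mpoly.mpoly a K) (x : 'rV[K]_a).

Lemma mpeval0 x : mpeval (0 : mpoly.mpoly a K) x = 0. Proof. exact: rmorph0. Qed.
Lemma mpeval1 x : mpeval (1 : mpoly.mpoly a K) x = 1. Proof. exact: rmorph1. Qed.
Lemma mpevalB f g x : mpeval (f - g) x = mpeval f x - mpeval g x.
Proof. exact: rmorphB. Qed.
Lemma mpevalM f g x : mpeval (f * g) x = mpeval f x * mpeval g x.
Proof. exact: rmorphM. Qed.

End PolynomialValues.

(** * Germs modulo the analytic ideal are determined by values on the hypersurface *)

Section AnalyticGerms.
Variables (R : realType) (a b : nat).
Local Notation CF := (complex_complex__canonical__Num_NumField R).
Local Notation C := (Num.NumField.sort CF).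
Local Notation V := 'rV[CF]_a.
Local Notation S := (poly_superalgebra CF a b).
Variables (h : mpoly.mpoly a CF) (I : set S) (hI : homogeneous I).

Definition scoef (U : opens V) (s : hol_sections b U) (T : {set 'I_b}) : hol U :=
  (s : grassmann b (hol_calg U)) T.

Definition pcoef (f : S) (T : {set 'I_b}) : mpoly.mpoly a CF :=
  (f : grassmann b (poly_calg CF a)) T.

(** Satisfied by the kernel of [hyp_pres]: coefficients of its elements are the polynomials
    vanishing on h = 1. *)
Hypothesis hIE : forall f : S, I f <->
  forall T x, mpeval h x = 1 -> mpeval (pcoef f T) x = 0.

(** Smoothness of h = 1 in a strong form: near each of its points one coordinate can be solved for
    rationally. *)
Hypothesis hslope : forall w : V, mpeval h w = 1 ->
  exists (j : 'I_a) (A : mpoly.mpoly a CF), mpeval A w != 0 /\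
    forall (x : V) (t : C), mpeval h (x + t *: delta_mx 0 j) = mpeval h x + t * mpeval A x.

Local Notation J := (analytic_ideal hI).
Implicit Types (U W : opens V) (x w : V).

Lemma closed_pointsE x : closed_points I x <-> mpeval h x = 1.
Proof.
split=> [Ix|hx f /hIE If]; last exact: If.
pose f : S := gconst b ((h - 1 : poly_calg CF a)).
have : I f.
  apply/hIE => T y hy; rewrite /pcoef ffunE; case: ifP => _; last exact: mpeval0.
  by rewrite mpevalB mpeval1 hy subrr.
by move=> /Ix; rewrite /gbody ffunE eqxx mpevalB mpeval1 => /eqP; rewrite subr_eq0 => /eqP.
Qed.

Lemma analytic_ideal_vanish U (s : hol_sections b U) :
  J U s -> forall T x, mpeval h x = 1 -> hev (scoef s T) x = 0.
Proof.
move=> Js; pose N := [set s : hol_sections b U |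
  forall T x, mpeval h x = 1 -> hev (scoef s T) x = 0].
suff : ideal_gen (poly_section b U @` I) `<=` N by apply.
apply: ideal_gen_min.
  split.
  - by move=> T x _; rewrite /scoef gzeroE hev0.
  - by move=> s1 s2 h1 h2 T x hx; rewrite /scoef gaddE hevD h1 // h2 // addr0.
  - move=> c s1 h1; split=> T x hx; rewrite /scoef gmE gmulE hev_sum big1 // => T' _.
      by rewrite !hevM -/(scoef s1 _) h1 // mulr0.
    by rewrite !hevM -/(scoef s1 _) h1 // mulr0 mul0r.
move=> _ [f /hIE If <-] T x hx; rewrite /scoef /= ffunE.
have [Ux|nUx] := pselect (oset U x); first by rewrite hev_poly // If.
by rewrite /hev; case: pselect.
Qed.

(** The converse of [analytic_ideal_vanish] for germs, an analytic Nullstellensatz: each coefficient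
    is locally g_T (h - 1), so the section is [h - 1] times the section with coefficients g_T. *)
Lemma analytic_germ_eq0 U x (Ux : oset U x) (s : hol_sections b U) :
  mpeval h x = 1 ->
  (forall T y, oset U y -> mpeval h y = 1 -> hev (scoef s T) y = 0) ->
  germ_of J Ux s = 0.
Proof.
move=> hx s0.
have [j [A [Ax hA]]] := hslope hx.
have dh y : differentiable (mpeval h : V -> C) y := mpeval_differentiable h y.
have dA y : differentiable (mpeval A : V -> C) y := mpeval_differentiable A y.
have div T := @hypersurface_division R a _ _ (delta_mx 0 j) x (oset U) (hev (scoef s T))
  dh dA hA (oopen U) Ux hx Ax (fun y Uy => hev_differentiable _ Uy) (s0 T).
pose WT T := sval (cid (div T)); pose gT T := sval (cid (svalP (cid (div T)))).
have hT T : [/\ open (WT T), WT T x, WT T `<=` oset U &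
   forall y, WT T y -> differentiable (gT T) y /\
     hev (scoef s T) y = gT T y * (mpeval h y - 1)].
  exact: svalP (cid (svalP (cid (div T)))).
(* There are finitely many index sets [T], so one neighbourhood serves all coefficients. *)
pose W := Opens (open_interior [set y | forall T, WT T y]).
have Wx : oset W x.
  rewrite /=; suff : \forall y \near x, forall T, WT T y by [].
  apply: (@filter_forall _ _ (fun T y => WT T y) (nbhs x) (@nbhs_filter V x)) => T.
  by have [oW WTx _ _] := hT T; exact: open_nbhs_nbhs.
have WWT T y : oset W y -> WT T y by move=> /interior_subset /(_ T).
have WU : W <=o U by move=> y /(WWT finset.set0); have [_ _ + _] := hT finset.set0; apply.
rewrite -(germ_res J Ux Wx WU) -(germ_of0 J Wx); apply: germ_eqJ; rewrite subr0.
have dg T y : oset W y -> differentiable (gT T) y.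
  by move=> /(WWT T) Wy; have [_ _ _ /(_ y Wy)[]] := hT T.
pose g : hol_sections b W := [ffun T : {set 'I_b} => mkhol (dg T)] : grassmann b (hol_calg W).
pose f : S := gconst b (h - 1 : poly_calg CF a).
have If : I f.
  apply/hIE => T y hy; rewrite /pcoef ffunE; case: ifP => _; last exact: mpeval0.
  by rewrite mpevalB mpeval1 hy subrr.
have -> : pres (hol_sheaf CF a b) WU s = poly_section b W f * g.
  apply/ffunP => T; rewrite /= gmap_const gconst_mulE !ffunE.
  apply: hev_ext => y Wy; rewrite hev_res // hevM hev_mkhol // hev_poly //.
  have [_ _ _ /(_ y (WWT T y Wy))[_]] := hT T; rewrite /scoef => ->.
  by rewrite mulrC mpevalB mpeval1.
apply: (Defs.idealMr (ideal_gen_ideal _)); apply: ideal_gen_sub; exists f => //.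
Qed.

(** Read off a chosen representative; on h = 1 the choice is harmless by [analytic_ideal_vanish]. *)
Definition gval (w : V) (g : germ J w) (T : {set 'I_b}) : C := hev (scoef (gsec (grepr g)) T) w.

Lemma gval_germ_of U w (Uw : oset U w) (s : hol_sections b U) T : mpeval h w = 1 ->
  gval (germ_of J Uw s) T = hev (scoef s T) w.
Proof.
move=> hw; rewrite /gval; have := greprK (germ_of J Uw s).
move: (grepr (germ_of J Uw s)) => [U' U'w s'] /= /germ_of_repP[/= W [hs [ht [Ww JW]]]].
have := analytic_ideal_vanish JW T hw.
rewrite /scoef gaddE goppE hevD hevN !ffunE !hev_res // => /eqP.
by rewrite subr_eq0 => /eqP.
Qed.

(** All identities of germs in the chart are reduced by this to identities of values on the
    hypersurface. *)
Lemma germ_of_eq U U' w (Uw : oset U w) (U'w : oset U' w)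
    (s : hol_sections b U) (s' : hol_sections b U') : mpeval h w = 1 ->
  (forall T y, oset U y -> oset U' y -> mpeval h y = 1 ->
     hev (scoef s T) y = hev (scoef s' T) y) ->
  germ_of J Uw s = germ_of J U'w s'.
Proof.
move=> hw ss'; have Ww : oset (opensI U U') w by split.
rewrite -(germ_res J Uw Ww (subo_Il U U')) -(germ_res J U'w Ww (subo_Ir U U')).
apply/eqP; rewrite -subr_eq0 -germ_ofB; apply/eqP; apply: analytic_germ_eq0 => // T y [Uy U'y] hy.
rewrite /scoef gaddE goppE hevD hevN !ffunE !hev_res //; [|by split..].
by apply/eqP; rewrite subr_eq0; apply/eqP; exact: ss'.
Qed.

End AnalyticGerms.

Section AnalyticStalks.
Variables (R : realType) (a b : nat).
Local Notation CF := (complex_complex__canonical__Num_NumField R).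
Local Notation C := (Num.NumField.sort CF).
Local Notation V := 'rV[CF]_a.
Local Notation S := (poly_superalgebra CF a b).
Variables (h : mpoly.mpoly a CF) (I : set S) (hI : homogeneous I).
Hypothesis hIE : forall f : S, I f <->
  forall T x, mpeval h x = 1 -> mpeval (pcoef f T) x = 0.

Local Notation J := (analytic_ideal hI).
Local Notation X := (analytic_space hI).
Local Notation Q := (rsheaf X).

Lemma set_val_continuous (T : topologicalType) (A : set T) : continuous (@set_val T A).
Proof. exact: initial_continuous. Qed.

Lemma continuous_set_type (T1 T2 : topologicalType) (A : set T2) (f : T1 -> A) :
  continuous (fun x => set_val (f x) : T2) -> continuous f.
Proof.
by move=> /continuousP cf; apply/continuousP => _ [B oB <-]; exact: (cf B oB).
Qed.

Lemma point_hE (v : X) : mpeval h (set_val v) = 1.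
Proof. by apply/(closed_pointsE hIE); exact: set_valP. Qed.

(** An element of this stalk is a germ of families of germs; its value is the body at [v] of the
    member of the family at [v]. *)
Definition stalk_value (v : X) (g : stalk Q v) : C :=
  let s := grepr (g : germ (ideal_presheaf0 Q) v) in
  gval (qval (gsec s : quot_section J (gdom s)) (gmem s)) finset.set0.

Lemma stalk_value_germ (v : X) (W : opens X) (Wv : oset W v) (s : Q W) :
  stalk_value (germ_of (ideal_presheaf0 Q) Wv s) = gval (qval (s : quot_section J W) Wv) finset.set0.
Proof.
rewrite /stalk_value; have := greprK (germ_of (ideal_presheaf0 Q) Wv s).
move: (grepr _) => [W' W'v s'] /= /germ_of_repP[/= W2 [hs [ht [W2v e0]]]].
have : pres Q hs s' = pres Q ht s.
  by apply/eqP; rewrite -subr_eq0; apply/eqP; exact: e0.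
move=> /(congr1 (fun t : quot_section J W2 => qval t W2v)) /= e.
rewrite (Prop_irrelevance W'v (hs v W2v)) (Prop_irrelevance Wv (ht v W2v)).
by rewrite e.
Qed.

Lemma gvalD (v : X) (g g' : germ J (set_val v)) T : gval (g + g') T = gval g T + gval g' T.
Proof.
have [U [Ux [s [t [-> ->]]]]] := germ2W g g'; have hv := point_hE v.
by rewrite -germ_ofD !(gval_germ_of hI hIE) // /scoef gaddE hevD.
Qed.

Lemma gvalM0 (v : X) (g g' : germ J (set_val v)) :
  gval (g * g') finset.set0 = gval g finset.set0 * gval g' finset.set0.
Proof.
have [U [Ux [s [t [-> ->]]]]] := germ2W g g'; have hv := point_hE v.
rewrite -germ_ofM !(gval_germ_of hI hIE) // /scoef.
by rewrite -[(s * t : grassmann _ _) _]/(gbody (s * t : grassmann b (hol_calg U))) gbodyM hevM.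
Qed.

Lemma gval_scal (v : X) c : gval (germ_scal J (set_val v) c) finset.set0 = c.
Proof.
rewrite (gval_germ_of hI hIE) ?point_hE // /scoef /= ffunE eqxx.
by rewrite /hev; case: pselect => // -[].
Qed.

Lemma stalk_value_scal (v : X) c : stalk_value (germ_scal (ideal_presheaf0 Q) v c) = c.
Proof. by rewrite /germ_scal stalk_value_germ /= gval_scal. Qed.

(** A germ with nonzero value has a representative whose body has no zero on a neighbourhood; there
    the body has a holomorphic inverse and [ginvertible] applies. *)
Lemma analytic_stalk_local (v : X) : local_ring (stalk Q v).
Proof.
apply: (@local_ring_of_value _ CF (@stalk_value v)).
- exact: stalk_value_scal.
- exact: stalk_value_scal.
- move=> x y; have [W [Wv [s [t [-> ->]]]]] := germ2W (x : germ _ v) y.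
  by rewrite -[_ + _]germ_ofD !stalk_value_germ /= gvalD.
- move=> x y; have [W [Wv [s [t [-> ->]]]]] := germ2W (x : germ _ v) y.
  by rewrite -[_ * _]germ_ofM !stalk_value_germ /= gvalM0.
move=> x; have [W [Wv [s ->]]] := germW (x : germ _ v).
rewrite stalk_value_germ => sv0.
have [U [f [Uv hf]]] := qval_loc (s : quot_section J W) Wv.
rewrite (hf v Wv Uv) (gval_germ_of hI hIE) ?point_hE // in sv0.
set B := scoef f finset.set0 in sv0.
have oU' : open [set x | oset U x /\ hev B x != 0].
  rewrite openE => y [Uy By]; apply/nbhsVP.
  have [r [r0 hr]] := opens_ballP Uy.
  have By' : 0 < cmod (hev B y) by rewrite cmod_gt0.
  have /continuousVP/(_ _ By')[r' [r'0 hr']] :=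
    differentiable_continuous (hev_differentiable B Uy).
  exists (Num.min r r'); split; first by rewrite lt_min r0.
  move=> z; rewrite lt_min => /andP[/hr Uz /hr' Bz]; split=> //.
  by apply: contraTneq Bz => ->; rewrite sub0r cmodN ltxx.
pose U' := Opens oU'.
have U'U : U' <=o U by move=> y [].
pose f' := pres (hol_sheaf CF a b) U'U f.
have dB y : oset U' y -> differentiable (fun y => (hev B y)^-1) y.
  by move=> [Uy By]; apply: differentiableV => //; exact: hev_differentiable.
have [g [fg gf]] : exists g : grassmann b (hol_calg U'), (f' : grassmann b (hol_calg U')) * g = 1 /\ g * f' = 1.
  apply: (@ginvertible _ _ _ (mkhol dB)); apply: hev_ext => y U'y; have [Uy By] := U'y.
  by rewrite hevM hev_mkhol // hev1 // /gbody ffunE hev_res // mulVf.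
have U'v : oset U' (set_val v) by split.
pose W' : opens X := opensI W (opens_pre (@set_val_continuous _ (closed_points I)) U').
have W'v : oset W' v by split.
pose tval (w : X) (W'w : oset W' w) : germ J (set_val w) := germ_of J (proj2 W'w : oset U' (set_val w)) g.
have tloc u : oset W' u -> exists (B : opens V) (f : hol_sheaf CF a b B), oset B (set_val u) /\
    forall (w : X) (Ww : oset W' w) (Bw : oset B (set_val w)), tval w Ww = germ_of J Bw f.
  move=> [_ U'u]; exists U', g; split=> // w W'w U'w; exact: germ_of_irr.
pose t : quot_section J W' := QuotSection tloc.
exists (germ_of (ideal_presheaf0 Q) W'v (t : Q W')).
have W'W : W' <=o W by move=> w [].
rewrite -(germ_res (ideal_presheaf0 Q) Wv W'v W'W) -[LHS]germ_ofM.
rewrite -(germ_of1 (ideal_presheaf0 Q) W'v); congr germ_of.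
apply: quot_section_ext => w W'w /=; have [Ww U'w] := W'w.
rewrite /tval (hf w (W'W w W'w) (U'U _ U'w)) -(germ_res J _ U'w U'U).
rewrite (germ_of_irr J (proj2 W'w) U'w) -germ_ofM -/f'.
rewrite -[germ_scal J (set_val w) 1]/(1 : germ J (set_val w)) -(germ_of1 J U'w); congr germ_of; exact: fg.
Qed.

Lemma analytic_is_superspace : is_superspace X.
Proof.
by split; [exact: quotient_sheaf_is_sheaf|exact: analytic_stalk_local].
Qed.

End AnalyticStalks.

(** * Charts of the hypersurface *)

Section Chart.
Variables (R : realType) (p b : nat).
Local Notation CF := (complex_complex__canonical__Num_NumField R).
Local Notation C := (Num.NumField.sort CF).
Local Notation V := 'rV[CF]_p.+1.
Local Notation S := (poly_superalgebra CF p.+1 b).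
Variables (h : mpoly.mpoly p.+1 CF) (I : set S) (hI : homogeneous I).
Hypothesis hIE : forall f : S, I f <->
  forall T x, mpeval h x = 1 -> mpeval (pcoef f T) x = 0.
Variables (j : 'I_p.+1) (A : mpoly.mpoly p.+1 CF).
Hypothesis hA : forall (x : V) (t : C),
  mpeval h (x + t *: delta_mx 0 j) = mpeval h x + t * mpeval A x.

Local Notation X := (analytic_space hI).
Local Notation Y := (affine_superspace CF p b).

Definition insert (y : 'rV[CF]_p) (t : C) : V :=
  \row_i (if unlift j i is Some k then y 0 k else t).

Definition drop_coord (x : V) : 'rV[CF]_p := col' j x.

Lemma drop_insert y t : drop_coord (insert y t) = y.
Proof. by apply/rowP => k; rewrite !mxE liftK. Qed.

Lemma insert_drop x : insert (drop_coord x) (x 0 j) = x.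
Proof.
apply/rowP => i; rewrite mxE; case: unliftP => [k ->|->] //.
by rewrite mxE.
Qed.

Lemma insertD y t s : insert y (t + s) = insert y t + s *: delta_mx 0 j.
Proof.
apply/rowP => i; rewrite !mxE eqxx /=; case: unliftP => [k ->|->].
  by rewrite [lift j k == j]eq_sym (negPf (neq_lift _ _)) mulr0 addr0.
by rewrite eqxx mulr1.
Qed.

(** Expand [h] at x + (t + 1) e_j in one step from [x] and in two steps through x + t e_j. *)
Lemma slope_invariant x t : mpeval A (x + t *: delta_mx 0 j) = mpeval A x.
Proof.
have := hA (x + t *: delta_mx 0 j) 1; rewrite -addrA -scalerDl !hA !mul1r => e.
by apply: (addrI (mpeval h x + t * mpeval A x)); rewrite -e mulrDl mul1r addrA.
Qed.

Lemma slope_insert y t : mpeval A (insert y t) = mpeval A (insert y 0).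
Proof. by rewrite -[t]add0r insertD slope_invariant. Qed.

Lemma slope_drop x : mpeval A (insert (drop_coord x) 0) = mpeval A x.
Proof. by rewrite -(slope_insert _ (x 0 j)) insert_drop. Qed.

(* chart_fun y is the t solving h (insert y t) = 1. *)
Definition chart_fun (y : 'rV[CF]_p) : C :=
  (1 - mpeval h (insert y 0)) * (mpeval A (insert y 0))^-1.

Definition chart_sec (y : 'rV[CF]_p) : V := insert y (chart_fun y).

Lemma chart_secE y : mpeval A (insert y 0) != 0 -> mpeval h (chart_sec y) = 1.
Proof.
move=> Ay; rewrite /chart_sec -[chart_fun y]add0r insertD hA /chart_fun divfK //.
by rewrite addrC subrK.
Qed.

Lemma chart_sec_drop x : mpeval h x = 1 -> mpeval A x != 0 -> chart_sec (drop_coord x) = x.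
Proof.
move=> hx Ax; rewrite -[RHS]insert_drop /chart_sec; congr insert.
have := hA (insert (drop_coord x) 0) (x 0 j).
rewrite -insertD add0r insert_drop hx slope_drop /chart_fun slope_drop => ->.
by rewrite addrAC subrr add0r mulfK.
Qed.

Lemma row_differentiable (n k : nat) (F : 'rV[CF]_n -> 'rV[CF]_k) x :
  (forall i, differentiable (fun y => F y 0 i : C) x) -> differentiable F x.
Proof.
move=> dF; rewrite (_ : F = \sum_i (fun y => F y 0 i *: (delta_mx 0 i : 'rV[CF]_k))); last first.
  by apply/funext => y; rewrite fct_sumE -row_sum_delta.
by apply: differentiable_sum => i; apply: differentiableZl.
Qed.

Lemma insert_differentiable (F : 'rV[CF]_p -> C) y : differentiable F y ->
  differentiable (fun y => insert y (F y)) y.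
Proof.
move=> dF; apply: row_differentiable => i.
case: (unliftP j i) => [k|] ei.
  rewrite (_ : (fun y => _) = (fun y : 'rV[CF]_p => y 0 k)); last first.
    by apply/funext => z; rewrite mxE ei liftK.
  exact: differentiable_coord.
rewrite (_ : (fun y => _) = F) //; apply/funext => z.
by rewrite mxE ei unlift_none.
Qed.

Lemma drop_differentiable x : differentiable drop_coord x.
Proof.
apply: row_differentiable => k.
rewrite (_ : (fun y => _) = (fun y : V => y 0 (lift j k))); last first.
  by apply/funext => z; rewrite mxE.
exact: differentiable_coord.
Qed.

Lemma slope_insert_differentiable (f : mpoly.mpoly p.+1 CF) y :
  differentiable (fun y => mpeval f (insert y 0)) y.
Proof.
apply: (@differentiable_comp CF _ _ _ (fun y => insert y 0) (mpeval f)).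
  by apply: insert_differentiable; exact: differentiable_cst.
exact: mpeval_differentiable.
Qed.

Lemma chart_sec_differentiable y : mpeval A (insert y 0) != 0 -> differentiable chart_sec y.
Proof.
move=> Ay; apply: insert_differentiable; apply: differentiableM.
  apply: differentiableB; first exact: differentiable_cst.
  exact: slope_insert_differentiable.
by apply: differentiableV => //; exact: slope_insert_differentiable.
Qed.

Lemma neq0_open (n : nat) (F : 'rV[CF]_n -> C) :
  (forall x, differentiable F x) -> open [set x | F x != 0].
Proof.
move=> dF; rewrite openE => x /= Fx; apply/nbhsVP.
have Fx' : 0 < cmod (F x) by rewrite cmod_gt0.
have /continuousVP/(_ _ Fx')[r [r0 hr]] := differentiable_continuous (dF x).
exists r; split=> // y /hr; apply: contraTneq => /= ->.
by rewrite sub0r cmodN ltxx.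
Qed.

(** By [slope_insert] the slope does not see the inserted coordinate, so the image of the chart can
    be described by inserting 0. *)
Definition chart_dom : opens Y :=
  Opens (neq0_open (slope_insert_differentiable A)).

Definition slope_open : opens V := Opens (neq0_open (mpeval_differentiable A)).

Definition chart_nbhs : opens X :=
  opens_pre (@set_val_continuous _ (closed_points I)) slope_open.

Local Notation XU := (open_subspace chart_nbhs).
Local Notation YD := (open_subspace chart_dom).

Definition xval (x : XU) : V := set_val (set_val x).

Lemma xval_h (x : XU) : mpeval h (xval x) = 1.
Proof. exact: (point_hE hIE). Qed.

Lemma xval_slope (x : XU) : mpeval A (xval x) != 0.
Proof. exact: (set_valP x). Qed.

Lemma chart_dom_drop (x : XU) : oset chart_dom (drop_coord (xval x)).
Proof. by rewrite /= slope_drop; exact: xval_slope. Qed.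

Definition chart (x : XU) : YD := exist _ (drop_coord (xval x)) (mem_set (chart_dom_drop x)).

Lemma sec_point (y : YD) : closed_points I (chart_sec (set_val y)).
Proof. by apply/(closed_pointsE hIE); apply: chart_secE; exact: (set_valP y). Qed.

Definition sec_pt (y : YD) : X := exist _ (chart_sec (set_val y)) (mem_set (sec_point y)).

Lemma sec_pt_nbhs (y : YD) : oset chart_nbhs (sec_pt y).
Proof. by rewrite /= /chart_sec slope_insert; exact: (set_valP y). Qed.

Definition chart_inv (y : YD) : XU := exist _ (sec_pt y) (mem_set (sec_pt_nbhs y)).

Lemma chartK : cancel chart chart_inv.
Proof.
move=> x; do 2!apply: val_inj => /=.
by apply: chart_sec_drop; [exact: xval_h|exact: xval_slope].
Qed.

Lemma chart_invK : cancel chart_inv chart.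
Proof. by move=> y; apply: val_inj => /=; exact: drop_insert. Qed.

Lemma chart_continuous : continuous chart.
Proof.
apply: continuous_set_type => x /=.
have c1 : {for x, continuous xval}.
  apply: (@continuous_comp _ _ _ (set_val : XU -> X) (set_val : X -> V));
    exact: set_val_continuous.
have c2 := differentiable_continuous (drop_differentiable (xval x)).
exact: (continuous_comp c1 c2).
Qed.

Lemma chart_inv_continuous : continuous chart_inv.
Proof.
apply: continuous_set_type; apply: continuous_set_type => y /=.
apply: (@continuous_comp _ _ _ (set_val : YD -> 'rV[CF]_p) chart_sec).
  exact: set_val_continuous.
apply: differentiable_continuous; apply: chart_sec_differentiable; exact: (set_valP y).
Qed.

End Chart.

(** * The chart as an isomorphism of superspaces *)

Section ChartIso.
Variables (R : realType) (p b : nat).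
Local Notation CF := (complex_complex__canonical__Num_NumField R).
Local Notation C := (Num.NumField.sort CF).
Local Notation V := 'rV[CF]_p.+1.
Local Notation S := (poly_superalgebra CF p.+1 b).
Variables (h : mpoly.mpoly p.+1 CF) (I : set S) (hI : homogeneous I).
Hypothesis hIE : forall f : S, I f <->
  forall T x, mpeval h x = 1 -> mpeval (pcoef f T) x = 0.
Hypothesis hslope : forall w : V, mpeval h w = 1 ->
  exists (j : 'I_p.+1) (A : mpoly.mpoly p.+1 CF), mpeval A w != 0 /\
    forall (x : V) (t : C), mpeval h (x + t *: delta_mx 0 j) = mpeval h x + t * mpeval A x.
Variables (j : 'I_p.+1) (A : mpoly.mpoly p.+1 CF).
Hypothesis hA : forall (x : V) (t : C),
  mpeval h (x + t *: delta_mx 0 j) = mpeval h x + t * mpeval A x.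

Local Notation J := (analytic_ideal hI).
Local Notation X := (analytic_space hI).
Local Notation Q := (rsheaf X).
Local Notation Y := (affine_superspace CF p b).
Local Notation nbhsX := (chart_nbhs hI A).
Local Notation domY := (@chart_dom R p b j A).
Local Notation XU := (open_subspace nbhsX).
Local Notation YD := (open_subspace domY).
Local Notation crt := (@chart R p b h I hI j A hA : XU -> YD).
Local Notation ccont := (@chart_continuous R p b h I hI j A hA : continuous crt).

Lemma drop_continuous : continuous (@drop_coord R p j).
Proof. by move=> x; apply: differentiable_continuous; exact: drop_differentiable. Qed.

Definition pull_dom (U1 : opens 'rV[CF]_p) : opens V := opens_pre drop_continuous U1.

Lemma pull_differentiable (U1 : opens 'rV[CF]_p) (f : hol U1) x :
  oset (pull_dom U1) x -> differentiable (fun x => hev f (drop_coord j x)) x.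
Proof.
move=> Ux; apply: (@differentiable_comp CF _ _ _ (@drop_coord R p j) (hev f)).
  exact: drop_differentiable.
exact: hev_differentiable.
Qed.

Definition hol_pull (U1 : opens 'rV[CF]_p) (f : hol U1) : hol (pull_dom U1) :=
  mkhol (fun x => @pull_differentiable U1 f x).

Lemma hev_pull (U1 : opens 'rV[CF]_p) (f : hol U1) x : oset (pull_dom U1) x ->
  hev (hol_pull f) x = hev f (drop_coord j x).
Proof. exact: hev_mkhol. Qed.

Lemma hol_pull_is_zmod_morphism (U1 : opens 'rV[CF]_p) : zmod_morphism (@hol_pull U1).
Proof.
move=> f g; apply: hev_ext => x Ux.
by rewrite hevD hevN !hev_pull // hevD hevN.
Qed.

Lemma hol_pull_is_monoid_morphism (U1 : opens 'rV[CF]_p) : monoid_morphism (@hol_pull U1).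
Proof.
split=> [|f g]; apply: hev_ext => x Ux; first by rewrite hev_pull // !hev1.
by rewrite hevM !hev_pull // hevM.
Qed.

Definition hol_pull_rmorphism (U1 : opens 'rV[CF]_p) : {rmorphism hol U1 -> hol (pull_dom U1)} :=
  HB.pack (@hol_pull U1)
    (GRing.isZmodMorphism.Build _ _ (@hol_pull U1) (@hol_pull_is_zmod_morphism U1))
    (GRing.isMonoidMorphism.Build _ _ (@hol_pull U1) (@hol_pull_is_monoid_morphism U1)).

Lemma hol_pull_scal (U1 : opens 'rV[CF]_p) c :
  hol_pull_rmorphism U1 (cscal (hol_calg U1) c) = cscal (hol_calg (pull_dom U1)) c.
Proof.
by apply: hev_ext => x Ux; rewrite /= hev_pull //.
Qed.

Definition hol_pull_cmor (U1 : opens 'rV[CF]_p) : cmor (hol_calg U1) (hol_calg (pull_dom U1)) :=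
  @CMor _ (hol_calg U1) (hol_calg (pull_dom U1)) (hol_pull_rmorphism U1) (@hol_pull_scal U1).

Definition spull (U1 : opens 'rV[CF]_p) : smor (hol_sections b U1) (hol_sections b (pull_dom U1)) :=
  grassmann_map b (hol_pull_cmor U1).

Lemma scoef_spull U1 (s : hol_sections b U1) T x : oset (pull_dom U1) x ->
  hev (scoef (spull U1 s) T) x = hev (scoef s T) (drop_coord j x).
Proof. by move=> Ux; rewrite /scoef ffunE; exact: hev_pull. Qed.

Definition img_dom (U : opens YD) : opens 'rV[CF]_p := @opens_img CF Y domY U.
Definition img_nbhs (U : opens YD) : opens X := opens_img (opens_pre ccont U).

Lemma img_nbhs_pull U (w : X) : oset (img_nbhs U) w -> oset (pull_dom (img_dom U)) (set_val w).
Proof. by move=> [x Ux <-]; exists (crt x). Qed.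

(** The slope depends only on the remaining coordinates, so a point of the hypersurface over the
    image of the chart lies in its domain. *)
Lemma pull_img_nbhs U (w : X) : oset (pull_dom (img_dom U)) (set_val w) -> oset (img_nbhs U) w.
Proof.
move=> [y Uy ey].
have Aw : oset nbhsX w.
  have Ay : mpeval A (insert j (set_val y) 0) != 0 by exact: (set_valP y).
  by rewrite /= -(slope_drop hA); move: Ay; rewrite ey.
exists (exist _ w (mem_set Aw)) => //=.
rewrite (_ : crt _ = y) //; exact/val_inj/esym.
Qed.

Lemma img_dom_sec U y : oset (img_dom U) y -> exists w : X,
  [/\ oset (img_nbhs U) w, set_val w = chart_sec h j A y & drop_coord j (set_val w) = y].
Proof.
move=> [y' Uy' <-]; exists (sec_pt hI hIE hA y'); split=> //=; last exact: drop_insert.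
by apply: pull_img_nbhs; exists y' => //=; rewrite drop_insert.
Qed.

(* theta is the pullback along the chart; its inverse evaluates a section along
   chart_sec. *)
Section Theta.
Variable U : opens YD.

Definition theta_val (s : hol_sections b (img_dom U)) (w : X) (Ww : oset (img_nbhs U) w) :
    germ J (set_val w) := germ_of J (img_nbhs_pull Ww) (spull (img_dom U) s).

Lemma theta_loc s (v : X) : oset (img_nbhs U) v ->
  exists (B : opens V) (f : hol_sheaf CF p.+1 b B), oset B (set_val v) /\
    forall (w : X) (Ww : oset (img_nbhs U) w) (Bw : oset B (set_val w)),
      theta_val s Ww = germ_of J Bw f.
Proof.
move=> Wv; exists (pull_dom (img_dom U)), (spull (img_dom U) s); split.
  exact: img_nbhs_pull.
move=> w Ww Bw; exact: germ_of_irr.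
Qed.

Definition theta (s : hol_sections b (img_dom U)) : quot_section_sa J (img_nbhs U) :=
  QuotSection (theta_loc s).

Lemma theta_is_zmod_morphism : zmod_morphism theta.
Proof.
by move=> s t; apply: quot_section_ext => w Ww; rewrite /= /theta_val rmorphB germ_ofB.
Qed.

Lemma theta_is_monoid_morphism : monoid_morphism theta.
Proof.
split=> [|s t]; apply: quot_section_ext => w Ww; rewrite /= /theta_val.
  by rewrite rmorph1 germ_of1.
by rewrite rmorphM germ_ofM.
Qed.

Definition theta_rmorphism :
    {rmorphism hol_sections b (img_dom U) -> quot_section_sa J (img_nbhs U)} :=
  HB.pack theta
    (GRing.isZmodMorphism.Build _ _ theta theta_is_zmod_morphism)
    (GRing.isMonoidMorphism.Build _ _ theta theta_is_monoid_morphism).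

Lemma theta_scal c : theta_rmorphism (sscal (hol_sections b (img_dom U)) c) =
  sscal (quot_section_sa J (img_nbhs U)) c.
Proof.
apply: quot_section_ext => w Ww; rewrite /= /theta_val.
by rewrite (smor_scal (spull (img_dom U))) germ_of_scal.
Qed.

Lemma theta_part q s : spart (hol_sections b (img_dom U)) q s ->
  spart (quot_section_sa J (img_nbhs U)) q (theta_rmorphism s).
Proof.
move=> qs w Ww; exists (pull_dom (img_dom U)), (img_nbhs_pull Ww), (spull (img_dom U) s).
by split=> //; exact: smor_part.
Qed.

Definition theta_smor : smor (hol_sections b (img_dom U)) (quot_section_sa J (img_nbhs U)) :=
  SMor theta_scal theta_part.

Lemma theta_inj : injective theta.
Proof.
move=> s t e; apply/ffunP => T; apply: hev_ext => y Uy.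
have [w [Ww _ wy]] := img_dom_sec Uy.
have := congr1 (fun q : quot_section J (img_nbhs U) => gval (qval q Ww) T) e.
rewrite /= /theta_val !(gval_germ_of hI hIE) ?(point_hE hIE) //.
by rewrite !scoef_spull ?wy //; exact: img_nbhs_pull.
Qed.

(** The preimage has as coefficients the values of [s] at the points above [y]. They are holomorphic
    since [s] is locally induced by some [f], whose coefficients are composed with [chart_sec];
    equality of germs then follows from equality of values. *)
Lemma theta_surj (s : quot_section J (img_nbhs U)) : exists t, theta t = s.
Proof.
pose F T (y : 'rV[CF]_p) : C := if pselect (oset (img_dom U) y) is left Uy then
  gval (qval s (let: And3 Ww _ _ := svalP (cid (img_dom_sec Uy)) in Ww)) T else 0.
(* The point chosen above [y] is unique: it has to be [chart_sec] of [y]. *)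
have FE T (w : X) (Ww : oset (img_nbhs U) w) : F T (drop_coord j (set_val w)) = gval (qval s Ww) T.
  rewrite /F; case: pselect => [Uy|]; last by case; exact: img_nbhs_pull.
  set Ww' := (let: And3 _ _ _ := _ in _); move: Ww'.
  case: (cid _) => w' /= [? e _] Ww'.
  have ew : w' = w.
    suff e2 : set_val w' = set_val w by exact: val_inj e2.
    rewrite e; apply: (chart_sec_drop hA); first exact: (point_hE hIE).
    by case: Ww => x _ <-; exact: (xval_slope x).
  by subst w'; congr (gval (qval s _) T); exact: Prop_irrelevance.
have dF T y : oset (img_dom U) y -> differentiable (F T) y.
  move=> Uy; have [w [Ww wsec wy]] := img_dom_sec Uy.
  have [B [f [Bw hf]]] := qval_loc s Ww.
  have Ay : mpeval A (insert j y 0) != 0 by case: Uy => y' _ <-; exact: (set_valP y').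
  have dsec := @chart_sec_differentiable R p h j A y Ay.
  have [r1 [r10 hr1]] := opens_ballP Uy.
  have [r2 [r20 hr2]] : exists r : R, 0 < r /\ forall y', vmod (y' - y) < r ->
      oset B (chart_sec h j A y').
    have csec : {for y, continuous (chart_sec h j A)} := differentiable_continuous dsec.
    have : nbhs (chart_sec h j A y) (oset B).
      by apply: open_nbhs_nbhs; split; [exact: oopen|rewrite -wsec].
    by move=> /csec/nbhsVP[r hr]; exists r.
  apply: (@differentiable_near_eq R _ (fun y => hev (scoef f T) (chart_sec h j A y)) _ y (Num.min r1 r2)).
  - by rewrite lt_min r10.
  - move=> y'; rewrite lt_min => /andP[/hr1 Uy' /hr2 By'].
    have [w' [Ww' w'sec w'y]] := img_dom_sec Uy'.
    have Bw' : oset B (set_val w') by rewrite w'sec.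
    rewrite -[in RHS]w'y (FE T w' Ww') (hf w' Ww' Bw').
    by rewrite (gval_germ_of hI hIE) ?(point_hE hIE) // w'sec.
  - apply: (@differentiable_comp CF _ _ _ (chart_sec h j A) (hev (scoef f T))) => //.
    by apply: hev_differentiable; rewrite -wsec.
pose t : hol_sections b (img_dom U) :=
  [ffun T : {set 'I_b} => mkhol (dF T)] : grassmann b (hol_calg (img_dom U)).
exists t; apply: quot_section_ext => w Ww; rewrite /= /theta_val.
have [B [f [Bw hf]]] := qval_loc s Ww.
rewrite (hf w Ww Bw); apply: (@germ_of_eq R p.+1 b h I hI hIE hslope (pull_dom (img_dom U)) B
  (set_val w) (img_nbhs_pull Ww) Bw (spull (img_dom U) t) f); first exact: (point_hE hIE).
move=> T y Uy By hy; rewrite scoef_spull // /scoef ffunE hev_mkhol //.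
have yV : closed_points I y by apply/(closed_pointsE hIE).
pose w' : X := exist _ y (mem_set yV).
have Ww' : oset (img_nbhs U) w' by exact: pull_img_nbhs.
rewrite (FE T w' Ww') (hf w' Ww' By).
by rewrite (gval_germ_of hI hIE).
Qed.

Lemma theta_bijective : bijective theta.
Proof.
exists (fun s => sval (cid (theta_surj s))) => [t|s].
  by apply: theta_inj; exact: (svalP (cid (theta_surj (theta t)))).
exact: (svalP (cid (theta_surj s))).
Qed.

End Theta.

Lemma theta_res (U U' : opens YD) (k : U' <=o U)
    (k' : opens_pre ccont U' <=o opens_pre ccont U) (s : hol_sections b (img_dom U)) :
  pres (rsheaf XU) k' (theta s : rsheaf XU (opens_pre ccont U)) =
  theta (pres (rsheaf YD) k (s : rsheaf YD U)).
Proof.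
apply: quot_section_ext => w Ww; rewrite /= /theta_val.
apply: (@germ_of_eq R p.+1 b h I hI hIE hslope (pull_dom (img_dom U)) (pull_dom (img_dom U'))
  (set_val w) _ _ (spull (img_dom U) s)
  (spull (img_dom U') (pres (hol_sheaf CF p b) (@sub_img _ Y domY U U' k) s))).
  exact: (point_hE hIE).
move=> T y Uy U'y hy; rewrite !scoef_spull // /scoef ffunE.
by rewrite hev_res.
Qed.

Lemma chart_space_iso : space_iso XU YD.
Proof.
exists crt, ccont, (chart_inv hI hIE hA); split.
- exact: chart_inv_continuous.
- exact: chartK.
- exact: chart_invK.
exists theta_smor; split; first exact: theta_bijective.
exact: theta_res.
Qed.

End ChartIso.

Theorem analytic_complex_supermanifold (R : realType) (a b : nat)
    (h : mpoly.mpoly a (complex_complex__canonical__Num_NumField R))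
    (I : set (poly_superalgebra (complex_complex__canonical__Num_NumField R) a b))
    (hI : homogeneous I) :
  (forall f, I f <-> forall T x, mpeval h x = 1 -> mpeval (pcoef f T) x = 0) ->
  (forall w, mpeval h w = 1 -> exists (j : 'I_a) (A : mpoly.mpoly a _),
     mpeval A w != 0 /\
     forall x t, mpeval h (x + t *: delta_mx 0 j) = mpeval h x + t * mpeval A x) ->
  complex_supermanifold (analytic_space hI).
Proof.
move=> hIE hslope; split; first by apply: (@analytic_is_superspace R a b h I hI).
case: a => [|p] in h I hI hIE hslope *.
  (* Without coordinates [hslope] would produce an element of ['I_0] at any point, so the space is
     empty. *)
  exists 0%N, 0%N => x.
  by have [[]] := hslope _ (point_hE hIE x).
exists p, b => x; have [j [A [Ax hA]]] := hslope _ (point_hE hIE x).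
exists (chart_nbhs hI A), (@chart_dom R p b j A); split; first exact: Ax.
exact: (@chart_space_iso R p b h I hI hIE hslope j A hA).
Qed.

(** * The universal property of the coordinate superalgebra *)

Section PolynomialIdentity.
Variable K : numFieldType.

Definition extend_point (n : nat) (y : 'I_n -> K) (t : K) (i : 'I_n.+1) : K :=
  oapp y t (insub (val i)).

Lemma extend_point_widen n (y : 'I_n -> K) t (i : 'I_n) :
  extend_point y t (widen_ord (leqnSn n) i) = y i.
Proof. by rewrite /extend_point /= (valK i). Qed.

Lemma extend_point_max n (y : 'I_n -> K) t : extend_point y t ord_max = t.
Proof. by rewrite /extend_point insubF //= ltnn. Qed.

Lemma poly_eq0_of_values (q : {poly K}) : (forall t, q.[t] = 0) -> q = 0.
Proof.
move=> q0; apply/eqP; apply: contraT => qn0.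
have := @max_poly_roots K q [seq i%:R | i <- iota 0 (size q)] qn0.
have -> : all (root q) [seq i%:R | i <- iota 0 (size q)].
  by apply/allP => x _; apply/rootP; exact: q0.
rewrite size_map size_iota ltnn => -> //.
by rewrite map_inj_uniq ?iota_uniq // => i j /eqP; rewrite eqr_nat => /eqP.
Qed.

(** Induction on n: for fixed values of the first n variables, q is a polynomial in the last one
    with infinitely many roots, so the coefficients [qk k] vanish at all points. *)
Lemma mpoly_eq0_of_values n (q : mpoly.mpoly n K) :
  (forall y, mpoly.meval y q = 0) -> q = 0.
Proof.
elim: n q => [|n IH] q q0.
  have qC : q = mpoly.mpolyC 0 (mpoly.mcoeff (@mpoly.mnm0 0) q).
    apply/mpoly.mpolyP => m; have -> : m = @mpoly.mnm0 0 by apply/mpoly.mnmP => -[].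
    by rewrite mpoly.mcoeffC eqxx mulr1.
  by have := q0 (fun=> 0); rewrite qC mpoly.mevalC => ->; rewrite rmorph0.
pose trunc (m : mpoly.multinom n.+1) : mpoly.multinom n :=
  mpoly.Multinom [tuple mpoly.fun_of_multinom m (widen_ord (leqnSn n) i) | i < n].
have truncE m i : mpoly.fun_of_multinom (trunc m) i = mpoly.fun_of_multinom m (widen_ord (leqnSn n) i).
  by rewrite mpoly.multinomE tnth_mktuple.
pose qk k : mpoly.mpoly n K := \sum_(m <- mpoly.msupp q | mpoly.fun_of_multinom m ord_max == k)
  mpoly.mcoeff m q *: mpoly.mpolyX K (trunc m).
have qk0 k : qk k = 0.
  apply: IH => y.
  pose r : {poly K} := \sum_(m <- mpoly.msupp q)
    (mpoly.mcoeff m q * \prod_(i < n) y i ^+ mpoly.fun_of_multinom (trunc m) i) *: 'X^(mpoly.fun_of_multinom m ord_max).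
  have r0 : r = 0.
    apply: poly_eq0_of_values => t; rewrite -(q0 (extend_point y t)) mpoly.mevalE /r.
    rewrite horner_sum; apply: eq_bigr => m _.
    rewrite hornerZ hornerXn big_ord_recr /= extend_point_max -mulrA; congr (_ * (_ * _)).
    by apply: eq_bigr => i _; rewrite extend_point_widen truncE.
  have := congr1 (fun p : {poly K} => p`_k) r0; rewrite coef0 => <-.
  rewrite /r coef_sum /qk raddf_sum /= big_mkcond; apply: eq_bigr => m _.
  rewrite coefZ coefXn eq_sym; case: eqP => _; last by rewrite mulr0.
  by rewrite mulr1 mpoly.mevalZ mpoly.mevalX.
apply/mpoly.mpolyP => m; rewrite mpoly.mcoeff0.
have [ms|/mpoly.memN_msupp_eq0 //] := boolP (m \in mpoly.msupp q).
have := congr1 (mpoly.mcoeff (trunc m)) (qk0 (mpoly.fun_of_multinom m ord_max)).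
rewrite mpoly.mcoeff0 /qk raddf_sum /= big_mkcond (bigD1_seq m) ?mpoly.msupp_uniq //= eqxx.
rewrite mpoly.mcoeffZ mpoly.mcoeffX eqxx mulr1 big1 ?addr0 // => m2 m2m.
case: eqP => // em; rewrite mpoly.mcoeffZ mpoly.mcoeffX; case: eqP => [et|]; last by rewrite mulr0.
case/eqP: m2m; apply/mpoly.mnmP => i.
have [->//|[k ->]] : i = ord_max \/ exists k, i = widen_ord (leqnSn n) k.
  have [ilt|ige] := ltnP i n; [right; exists (Ordinal ilt)|left]; apply: val_inj => //=.
  by apply/eqP; rewrite eqn_leq ige andbT -ltnS ltn_ord.
by rewrite -!truncE et.
Qed.

End PolynomialIdentity.

Section PolynomialMorphisms.
Variables (K : numFieldType) (n : nat).
Local Notation P := (mpoly.mpoly n K).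
Local Notation X i := (mpoly.mpolyX K (mpoly.mnm1 i) : P).

Lemma mpoly_morphism_ext (A : pzRingType) (f g : {rmorphism P -> A}) :
  (forall c, f (mpoly.mpolyC n c) = g (mpoly.mpolyC n c)) ->
  (forall i, f (X i) = g (X i)) -> f =1 g.
Proof.
move=> fgC fgX p; rewrite (mpoly.mpolyE p) !rmorph_sum; apply: eq_bigr => m _.
rewrite -mpoly.mul_mpolyC !rmorphM fgC; congr (_ * _).
rewrite mpoly.mpolyXE_id !rmorph_prod; apply: eq_bigr => i _.
by rewrite !rmorphXn fgX.
Qed.

Lemma mpoly_morphism_nz (E : comNzRingType) (s : {rmorphism K -> E}) (x : 'I_n -> E) :
  exists f : {rmorphism P -> E},
    (forall c, f (mpoly.mpolyC n c) = s c) /\ forall i, f (X i) = x i.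
Proof.
exists (mpoly.mmap s x); split => [c|i]; first exact: mpoly.mmapC.
by rewrite /= mpoly.mmapX mpoly.mmap1U.
Qed.

(** The zero ring is a legitimate superalgebra and is treated apart from the nonzero rings in which
    [mmap] evaluates. *)
Lemma mpoly_morphism_exists (E : comPzRingType) (s : {rmorphism K -> E}) (x : 'I_n -> E) :
  exists f : {rmorphism P -> E},
    (forall c, f (mpoly.mpolyC n c) = s c) /\ forall i, f (X i) = x i.
Proof.
have [e10|e10] := eqVneq (1 : E) 0.
  have triv (y z : E) : y = z by rewrite -[y]mulr1 -[z]mulr1 e10 !mulr0.
  have za : zmod_morphism (fun _ : P => 0 : E) by move=> y z; exact: triv.
  have zm : monoid_morphism (fun _ : P => 0 : E) by split=> [|y z]; exact: triv.
  pose f0 : {rmorphism P -> E} := HB.pack (fun _ : P => 0 : E)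
    (GRing.isZmodMorphism.Build P E (fun _ : P => 0 : E) za)
    (GRing.isMonoidMorphism.Build P E (fun _ : P => 0 : E) zm).
  by exists f0; split=> [c|i]; exact: triv.
pose E' : comNzRingType := HB.pack (GRing.ComPzRing.sort E)
  (GRing.PzSemiRing_isNonZero.Build (GRing.ComPzRing.sort E) e10).
exact: (@mpoly_morphism_nz E' s x).
Qed.

Variables (h : P) (J : pred 'I_n).
Hypothesis hJ : forall (x : 'rV[K]_n) (u : K),
  mpeval h (\row_i (if J i then u * x 0 i else x 0 i)) = u * mpeval h x.

(* Scaling the coordinates in J by 1 / h x retracts the open set h <> 0 onto the
   hypersurface h = 1; clearing denominators in the composite with f gives a
   polynomial that vanishes identically, and agrees with f wherever h = 1. *)
Lemma morphism_vanish (E : comPzRingType) (f : {rmorphism P -> E}) (q : P) :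
  (forall x, mpeval h x = 1 -> mpeval q x = 0) -> f h = 1 -> f q = 0.
Proof.
move=> q0 fh1; pose deg m := (\sum_(i < n | J i) mpoly.fun_of_multinom m i)%N.
pose N := (\max_(m <- mpoly.msupp q) deg m)%N.
(* [q] homogenised by powers of [h], with respect to the degree in the coordinates of [J]: at [y]
   its value is h(y)^N q(x'), with x' the rescaled point. Since [f h = 1], it has the same image as
   [q]. *)
pose H : P := \sum_(m <- mpoly.msupp q)
  mpoly.mpolyC n (mpoly.mcoeff m q) * (h ^+ (N - deg m) * mpoly.mpolyX K m).
have fH : f H = f q.
  rewrite [in RHS](mpoly.mpolyE q) !rmorph_sum; apply: eq_bigr => m _.
  by rewrite -mpoly.mul_mpolyC !rmorphM rmorphXn fh1 expr1n mul1r.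
(* The extra factor [h] settles the points where [h] vanishes and no rescaling exists. *)
suff Hh : H * h = 0 by rewrite -fH -[f H]mulr1 -fh1 -rmorphM Hh rmorph0.
apply: mpoly_eq0_of_values => y; rewrite mpoly.mevalM.
pose x : 'rV[K]_n := \row_i y i.
have hE (p : P) : mpoly.meval y p = mpeval p x.
  by apply: mpoly.meval_eq => i; rewrite mxE.
rewrite (hE h); have [->|hx] := eqVneq (mpeval h x) 0; first by rewrite mulr0.
pose u := (mpeval h x)^-1; pose x' : 'rV[K]_n := \row_i (if J i then u * x 0 i else x 0 i).
have hx' : mpeval h x' = 1 by rewrite hJ mulVf.
suff -> : mpoly.meval y H = mpeval h x ^+ N * mpeval q x' by rewrite q0 // mulr0 mul0r.
rewrite /H rmorph_sum [mpeval q x']mpoly.mevalE mulr_sumr.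
rewrite big_seq_cond [RHS]big_seq_cond; apply: eq_bigr => m /andP[ms _].
rewrite -[LHS]/(mpoly.meval y (mpoly.mpolyC n (mpoly.mcoeff m q) *
  (h ^+ (N - deg m) * mpoly.mpolyX K m))).
have hX k : mpoly.meval y (h ^+ k) = mpeval h x ^+ k by rewrite -hE; exact: rmorphXn.
rewrite !mpoly.mevalM mpoly.mevalC hX mpoly.mevalX [RHS]mulrCA; congr (_ * _).
have dN : (deg m <= N)%N by rewrite /N; apply: leq_bigmax_seq.
rewrite (_ : \prod_(i < n) x' 0 i ^+ _ = u ^+ deg m * \prod_i y i ^+ mpoly.fun_of_multinom m i).
  have eN : mpeval h x ^+ N = mpeval h x ^+ (N - deg m) * mpeval h x ^+ deg m.
    by rewrite -exprD subnK.
  by rewrite eN -mulrA (mulrA (_ ^+ deg m)) -exprMn mulfV // expr1n mul1r.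
rewrite /deg -prodrXr [in RHS]big_mkcond -big_split /=; apply: eq_bigr => i _.
by rewrite !mxE; case: ifP => _; rewrite ?exprMn ?mul1r.
Qed.

End PolynomialMorphisms.

Section GrassmannMonomials.
Variables (b : nat) (R : comPzRingType).
Local Notation G := (grassmann b R).
Implicit Types (c d : R) (S T U : {set 'I_b}) (f g : G).

Definition gmono c S : G := [ffun T : {set 'I_b} => if T == S then c else 0].

Definition gxi (i : 'I_b) : G := gmono 1 [set i]%SET.

Lemma gmono0 S : gmono 0 S = 0.
Proof. by apply/ffunP => T; rewrite gzeroE ffunE; case: ifP. Qed.

Lemma gmonoE f : f = \sum_S gmono (f S) S.
Proof.
apply/ffunP => T; rewrite (big_morph (fun g : G => g T) (fun f g => gaddE f g T) (gzeroE R T)).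
rewrite (bigD1 T) //= ffunE eqxx big1 ?addr0 // => S ST.
by rewrite ffunE eq_sym (negPf ST).
Qed.

Lemma gmonoM c d T U : fintype.disjoint (mem T) (mem U) ->
  gmono c T * gmono d U = gmono ((-1) ^+ ninv T U * c * d) (T :|: U)%SET.
Proof.
move=> dTU; apply/ffunP => S; rewrite gmE gmulE ffunE.
have [->|SnTU] := eqVneq S (T :|: U)%SET.
  rewrite (bigD1 T) ?finset.subsetUl //= big1 ?addr0 => [|T' /andP[_ /negPf T'T]]; last first.
    by rewrite [gmono c T T']ffunE T'T mulr0 mul0r.
  have -> : ((T :|: U) :\: T = U)%SET.
    by rewrite finset.setDUl finset.setDv finset.set0U; apply/finset.setDidPl; rewrite disjoint_sym.
  by rewrite !ffunE !eqxx.
rewrite big1 // => T' T'S; rewrite [gmono c T T']ffunE [gmono d U _]ffunE.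
case: eqP => [eT|_]; last by rewrite mulr0 mul0r.
case: eqP => [eU|_]; last by rewrite mulr0.
case/eqP: SnTU; rewrite -eU -eT finset.setDE finset.setUIr finset.setUCr finset.setIT.
by apply/esym/finset.setUidPr.
Qed.

Lemma gconst_gmono c d S : gconst b c * gmono d S = gmono (c * d) S.
Proof.
by apply/ffunP => T; rewrite gconst_mulE !ffunE; case: ifP => // _; rewrite mulr0.
Qed.

Lemma gpart_gmono c S : gpart (odd #|S|) (gmono c S).
Proof. by move=> T oT; rewrite ffunE; case: eqP => // e; rewrite e eqxx in oT. Qed.

Lemma gpart_gxi i : gpart true (gxi i).
Proof. by have := @gpart_gmono 1 [set i]%SET; rewrite cards1. Qed.

Lemma gmono_factor c S i : i \in S ->
  gmono c S = gmono ((-1) ^+ ninv (S :\ i)%SET [set i]%SET * c) (S :\ i)%SET * gxi i.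
Proof.
move=> iS; rewrite /gxi gmonoM; last by rewrite disjoint_sym finset.disjoints1 !inE eqxx.
by rewrite mulr1 mulrA -exprD addnn -mul2n exprM sqrrN !expr1n mul1r finset.setUC finset.setD1K.
Qed.

(** Each nonempty S is charged to the one index returned by [[pick k in S]]; this makes [gquoE] a
    decomposition without repetition. *)
Definition gquo (i : 'I_b) f : G :=
  \sum_(S : {set 'I_b} | [pick k in S] == Some i)
    gmono ((-1) ^+ ninv (S :\ i)%SET [set i]%SET * f S) (S :\ i)%SET.

Lemma gquoE f : gbody f = 0 -> f = \sum_i gquo i f * gxi i.
Proof.
move=> f0; rewrite [LHS]gmonoE.
rewrite (eq_bigr (fun i => \sum_(S : {set 'I_b} | [pick k in S] == Some i) gmono (f S) S)); last first.
  move=> i _; rewrite /gquo mulr_suml; apply: eq_bigr => S.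
  by case: pickP => // k kS /eqP [<-]; rewrite -gmono_factor.
rewrite (exchange_big_dep xpredT) //=; apply: eq_bigr => S _.
case: pickP => [k kS|S0]; first by rewrite (big_pred1 k) // => i; rewrite (inj_eq (@Some_inj _)) eq_sym.
rewrite big_pred0 // (_ : S = finset.set0); last by apply/finset.setP => k; rewrite inE; exact: S0.
by rewrite -[f _]/(gbody f) f0 gmono0.
Qed.

Lemma gpart0 q : gpart q (0 : G).
Proof. by move=> S _; rewrite gzeroE. Qed.

Lemma gpart_sum q (I : Type) (r : seq I) (P : pred I) (F : I -> G) :
  (forall i, P i -> gpart q (F i)) -> gpart q (\sum_(i <- r | P i) F i).
Proof.
move=> h; elim/big_ind: _ => //; first exact: gpart0.
by move=> x y hx hy S qS; rewrite gaddE hx ?hy ?addr0.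
Qed.

Lemma gquo_even i f : gpart true f -> gpart false (gquo i f).
Proof.
move=> f1; apply: gpart_sum => S /eqP Si.
have iS : i \in S by move: Si; case: pickP => // k kS [<-].
have [oS|eS] := boolP (odd #|S|).
  have -> : false = odd #|(S :\ i)%SET|; last exact: gpart_gmono.
  by move: oS; rewrite (cardsD1 i S) iS add1n /=; case: (odd _).
by rewrite f1 ?mulr0 ?gmono0; [exact: gpart0|move: eS; case: (odd _)].
Qed.

End GrassmannMonomials.

(** * The coordinate superalgebra of the hypersurface *)

Section HypersurfaceAlgebra.
Variables (K : numFieldType) (n : nat) (h : mpoly.mpoly n K).
Local Notation P := (mpoly.mpoly n K).

Definition hypersurface : set 'rV[K]_n := [set x | mpeval h x = 1].

(** Regular functions are kept as functions instead of classes of polynomials, so relations between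
    them are identities of values; [morphism_vanish] is what allows morphisms out of this ring to be
    defined on coordinates. *)
Definition pfun_pred : {pred hypersurface -> K} :=
  fun u => `[< @regular_function K n hypersurface u >].

Record pfun := PFun { pfval :> hypersurface -> K ; pfvalP : pfval \in pfun_pred }.

Lemma pfun_subring_closed : subring_closed pfun_pred.
Proof.
split.
- by apply/asboolP; exists 1 => z; rewrite [RHS]rmorph1.
- move=> u v /asboolP[f uf] /asboolP[g vg]; apply/asboolP; exists (f - g) => z.
  by rewrite [RHS]rmorphB /= !fctE uf vg.
- move=> u v /asboolP[f uf] /asboolP[g vg]; apply/asboolP; exists (f * g) => z.
  by rewrite [RHS]rmorphM /= !fctE uf vg.
Qed.

HB.instance Definition _ := [isSub for pfval].
HB.instance Definition _ := [Choice of pfun by <:].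
HB.instance Definition _ :=
  GRing.SubChoice_isSubComPzRing.Build _ _ pfun pfun_subring_closed.

Lemma pfun_ext (u v : pfun) : pfval u =1 pfval v -> u = v.
Proof. by move=> uv; apply: val_inj; apply/funext. Qed.

Lemma pfun_of_subproof (f : P) : (fun z : hypersurface => mpeval f (set_val z)) \in pfun_pred.
Proof. by apply/asboolP; exists f. Qed.

Definition pfun_of (f : poly_calg K n) : pfun := PFun (pfun_of_subproof f).

Lemma pfun_of_is_zmod_morphism : zmod_morphism pfun_of.
Proof. by move=> f g; apply: pfun_ext => x; exact: rmorphB. Qed.
Lemma pfun_of_is_monoid_morphism : monoid_morphism pfun_of.
Proof. by split=> [|f g]; apply: pfun_ext => x; [exact: rmorph1|exact: rmorphM]. Qed.
Definition pfun_of_rmorphism : {rmorphism poly_calg K n -> pfun} :=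
  HB.pack pfun_of
    (GRing.isZmodMorphism.Build _ _ pfun_of pfun_of_is_zmod_morphism)
    (GRing.isMonoidMorphism.Build _ _ pfun_of pfun_of_is_monoid_morphism).

Definition pfun_calg : calg K :=
  @CAlg K pfun (pfun_of_rmorphism \o cscal (poly_calg K n)).

Definition pfun_cmor : cmor (poly_calg K n) pfun_calg :=
  @CMor K (poly_calg K n) pfun_calg pfun_of_rmorphism (fun c => erefl).

Lemma pfun_of_surj (u : pfun) : exists f, pfun_of f = u.
Proof.
by have /asboolP[f uf] := pfvalP u; exists f; apply: pfun_ext => z; rewrite uf.
Qed.

Lemma pfun_of_eq0 (f : P) :
  pfun_of f = 0 <-> forall x, mpeval h x = 1 -> mpeval f x = 0.
Proof.
split=> [f0 x hx|f0].
  by have := congr1 (fun u : pfun => pfval u (exist _ x (mem_set hx))) f0.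
by apply: pfun_ext => z; apply: f0; exact: (set_valP z).
Qed.

Variable b : nat.

Definition hyp_sa : superalgebra K := grassmann_sa b pfun_calg.

Definition hyp_pres : smor (poly_superalgebra K n b) hyp_sa := grassmann_map b pfun_cmor.

Lemma hyp_pres_surj y : exists x, hyp_pres x = y.
Proof.
pose F S := sval (cid (pfun_of_surj ((y : grassmann b pfun_calg) S))).
exists ([ffun S : {set 'I_b} => F S] : grassmann b (poly_calg K n)).
apply/ffunP => S; rewrite !ffunE.
exact: (svalP (cid (pfun_of_surj ((y : grassmann b pfun_calg) S)))).
Qed.

Lemma hyp_pres_ker (f : poly_superalgebra K n b) : hyp_pres f = 0 <->
  forall (T : {set 'I_b}) x, mpeval h x = 1 ->
    mpeval ((f : grassmann b (poly_calg K n)) T) x = 0.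
Proof.
split=> [f0 T|f0].
  apply/pfun_of_eq0; have := congr1 (fun g : grassmann b pfun_calg => g T) f0.
  by rewrite gzeroE ffunE.
by apply/ffunP => T; rewrite gzeroE ffunE; apply/pfun_of_eq0; exact: f0.
Qed.

Definition hyp_body (f : hyp_sa) : hypersurface -> K :=
  pfval (gbody (f : grassmann b pfun_calg)).

Lemma hyp_body_is_zmod_morphism : zmod_morphism hyp_body.
Proof. by move=> f g; rewrite /hyp_body /gbody gaddE goppE. Qed.

Lemma hyp_body_is_monoid_morphism : monoid_morphism hyp_body.
Proof.
split=> [|f g]; last by rewrite /hyp_body gbodyM.
by rewrite /hyp_body /gbody [(1 : hyp_sa)]/(gconst b 1) ffunE eqxx.
Qed.

Definition hyp_body_rmorphism : {rmorphism hyp_sa -> (hypersurface -> K)} :=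
  HB.pack hyp_body
    (GRing.isZmodMorphism.Build _ _ hyp_body hyp_body_is_zmod_morphism)
    (GRing.isMonoidMorphism.Build _ _ hyp_body hyp_body_is_monoid_morphism).

Lemma hyp_odd_ideal (x : hyp_sa) :
  odd_ideal x <-> gbody (x : grassmann b pfun_calg) = 0.
Proof.
split=> [ox|x0].
  pose N := [set x : hyp_sa | gbody (x : grassmann b pfun_calg) = 0].
  suff : odd_ideal (A := hyp_sa) `<=` N by apply.
  apply: ideal_gen_min.
    split=> [|f g|c f]; rewrite /N /= ?gbodyM.
    - exact: gzeroE.
    - by rewrite /gbody gaddE => -> ->; rewrite addr0.
    - by move=> ->; rewrite mulr0 mul0r.
  by move=> f /= f1; apply: f1; rewrite finset.cards0.
have OI := ideal_gen_ideal (spart hyp_sa true).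
rewrite [X in odd_ideal X](gquoE x0) /odd_ideal; elim/big_ind: _ => [||i _].
- exact: (Defs.ideal0 OI).
- by move=> f g; exact: (Defs.idealD OI).
- by apply: (Defs.idealMl OI); apply: ideal_gen_sub; exact: gpart_gxi.
Qed.

Lemma hyp_affine_supervariety : affine_supervariety hyp_sa.
Proof.
split.
  exists n, hypersurface, hyp_body_rmorphism; split.
  - exists [set h - 1]; apply/seteqP; split=> x /=.
      by move=> hx f ->; rewrite mpevalB mpeval1 hx subrr.
    by move=> /(_ _ erefl); rewrite mpevalB mpeval1 => /eqP; rewrite subr_eq0 => /eqP.
  - move=> c; apply/funext => z; rewrite /= /hyp_body /gbody ffunE eqxx /=.
    exact: mpoly.mevalC.
  - apply/seteqP; split=> u.
      by move=> [x _ <-]; have /asboolP := pfvalP (gbody (x : grassmann b pfun_calg)).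
    move=> ru; have pu : u \in pfun_pred by apply/asboolP.
    exists (gconst b (PFun pu : pfun_calg)) => //=.
    by rewrite /hyp_body /gbody ffunE eqxx.
  - move=> x; rewrite hyp_odd_ideal; split=> [e|e]; last by rewrite /= /hyp_body e.
    by apply: val_inj.
exists b, (fun i => gxi _ i : hyp_sa); split; first by move=> i; exact: gpart_gxi.
move=> x x1; exists (fun i => gquo i (x : grassmann b pfun_calg)); split.
  by move=> i; exact: gquo_even.
by apply: gquoE; apply: x1; rewrite finset.cards0.
Qed.

End HypersurfaceAlgebra.

Section EvenPart.
Variables (K : numFieldType) (D : superalgebra K).
Implicit Types x y : D.

Definition even_pred : {pred D} := fun x => `[< spart D false x >].

(** The even part as a commutative ring of its own, over which polynomials can be evaluated and the
    usual theory of determinants applies. *)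
Record evenD := EvenD { evenval :> D ; evenvalP : evenval \in even_pred }.

Lemma even_subring_closed : subring_closed even_pred.
Proof.
split.
- by apply/asboolP; exact: spart1.
- by move=> x y /asboolP hx /asboolP hy; apply/asboolP; exact: spartB.
- by move=> x y /asboolP hx /asboolP hy; apply/asboolP; exact: (spartM hx hy).
Qed.

HB.instance Definition _ := [isSub for evenval].
HB.instance Definition _ := [Choice of evenD by <:].
HB.instance Definition _ :=
  GRing.SubChoice_isSubPzRing.Build _ _ evenD even_subring_closed.

Lemma evenvalE (x : evenD) : spart D false (evenval x).
Proof. by have /asboolP := evenvalP x. Qed.

Lemma even_mulC : @commutative evenD evenD *%R.
Proof.
move=> x y; apply: val_inj.
transitivity (evenval x * evenval y); first exact: (rmorphM (val : evenD -> D)).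
rewrite (spartC (evenvalE x) (evenvalE y)) mul1r.
by apply/esym; exact: (rmorphM (val : evenD -> D)).
Qed.

HB.instance Definition _ := GRing.PzRing_hasCommutativeMul.Build evenD even_mulC.

Definition mkeven x (hx : spart D false x) : evenD := EvenD (asboolT hx : x \in even_pred).

Lemma even_central (x y : D) : spart D false x -> x * y = y * x.
Proof.
move=> hx; have [y0 [y1 [h0 h1 ->]]] := spart_dec y.
rewrite mulrDl mulrDr (spartC hx h0) (spartC hx h1) /= !mul1r //.
Qed.

Lemma sscal2_inv : sscal D 2^-1 * 2 = 1.
Proof.
have -> : 2 = sscal D 2 :> D by rewrite rmorph_nat.
by rewrite -rmorphM mulVf ?rmorph1 // pnatr_eq0.
Qed.

Lemma double_eq0 x : x = - x -> x = 0.
Proof.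
move=> e; have e2 : 2 * x = 0 by rewrite mulr_natl mulr2n {1}e addNr.
by rewrite -[x]mul1r -sscal2_inv -mulrA e2 mulr0.
Qed.

Lemma odd_sqr0 x : spart D true x -> x * x = 0.
Proof. by move=> hx; apply: double_eq0; rewrite {1}(spartC hx hx) expr1 mulN1r. Qed.

Definition even_scal (c : K) : evenD := mkeven (sscal_even D c).

Lemma even_scal_is_zmod_morphism : zmod_morphism even_scal.
Proof. by move=> x y; apply: val_inj; rewrite raddfB /= rmorphB. Qed.
Lemma even_scal_is_monoid_morphism : monoid_morphism even_scal.
Proof. by split=> [|x y]; apply: val_inj; rewrite /= ?rmorph1 // !rmorphM. Qed.
Definition even_scal_rmorphism : {rmorphism K -> evenD} :=
  HB.pack even_scal
    (GRing.isZmodMorphism.Build _ _ even_scal even_scal_is_zmod_morphism)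
    (GRing.isMonoidMorphism.Build _ _ even_scal even_scal_is_monoid_morphism).

End EvenPart.

(** * The universal property of the exterior algebra *)

Section OddProducts.
Variables (K : numFieldType) (D : superalgebra K) (b : nat) (xi : 'I_b -> D).
Hypothesis xi_odd : forall i, spart D true (xi i).
Implicit Types (S T U : {set 'I_b}) (r : seq 'I_b).

Definition oprod_seq r S : D := \prod_(i <- r | i \in S) xi i.
Lemma oprod_cons i r S :
  oprod_seq (i :: r) S = (if i \in S then xi i else 1) * oprod_seq r S.
Proof. by rewrite /oprod_seq big_cons; case: ifP; rewrite ?mul1r. Qed.

Lemma oprod_swap i r S :
  oprod_seq r S * xi i = (-1) ^+ count (mem S) r * (xi i * oprod_seq r S).
Proof.
elim: r => [|k r IH]; first by rewrite /oprod_seq !big_nil expr0 !mul1r mulr1.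
rewrite oprod_cons /=; case: (k \in S); last by rewrite !mul1r add0n.
rewrite -mulrA IH !mulrA add1n exprS; congr (_ * _).
rewrite (commr_sign (xi k)) -!mulrA.
by rewrite (spartC (xi_odd k) (xi_odd i)) expr1 !mulN1r mulrN.
Qed.

Definition ninv_seq r T U := (\sum_(i <- r | i \in T) \sum_(j <- r | j \in U) (j < i))%N.

(** Induction on the list, whose head i is its least element. If i is in U it moves left past all
    later factors from T, one sign for each; if it is in T as well, its square is 0. *)
Lemma oprod_seqM r T U : sorted (fun i j : 'I_b => (i < j)%N) r ->
  oprod_seq r T * oprod_seq r U =
  if [exists i, [&& i \in r, i \in T & i \in U]] then 0
  else (-1) ^+ ninv_seq r T U * oprod_seq r (T :|: U)%SET.
Proof.
elim: r => [|i r IH] rs.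
  case: existsP => [[k]|_]; first by rewrite in_nil.
  by rewrite /oprod_seq /ninv_seq !big_nil !mul1r.
have tr : transitive (fun i j : 'I_b => (i < j)%N) by move=> x y z; exact: ltn_trans.
have il : all (fun j : 'I_b => (i < j)%N) r by exact: (order_path_min tr rs).
have {}rs : sorted (fun i j : 'I_b => (i < j)%N) r by exact: path_sorted rs.
have {IH} := IH rs.
have inv_cons : ninv_seq (i :: r) T U = ((i \in U) * count (mem T) r + ninv_seq r T U)%N.
  rewrite /ninv_seq big_cons (_ : (\sum_(j <- i :: r | j \in U) (j < i))%N = 0%N); last first.
    rewrite big1_seq // => j /andP[_]; rewrite inE => /orP[/eqP ->|jr]; first by rewrite ltnn.
    by move/allP: il => /(_ _ jr) ij; rewrite ltnNge (ltnW ij).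
  rewrite add0n if_same.
  transitivity (\sum_(k <- r | k \in T) ((i \in U) + \sum_(j <- r | j \in U) (j < k)))%N.
    rewrite big_seq_cond [RHS]big_seq_cond; apply: eq_bigr => k /andP[kr _].
    by rewrite big_cons; move/allP: il => /(_ _ kr) ->; case: ifP.
  by rewrite big_split /= big_const_seq iter_addn_0.
have ex_cons : [exists k, [&& k \in i :: r, k \in T & k \in U]] =
    ((i \in T) && (i \in U)) || [exists k, [&& k \in r, k \in T & k \in U]].
  apply/existsP/orP => [[k /and3P[]]|].
    rewrite inE => /orP[/eqP -> -> ->|kr kT kU]; [by left|right].
    by apply/existsP; exists k; rewrite kr kT kU.
  case=> [/andP[iT iU]|/existsP[k /and3P[kr kT kU]]]; first by exists i; rewrite mem_head iT iU.
  by exists k; rewrite inE kr kT kU orbT.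
rewrite ex_cons inv_cons !oprod_cons finset.in_setU.
case iT: (i \in T); case iU: (i \in U) => /= e.
- rewrite -mulrA (mulrA (oprod_seq r T)) oprod_swap -!mulrA -(commr_sign _ (count (mem T) r)).
  by rewrite !mulrA odd_sqr0 // !mul0r.
- rewrite mul1r -mulrA e; case: ifP => _; first by rewrite mulr0.
  by rewrite mul0n add0n mulrA commr_sign mulrA.
- rewrite !mul1r mulrA oprod_swap -!mulrA e; case: ifP => _; first by rewrite !mulr0.
  rewrite mul1n exprD -!mulrA; congr (_ * _).
  by rewrite !mulrA commr_sign.
- by rewrite !mul1r e mul0n add0n.
Qed.

End OddProducts.

Section GrassmannExtension.
Variables (K : numFieldType) (D : superalgebra K) (b : nat) (xi : 'I_b -> D).
Hypothesis xi_odd : forall i, spart D true (xi i).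
Variables (A : calg K) (f : {rmorphism A -> D}).
Hypothesis f_even : forall c, spart D false (f c).
Hypothesis f_scal : forall c, f (cscal A c) = sscal D c.
Implicit Types (S T U : {set 'I_b}).

Definition xiprod S : D := oprod_seq xi (enum 'I_b) S.

Lemma enum_ord_sorted : sorted (fun i j : 'I_b => (i < j)%N) (enum 'I_b).
Proof.
have := iota_ltn_sorted 0 b; rewrite -val_enum_ord.
by rewrite sorted_map.
Qed.

Lemma xiprodM T U : xiprod T * xiprod U =
  if fintype.disjoint (mem T) (mem U) then (-1) ^+ ninv T U * xiprod (T :|: U)%SET else 0.
Proof.
rewrite /xiprod oprod_seqM //; last exact: enum_ord_sorted.
have -> : ninv_seq (enum 'I_b) T U = ninv T U.
  rewrite /ninv_seq /ninv big_enum_cond; apply: eq_big => // i _.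
  by rewrite big_enum_cond.
case: existsP => [[k /and3P[_ kT kU]]|h].
  by case: ifP => // /disjointFr/(_ kT); rewrite kU.
case: ifP => // /negP[]; rewrite disjoint_subset; apply/fintype.subsetP => k kT.
by rewrite inE; apply/negP => kU; apply: h; exists k; rewrite mem_enum kT kU.
Qed.

Lemma xiprod0 : xiprod finset.set0 = 1.
Proof. by rewrite /xiprod /oprod_seq big1 // => i; rewrite finset.inE. Qed.

Lemma xiprod_part S : spart D (odd #|S|) (xiprod S).
Proof.
have main r : spart D (odd (count (mem S) r)) (oprod_seq xi r S).
  elim: r => [|k r IH]; first by rewrite /oprod_seq big_nil; exact: spart1.
  rewrite oprod_cons /=; case: (k \in S); last by rewrite mul1r.
  by rewrite add1n /=; have := spartM (xi_odd k) IH.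
have -> : #|S| = count (mem S) (enum 'I_b) by rewrite cardE -size_filter enumT.
exact: main.
Qed.

Definition gext (g : grassmann b A) : D := \sum_S f (g S) * xiprod S.

Lemma gext_is_zmod_morphism : zmod_morphism gext.
Proof.
move=> g g'; rewrite /gext -sumrB; apply: eq_bigr => S _.
by rewrite gaddE goppE rmorphB mulrBl.
Qed.

Lemma gext_gconst c : gext (gconst b c) = f c.
Proof.
rewrite /gext (bigD1 finset.set0) //= big1 => [|S /negPf S0]; last first.
  by rewrite ffunE S0 rmorph0 mul0r.
by rewrite ffunE eqxx xiprod0 mulr1 addr0.
Qed.

(** Pairs (T, U) that meet contribute 0 on the side of the product, and disjoint pairs correspond to
    a set S = T :|: U with a subset T. The coefficients move freely because [f] has even values. *)
Lemma gext_is_monoid_morphism : monoid_morphism gext.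
Proof.
split=> [|g g']; first by rewrite [1]/(gconst b 1) gext_gconst rmorph1.
rewrite {1}/gext.
have e1 S : f ((g * g') S) * xiprod S =
    \sum_(T : {set 'I_b} | T \subset S) f (g T) * f (g' (S :\: T)%SET) * ((-1) ^+ ninv T (S :\: T)%SET * xiprod S).
  rewrite gmE gmulE rmorph_sum mulr_suml; apply: eq_bigr => T _.
  rewrite !rmorphM rmorphXn rmorphN1.
  by rewrite [RHS]mulrA (commr_sign (f (g T) * _)) !mulrA.
rewrite (eq_bigr _ (fun S _ => e1 S)) (exchange_big_dep xpredT) //=.
rewrite /gext mulr_suml; apply: eq_bigr => T _; rewrite mulr_sumr.
rewrite [RHS](bigID (fun U : {set 'I_b} => fintype.disjoint (mem T) (mem U))) /= [X in _ + X]big1; last first.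
  move=> U /negPf dTU; rewrite -mulrA (mulrA (xiprod T)) -(even_central _ (f_even _)) -mulrA xiprodM dTU.
  by rewrite !mulr0.
rewrite addr0 (reindex_onto (fun U => T :|: U)%SET (fun S => S :\: T)%SET) /=; last first.
  by move=> S TS; rewrite finset.setDE finset.setUIr finset.setUCr finset.setIT; apply/finset.setUidPr.
apply: eq_big => [U|U].
  rewrite finset.subsetUl finset.setDUl finset.setDv finset.set0U /=.
  by rewrite disjoint_sym; apply/eqP/idP => /finset.setDidPl.
move=> /andP[_ /eqP eU]; rewrite eU -!mulrA; congr (_ * _).
rewrite (mulrA (xiprod T)) -(even_central _ (f_even _)) -mulrA xiprodM.
case: ifP => // /negP[].
by rewrite -eU disjoint_sym finset.disjoints_subset finset.setDE finset.subsetIr.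
Qed.

Definition gext_rmorphism : {rmorphism grassmann b A -> D} :=
  HB.pack gext
    (GRing.isZmodMorphism.Build _ _ gext gext_is_zmod_morphism)
    (GRing.isMonoidMorphism.Build _ _ gext gext_is_monoid_morphism).

Lemma gext_scal c : (gext_rmorphism : {rmorphism grassmann_sa b A -> D})
  (sscal (grassmann_sa b A) c) = sscal D c.
Proof. by rewrite /= gext_gconst. Qed.

Lemma gext_part p g : spart (grassmann_sa b A) p g ->
  spart D p ((gext_rmorphism : {rmorphism grassmann_sa b A -> D}) g).
Proof.
move=> pg; rewrite /= /gext; elim/big_ind: _ => [||S _]; first exact: spart0.
  by move=> x y; exact: spartD.
have [pS|nS] := eqVneq (odd #|S|) p.
  by have := spartM (f_even ((g : grassmann b A) S)) (xiprod_part S); rewrite pS.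
by rewrite (pg S nS) rmorph0 mul0r; exact: spart0.
Qed.

Definition gext_smor : smor (grassmann_sa b A) D := SMor gext_scal gext_part.

Lemma gext_gxi i : gext_smor (gxi A i) = xi i.
Proof.
rewrite /= /gext (bigD1 [set i]%SET) //= big1 => [|S /negPf Si]; last first.
  by rewrite ffunE Si rmorph0 mul0r.
rewrite addr0 ffunE eqxx rmorph1 mul1r /xiprod /oprod_seq.
rewrite -big_filter (eq_filter (a2 := pred1 i)) => [|j]; last by rewrite finset.inE.
by rewrite filter_pred1_uniq ?enum_uniq ?mem_enum // big_seq1.
Qed.

End GrassmannExtension.

Section GrassmannGenerators.
Variables (K : numFieldType) (b : nat) (A : calg K).
Implicit Types (S : {set 'I_b}).

Lemma gmono_xiprod S : gmono 1 S = xiprod (D := grassmann_sa b A) (gxi A) S.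
Proof.
have main r : sorted (fun i j : 'I_b => (i < j)%N) r ->
    oprod_seq (D := grassmann_sa b A) (gxi A) r S = gmono 1 [set k in r | k \in S]%SET.
  elim: r => [|k r IH] rs.
    rewrite /oprod_seq big_nil; apply/ffunP => T; rewrite !ffunE.
    by congr (if T == _ then _ else _); apply/finset.setP => k; rewrite !finset.inE.
  have tr : transitive (fun i j : 'I_b => (i < j)%N) by move=> x y z; exact: ltn_trans.
  have il : all (fun j : 'I_b => (k < j)%N) r by exact: (order_path_min tr rs).
  rewrite oprod_cons (IH (path_sorted rs)).
  have kr : k \notin r by apply/negP => /(allP il); rewrite ltnn.
  case: ifP => kS.
    rewrite /gxi gmonoM; last by rewrite finset.disjoints1 !finset.inE (negPf kr).
    have -> : ninv [set k]%SET [set k0 in r | k0 \in S]%SET = 0%N.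
      rewrite /ninv big1 // => i; rewrite finset.inE => /eqP ->.
      rewrite big1 // => j; rewrite !finset.inE => /andP[/(allP il) kj _].
      by rewrite ltnNge (ltnW kj).
    rewrite expr0 !mul1r; congr gmono; apply/finset.setP => i; rewrite !finset.inE.
    by case: eqP => // ->; rewrite kS.
  rewrite mul1r; congr gmono; apply/finset.setP => i; rewrite !finset.inE.
  by case: eqP => // ->; rewrite kS !andbF.
rewrite /xiprod main; last exact: enum_ord_sorted.
by congr gmono; apply/finset.setP => k; rewrite !finset.inE mem_enum.
Qed.

Lemma grassmann_mor_ext (D : superalgebra K) (u v : smor (grassmann_sa b A) D) :
  (forall c : A, u (gconst b c) = v (gconst b c)) ->
  (forall i, u (gxi A i) = v (gxi A i)) -> u = v.
Proof.
move=> uvc uvx; apply: smor_ext => g.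
rewrite [g in LHS](gmonoE (g : grassmann b A)) [g in RHS](gmonoE (g : grassmann b A)) !rmorph_sum.
apply: eq_bigr => S _.
have -> : gmono ((g : grassmann b A) S) S = gconst b ((g : grassmann b A) S) * gmono 1 S.
  by rewrite gconst_gmono mulr1.
rewrite !rmorphM uvc gmono_xiprod /xiprod /oprod_seq !rmorph_prod; congr (_ * _).
by apply: eq_bigr => i _; rewrite uvx.
Qed.

End GrassmannGenerators.

Section HypersurfaceMorphisms.
Variables (K : numFieldType) (n : nat) (h : mpoly.mpoly n K) (b : nat) (D : superalgebra K).
Local Notation P := (mpoly.mpoly n K).
Local Notation X i := (mpoly.mpolyX K (mpoly.mnm1 i) : P).

Definition hyp_coord (p : P) : hyp_sa h b := gconst b (pfun_of h p : pfun_calg h).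
Definition hyp_odd (i : 'I_b) : hyp_sa h b := gxi (pfun_calg h) i.

Lemma hyp_mor_ext (u v : smor (hyp_sa h b) D) :
  (forall i, u (hyp_coord (X i)) = v (hyp_coord (X i))) ->
  (forall i, u (hyp_odd i) = v (hyp_odd i)) -> u = v.
Proof.
move=> uvX uvx; apply: grassmann_mor_ext => // c.
have [p <-] := pfun_of_surj c.
pose c0 : {rmorphism P -> grassmann b (pfun h)} := @gconst b (pfun h) \o pfun_of_rmorphism h.
pose u' : {rmorphism P -> D} := u \o c0; pose v' : {rmorphism P -> D} := v \o c0.
suff : u' =1 v' by apply.
apply: mpoly_morphism_ext => [k|i]; last exact: uvX.
by rewrite /= -[gconst _ _]/(sscal (hyp_sa h b) k) !smor_scal.
Qed.

Variable J : pred 'I_n.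
Hypothesis hJ : forall (x : 'rV[K]_n) (u : K),
  mpeval h (\row_i (if J i then u * x 0 i else x 0 i)) = u * mpeval h x.

(** By [morphism_vanish] the value of [F] depends only on the restriction of a polynomial to the
    hypersurface, so [F] descends through any choice of representatives. *)
Lemma hyp_mor_exists (F : {rmorphism P -> evenD D}) (xi : 'I_b -> D) :
  (forall c, F (mpoly.mpolyC n c) = even_scal D c) -> F h = 1 ->
  (forall i, spart D true (xi i)) ->
  exists u : smor (hyp_sa h b) D,
    (forall p, u (hyp_coord p) = evenval (F p)) /\ forall i, u (hyp_odd i) = xi i.
Proof.
move=> FC Fh xio.
pose rep (c : pfun h) : P := sval (cid (pfun_of_surj c)).
have repK c : pfun_of h (rep c) = c := svalP (cid (pfun_of_surj c)).
pose f (c : pfun_calg h) : D := evenval (F (rep c)).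
have Feq (p q : P) : pfun_of h p = pfun_of h q -> F p = F q.
  move=> epq; apply/eqP; rewrite -subr_eq0 -rmorphB; apply/eqP.
  apply: (@morphism_vanish K n h J hJ (evenD D) F (p - q)) => //.
  by apply/pfun_of_eq0; rewrite [LHS](rmorphB (pfun_of_rmorphism h)) /= epq subrr.
have fE p : f (pfun_of h p) = evenval (F p) by rewrite /f (Feq _ p) // repK.
have evB (x y : evenD D) : evenval (x - y) = evenval x - evenval y.
  exact: (rmorphB (val : evenD D -> D)).
have evM (x y : evenD D) : evenval (x * y) = evenval x * evenval y.
  exact: (rmorphM (val : evenD D -> D)).
have fz : zmod_morphism f.
  move=> c d; rewrite -(repK c) -(repK d) -(rmorphB (pfun_of_rmorphism h)) !fE.
  by rewrite rmorphB evB.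
have fm : monoid_morphism f.
  split=> [|c d]; first by rewrite -(rmorph1 (pfun_of_rmorphism h)) fE rmorph1.
  rewrite -(repK c) -(repK d) -(rmorphM (pfun_of_rmorphism h)) !fE.
  by rewrite rmorphM evM.
pose fr : {rmorphism pfun_calg h -> D} := HB.pack f
  (GRing.isZmodMorphism.Build _ _ f fz) (GRing.isMonoidMorphism.Build _ _ f fm).
have fev c : spart D false (fr c) by exact: evenvalE.
have fsc c : fr (cscal (pfun_calg h) c) = sscal D c by rewrite /= fE FC.
exists (gext_smor xio fev fsc); split=> [p|i]; last exact: gext_gxi.
by rewrite /= gext_gconst /= fE.
Qed.

End HypersurfaceMorphisms.

(** * The Berezinian *)

Section EvenMatrices.
Variables (K : numFieldType) (D : superalgebra K).

Definition even_val : {rmorphism evenD D -> D} := (val : evenD D -> D).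

Lemma spart_sum p (I : Type) (r : seq I) (P : pred I) (F : I -> D) :
  (forall i, P i -> spart D p (F i)) -> spart D p (\sum_(i <- r | P i) F i).
Proof.
move=> h; elim/big_ind: _ => //; first exact: spart0.
by move=> x y; exact: spartD.
Qed.

Lemma mx_partM p q k l o (s : 'M[D]_(k, l)) (t : 'M[D]_(l, o)) :
  mx_part p s -> mx_part q t -> mx_part (p (+) q) (s *m t).
Proof. by move=> hs ht i j; rewrite mxE; apply: spart_sum => c _; exact: spartM. Qed.

Lemma mx_partD p k l (s t : 'M[D]_(k, l)) :
  mx_part p s -> mx_part p t -> mx_part p (s + t).
Proof. by move=> hs ht i j; rewrite mxE; exact: spartD. Qed.

Lemma mx_partN p k l (s : 'M[D]_(k, l)) : mx_part p s -> mx_part p (- s).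
Proof. by move=> hs i j; rewrite mxE; exact: spartN. Qed.

Lemma mx_partB p k l (s t : 'M[D]_(k, l)) :
  mx_part p s -> mx_part p t -> mx_part p (s - t).
Proof. by move=> hs ht; apply: mx_partD => //; exact: mx_partN. Qed.

Lemma mx_part0 p k l : mx_part p (0 : 'M[D]_(k, l)).
Proof. by move=> i j; rewrite mxE; exact: spart0. Qed.

Lemma mx_part1 k : mx_part false (1%:M : 'M[D]_k).
Proof. by move=> i j; rewrite mxE; case: eqP => _; [exact: spart1|exact: spart0]. Qed.

(** The transfer principle for determinants: identities over the commutative ring [evenD D] become
    identities for even matrices over [D]. *)
Lemma mx_part_lift k l (s : 'M[D]_(k, l)) : mx_part false s ->
  exists s', s = map_mx even_val s'.
Proof.
by move=> hs; exists (\matrix_(i, j) mkeven (hs i j)); apply/matrixP => i j; rewrite !mxE.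
Qed.

Lemma mx_part_map k l (s : 'M[evenD D]_(k, l)) : mx_part false (map_mx even_val s).
Proof. by move=> i j; rewrite mxE; exact: evenvalE. Qed.

Lemma det_even k (s : 'M[D]_k) : mx_part false s -> spart D false (\det s).
Proof. by move=> /mx_part_lift[s' ->]; rewrite det_map_mx; exact: evenvalE. Qed.

Lemma det_evenM k (s t : 'M[D]_k) : mx_part false s -> mx_part false t ->
  \det (s *m t) = \det s * \det t.
Proof.
by move=> /mx_part_lift[s' ->] /mx_part_lift[t' ->]; rewrite -map_mxM !det_map_mx det_mulmx rmorphM.
Qed.

Lemma det_even1 k : \det (1%:M : 'M[D]_k) = 1.
Proof.
have := det_map_mx even_val (1%:M : 'M[evenD D]_k).
by rewrite map_mx1 det1 rmorph1.
Qed.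

Lemma det_even_ublock k l (s : 'M[D]_k) (q : 'M[D]_(k, l)) (t : 'M[D]_l) :
  mx_part false s -> mx_part false q -> mx_part false t ->
  \det (block_mx s q 0 t) = \det s * \det t.
Proof.
move=> /mx_part_lift[s' ->] /mx_part_lift[q' ->] /mx_part_lift[t' ->].
by rewrite -(map_mx0 even_val) -map_block_mx !det_map_mx det_ublock rmorphM.
Qed.

Lemma det_even_lblock k l (s : 'M[D]_k) (q : 'M[D]_(l, k)) (t : 'M[D]_l) :
  mx_part false s -> mx_part false q -> mx_part false t ->
  \det (block_mx s 0 q t) = \det s * \det t.
Proof.
move=> /mx_part_lift[s' ->] /mx_part_lift[q' ->] /mx_part_lift[t' ->].
by rewrite -(map_mx0 even_val) -map_block_mx !det_map_mx det_lblock rmorphM.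
Qed.

Lemma mx_part_block p k l k' l' (s : 'M[D]_(k, l)) (q : 'M[D]_(k, l')) (r : 'M[D]_(k', l))
    (t : 'M[D]_(k', l')) :
  mx_part p s -> mx_part p q -> mx_part p r -> mx_part p t -> mx_part p (block_mx s q r t).
Proof.
move=> hs hq hr ht i j; rewrite !mxE.
by case: (fintype.split i) => i'; rewrite !mxE; case: (fintype.split j).
Qed.

Lemma mx_inverse_uniq k (s t t' : 'M[D]_k) : mx_inverse s t -> mx_inverse s t' -> t = t'.
Proof. by move=> [_ ts] [st' _]; rewrite -[t]mulmx1 -st' mulmxA ts mul1mx. Qed.

Lemma mx_invE k (s t : 'M[D]_k) : mx_inverse s t -> mx_inv s = t.
Proof.
move=> h; apply: (@mx_inverse_uniq _ s) => //.
exact: (@xgetPex _ 1%:M [set t | mx_inverse s t] (ex_intro _ t h)).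
Qed.

Lemma mx_inverse_sym k (s t : 'M[D]_k) : mx_inverse s t -> mx_inverse t s.
Proof. by case. Qed.

Lemma mx_inverse1 k : mx_inverse (1%:M : 'M[D]_k) 1%:M.
Proof. by split; rewrite mulmx1. Qed.

Lemma mx_inverseM k (s t s' t' : 'M[D]_k) :
  mx_inverse s t -> mx_inverse s' t' -> mx_inverse (s *m s') (t' *m t).
Proof.
move=> [st ts] [st' ts']; split.
  by rewrite mulmxA -(mulmxA s) st' mulmx1.
by rewrite mulmxA -(mulmxA t') ts mulmx1.
Qed.

(* The odd part of s t = 1 says that s kills the odd part of t. *)
Lemma mx_inverse_even k (s t : 'M[D]_k) : mx_part false s -> mx_inverse s t -> mx_part false t.
Proof.
move=> hs [st ts].
have part i j : exists x : D * D, [/\ spart D false x.1, spart D true x.2 & t i j = x.1 + x.2].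
  by have [x0 [x1 h]] := spart_dec (t i j); exists (x0, x1).
pose t0 : 'M[D]_k := \matrix_(i, j) (sval (cid (part i j))).1.
pose t1 : 'M[D]_k := \matrix_(i, j) (sval (cid (part i j))).2.
have h0 : mx_part false t0 by move=> i j; rewrite mxE; case: cid => x [].
have h1 : mx_part true t1 by move=> i j; rewrite mxE; case: cid => x [].
have et : t = t0 + t1.
  by apply/matrixP => i j; rewrite !mxE; case: cid => x [].
have st1 : s *m t1 = 0.
  have e : s *m t1 = 1%:M - s *m t0 by rewrite -st et mulmxDr addrAC subrr add0r.
  apply/matrixP => i j; rewrite [RHS]mxE; apply: spart_disj; last exact: (mx_partM hs h1).
  by rewrite e; apply: mx_partB; [exact: mx_part1|exact: (mx_partM hs h0)].
by rewrite -[t1]mul1mx -ts -mulmxA st1 mulmx0 addr0 in et; rewrite et.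
Qed.

Lemma mx_inverse_det k (s t : 'M[D]_k) : mx_part false s -> mx_inverse s t ->
  \det s * \det t = 1.
Proof.
move=> hs h; rewrite -det_evenM ?(mx_inverse_even hs h) //; last exact: mx_inverse_even h.
by case: h => [-> _]; rewrite det_even1.
Qed.

Lemma even_det_invertible k (s : 'M[D]_k) (d : D) : mx_part false s -> spart D false d ->
  \det s * d = 1 -> exists2 t, mx_part false t & mx_inverse s t.
Proof.
move=> /mx_part_lift[s' ->] hd; rewrite det_map_mx => e.
pose d' : evenD D := mkeven hd.
have e' : \det s' * d' = 1 by apply: val_inj; rewrite -[LHS]/(even_val _) rmorphM.
exists (map_mx even_val (d' *: \adj s')); first exact: mx_part_map.
split; rewrite -map_mxM ?scalemxAr -?scalemxAl -?scalemxAr ?mul_mx_adj ?mul_adj_mx.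
  by rewrite scale_scalar_mx mulrC e' map_mx1.
by rewrite scale_scalar_mx mulrC e' map_mx1.
Qed.

Lemma det_even_schur k l (s s' : 'M[D]_k) (q : 'M[D]_(k, l)) (r : 'M[D]_(l, k)) (t : 'M[D]_l) :
  mx_part false s -> mx_part false q -> mx_part false r -> mx_part false t ->
  mx_inverse s s' -> \det (block_mx s q r t) = \det s * \det (t - r *m s' *m q).
Proof.
move=> hs hq hr ht h; have hs' := mx_inverse_even hs h; have [ss' s's] := h.
have -> : block_mx s q r t = block_mx s 0 r 1%:M *m block_mx 1%:M (s' *m q) 0 (t - r *m s' *m q).
  rewrite mulmx_block !mulmx1 !mul0mx !mulmx0 !addr0 mul1mx !mulmxA ss' mul1mx.
  by rewrite addrCA subrr addr0.
have h1 := @mx_part1.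
have hsq : mx_part false (s' *m q) by exact: (mx_partM hs' hq).
have htr : mx_part false (t - r *m s' *m q).
  by apply: mx_partB => //; exact: (mx_partM (mx_partM hr hs') hq).
have h0 := @mx_part0 false.
rewrite det_evenM ?det_even_lblock ?det_even_ublock //; try by apply: mx_part_block.
by rewrite !det_even1 mulr1 mul1r.
Qed.

End EvenMatrices.

(** * Sylvester's determinant identity for odd matrices *)

Section OddSylvester.
Variables (K : numFieldType) (D : superalgebra K).

(** The formula (1 + x y)^-1 = 1 - x (1 + y x)^-1 y, valid over any ring. *)
Lemma mx_inverse_swap k l (x : 'M[D]_(k, l)) (y : 'M[D]_(l, k)) v :
  mx_inverse (1%:M + y *m x) v -> mx_inverse (1%:M + x *m y) (1%:M - x *m v *m y).
Proof.
move=> [yxv vyx]; set w := x *m v *m y.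
have e1 : x *m y *m w = x *m y - w.
  have -> : x *m y *m w = x *m ((1%:M + y *m x) *m v) *m y - w.
    by rewrite mulmxDl mul1mx mulmxDr mulmxDl addrAC subrr add0r !mulmxA.
  by rewrite yxv mulmx1.
have e2 : w *m (x *m y) = x *m y - w.
  have -> : w *m (x *m y) = x *m (v *m (1%:M + y *m x)) *m y - w.
    by rewrite mulmxDr mulmx1 mulmxDr mulmxDl addrAC subrr add0r !mulmxA.
  by rewrite vyx mulmx1.
split; first by rewrite mulmxDl mul1mx mulmxBr mulmx1 e1 subKr subrK.
by rewrite mulmxDr mulmx1 mulmxBl mul1mx e2 subKr subrK.
Qed.

(** With commuting entries the two determinants would be equal; anticommutation makes them inverse
    to each other. *)
Definition odd_sylvester k l := forall (x : 'M[D]_(k, l)) (y : 'M[D]_(l, k)),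
  mx_part true x -> mx_part true y -> \det (1%:M + x *m y) * \det (1%:M + y *m x) = 1.

Lemma odd_mulmx_even k l (x : 'M[D]_(k, l)) (y : 'M[D]_(l, k)) :
  mx_part true x -> mx_part true y -> mx_part false (1%:M + x *m y).
Proof. by move=> hx hy; apply: mx_partD; [exact: mx_part1|exact: (mx_partM hx hy)]. Qed.

Lemma odd_sylvester_sym k l : odd_sylvester k l -> odd_sylvester l k.
Proof.
move=> h x y hx hy; rewrite even_central; first exact: h.
by apply: det_even; exact: odd_mulmx_even.
Qed.

Lemma odd_sylvester0 k : odd_sylvester k 0.
Proof.
move=> x y _ _; rewrite [x]thinmx0 mul0mx addr0 mulmx0 addr0 !det_even1.
exact: mulr1.
Qed.

(** For odd elements this reads (1 + x y)(1 - x y) = 1, because x y squares to 0. *)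
Lemma odd_sylvester11 : odd_sylvester 1 1.
Proof.
move=> x y hx hy; have e (u v : 'M[D]_1) : mx_part true u -> mx_part true v ->
    \det (1%:M + u *m v) = 1 + u 0 0 * v 0 0.
  move=> hu hv; have [w ew] := mx_part_lift (odd_mulmx_even hu hv).
  rewrite ew det_map_mx det_mx11; have := congr1 (fun M : 'M[D]_1 => M 0 0) ew.
  by rewrite !mxE big_ord1 eqxx => ->.
rewrite !e // (spartC (hy 0 0) (hx 0 0)) expr1 mulN1r mulrDl mul1r mulrDr mulr1.
have -> : x 0 0 * y 0 0 * - (x 0 0 * y 0 0) = 0.
  rewrite mulrN -mulrA (mulrA (y 0 0)) (spartC (hy 0 0) (hx 0 0)) expr1 mulN1r mulNr -mulrA.
  by rewrite odd_sqr0 ?mulr0 ?oppr0 ?mulr0 ?oppr0.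
by rewrite addr0 subrK.
Qed.

Lemma odd_invertible k l (x : 'M[D]_(k, l)) (y : 'M[D]_(l, k)) : odd_sylvester k l ->
  mx_part true x -> mx_part true y ->
  exists2 v, mx_part false v & mx_inverse (1%:M + x *m y) v.
Proof.
move=> h hx hy; apply: (even_det_invertible _ _ (h _ _ hx hy)); first exact: odd_mulmx_even.
by apply: det_even; exact: odd_mulmx_even.
Qed.

(** With u = 1 + x1 y1, the first matrix is u (1 + u^-1 x2 y2), while the Schur complement of 1 + y1
    x1 in the second is 1 + y2 u^-1 x2, by the formula of [mx_inverse_swap]. The two hypotheses pair
    off the four determinants. *)
Lemma odd_sylvesterD k l1 l2 :
  odd_sylvester k l1 -> odd_sylvester k l2 -> odd_sylvester k (l1 + l2).
Proof.
move=> h1 h2 x y; rewrite -[x]hsubmxK -[y]vsubmxK.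
set x1 := lsubmx x; set x2 := rsubmx x; set y1 := usubmx y; set y2 := dsubmx y => hx hy.
have hx1 : mx_part true x1 by move=> i j; have := hx i (lshift _ j); rewrite row_mxEl.
have hx2 : mx_part true x2 by move=> i j; have := hx i (rshift _ j); rewrite row_mxEr.
have hy1 : mx_part true y1 by move=> i j; have := hy (lshift _ i) j; rewrite col_mxEu.
have hy2 : mx_part true y2 by move=> i j; have := hy (rshift _ i) j; rewrite col_mxEd.
have [v hv vI] := odd_invertible (odd_sylvester_sym h1) hy1 hx1.
pose u' := 1%:M - x1 *m v *m y1; have [uu' u'u] := mx_inverse_swap vI.
have hu' : mx_part false u'.
  by apply: mx_partB; [exact: mx_part1|exact: (mx_partM (mx_partM hx1 hv) hy1)].
have hux : mx_part true (u' *m x2) by exact: (mx_partM hu' hx2).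
have e1 : \det (1%:M + row_mx x1 x2 *m col_mx y1 y2) =
    \det (1%:M + x1 *m y1) * \det (1%:M + u' *m x2 *m y2).
  rewrite -det_evenM; try exact: odd_mulmx_even.
  by rewrite mulmxDr mulmx1 !mulmxA uu' mul1mx mul_row_col addrA.
have e2 : \det (1%:M + col_mx y1 y2 *m row_mx x1 x2) =
    \det (1%:M + y1 *m x1) * \det (1%:M + y2 *m (u' *m x2)).
  have part2 (k1 k2 k3 : nat) (s : 'M[D]_(k1, k2)) (t : 'M[D]_(k2, k3)) :
    mx_part true s -> mx_part true t -> mx_part false (s *m t) by move=> hs ht; exact: (mx_partM hs ht).
  rewrite mul_col_row scalar_mx_block add_block_mx !add0r (det_even_schur _ _ _ _ vI);
    try by [exact: odd_mulmx_even|exact: part2].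
  congr (_ * \det _); rewrite /u' mulmxBl mul1mx mulmxBr addrA; congr (_ - _).
  by rewrite !mulmxA.
rewrite e1 e2 mulrA -(mulrA (\det _)) (even_central (\det (1%:M + y1 *m x1))).
  by rewrite mulrA -(mulrA _ (\det (_ + _ *m y2))) h2 // mulr1 h1.
by apply: det_even; exact: odd_mulmx_even.
Qed.

Lemma odd_sylvesterP k l : odd_sylvester k l.
Proof.
have h1 l' : odd_sylvester 1 l'.
  elim: l' => [|l' IH]; first exact: odd_sylvester0.
  by rewrite -[l'.+1]add1n; apply: odd_sylvesterD => //; exact: odd_sylvester11.
elim: l => [|l IH]; first exact: odd_sylvester0.
by rewrite -[l.+1]add1n; apply: odd_sylvesterD => //; exact/odd_sylvester_sym.
Qed.

End OddSylvester.

(** * Block factorisation and multiplicativity of the Berezinian *)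

Section SpecialLinear.
Variables (K : numFieldType) (D : superalgebra K) (m n : nat).

Definition bl_upper (x : 'M[D]_(m, n)) : 'M[D]_(m + n) := block_mx 1%:M x 0 1%:M.
Definition bl_diag (p : 'M[D]_m) (s : 'M[D]_n) : 'M[D]_(m + n) := block_mx p 0 0 s.
Definition bl_lower (y : 'M[D]_(n, m)) : 'M[D]_(m + n) := block_mx 1%:M 0 y 1%:M.

Lemma bl_upperD x x' : bl_upper x *m bl_upper x' = bl_upper (x + x').
Proof. by rewrite mulmx_block !mul1mx !mulmx1 !mulmx0 !mul0mx !addr0 add0r addrC. Qed.

Lemma bl_lowerD y y' : bl_lower y *m bl_lower y' = bl_lower (y + y').
Proof. by rewrite mulmx_block !mul1mx !mulmx1 !mulmx0 !mul0mx !addr0 add0r. Qed.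

Lemma bl_diagM p s p' s' : bl_diag p s *m bl_diag p' s' = bl_diag (p *m p') (s *m s').
Proof. by rewrite mulmx_block !mulmx0 !mul0mx !addr0 !add0r. Qed.

Lemma bl_upper0 : bl_upper 0 = 1%:M.
Proof. by rewrite /bl_upper -scalar_mx_block. Qed.

Lemma bl_lower0 : bl_lower 0 = 1%:M.
Proof. by rewrite /bl_lower -scalar_mx_block. Qed.

Lemma bl_diag1 : bl_diag 1%:M 1%:M = 1%:M.
Proof. by rewrite /bl_diag -scalar_mx_block. Qed.

Lemma bl_diag_upper p s s' x : s' *m s = 1%:M ->
  bl_diag p s *m bl_upper x = bl_upper (p *m x *m s') *m bl_diag p s.
Proof.
move=> ss; rewrite !mulmx_block !mul1mx !mulmx1 !mulmx0 !mul0mx !addr0 !add0r.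
by rewrite -mulmxA ss mulmx1.
Qed.

Lemma bl_lower_diag p s s' y : s *m s' = 1%:M ->
  bl_lower y *m bl_diag p s = bl_diag p s *m bl_lower (s' *m y *m p).
Proof.
move=> ss; rewrite !mulmx_block !mul1mx !mulmx1 !mulmx0 !mul0mx !addr0 !add0r.
by rewrite !mulmxA ss mul1mx.
Qed.

Definition udl x p s y := bl_upper x *m bl_diag p s *m bl_lower y.

Lemma udlE x p s y : udl x p s y = block_mx (p + x *m s *m y) (x *m s) (s *m y) s.
Proof. by rewrite /udl !mulmx_block !mul1mx !mulmx1 !mulmx0 !mul0mx !addr0 !add0r. Qed.

(** The reordering that products of factorised matrices call for. Its diagonal part is ((1 + x
    y)^-1, 1 + y x), which has Berezinian 1 for odd [x] and [y] by [odd_sylvesterP]. *)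
Lemma bl_lower_upper y x f : mx_inverse (1%:M + y *m x) f ->
  bl_lower y *m bl_upper x =
  udl (x *m f) (1%:M - x *m f *m y) (1%:M + y *m x) (f *m y).
Proof.
move=> [yxf fyx]; rewrite udlE mulmx_block !mul1mx !mulmx1 !mul0mx !addr0.
rewrite !mulmxA -(mulmxA x f (_ + _)) fyx mulmx1 yxf mul1mx subrK.
by rewrite [y *m x + _]addrC.
Qed.

(** Inverses are carried as witnesses, so that the group computations proceed without [mx_inv]. *)
Definition udl_spec (g : 'M[D]_(m + n)) (d : D) : Prop :=
  exists (x : 'M[D]_(m, n)) (p p' : 'M[D]_m) (s s' : 'M[D]_n) (y : 'M[D]_(n, m)),
    [/\ mx_part true x, mx_part true y, mx_part false p /\ mx_part false s,
        mx_inverse p p' /\ mx_inverse s s' &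
        g = udl x p s y /\ d = \det p * \det s'].

Lemma udl_specP g d : udl_spec g d <-> GL g /\ Ber g = d.
Proof.
split.
  move=> [x [p [p' [s [s' [y [hx hy [hp hs] [hpp hss] [-> ->]]]]]]]].
  have hp' := mx_inverse_even hp hpp.
  rewrite /GL /Ber udlE /= !block_mxKul !block_mxKur !block_mxKdl !block_mxKdr.
  rewrite (mx_invE hss); split; last first.
    by rewrite -!mulmxA (mulmxA s) (proj1 hss) mul1mx addrK.
  have hxs : mx_part true (x *m s) by exact: (mx_partM hx hs).
  have hsy : mx_part true (s *m y) by exact: (mx_partM hs hy).
  split; first split=> //.
    by apply: mx_partD => //; exact: (mx_partM hxs hy).
  split; last by exists s'.
  (* The upper left block is p (1 + p' x s y), and 1 plus a product of two odd matrices is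
     invertible. *)
  have hpx : mx_part true (p' *m x) by exact: (mx_partM hp' hx).
  have [v _ vI] := odd_invertible (@odd_sylvesterP _ _ _ _) hpx hsy.
  exists (v *m p'); have := mx_inverseM hpp vI.
  by rewrite mulmxDr mulmx1 !mulmxA (proj1 hpp) mul1mx.
move=> [[[hP hq hr hS] [[P' hPP] [S' hSS]]] <-].
set P := ulsubmx g in hP hPP *; set q := ursubmx g in hq *; set r := dlsubmx g in hr *.
set S := drsubmx g in hS hSS *.
have hP' := mx_inverse_even hP hPP; have hS' := mx_inverse_even hS hSS.
have hx : mx_part true (q *m S') by exact: (mx_partM hq hS').
have hy : mx_part true (S' *m r) by exact: (mx_partM hS' hr).
(* The same device for the Schur complement: P - q S' r = P (1 - P' q S' r). *)
have hPq : mx_part true (- (P' *m q)) by apply: mx_partN; exact: (mx_partM hP' hq).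
have [v _ vI] := odd_invertible (@odd_sylvesterP _ _ _ _) hPq hy.
exists (q *m S'), (P - q *m S' *m r), (v *m P'), S, S', (S' *m r); split=> //.
- by split=> //; apply: mx_partB => //; exact: (mx_partM hx hr).
- split=> //; have := mx_inverseM hPP vI.
  by rewrite mulmxDr mulmx1 !mulNmx mulmxN !mulmxA (proj1 hPP) mul1mx.
split; last by rewrite /Ber (mx_invE hSS).
rewrite udlE -!mulmxA (mulmxA S) (proj1 hSS) (proj2 hSS) mulmx1 mul1mx subrK.
by rewrite submxK.
Qed.

Lemma udl_spec1 : udl_spec 1%:M 1.
Proof.
exists 0, 1%:M, 1%:M, 1%:M, 1%:M, 0; split; try exact: mx_part0.
- by split; exact: mx_part1.
- by split; exact: mx_inverse1.
- by rewrite /udl bl_upper0 bl_lower0 bl_diag1 !mulmx1 !det_even1 mulr1.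
Qed.

Lemma det_lift k (s : 'M[D]_k) : mx_part false s -> exists a : evenD D, \det s = even_val D a.
Proof. by move=> hs; exists (mkeven (det_even hs)). Qed.

(** The inner factors L(y) U(z) are reordered by [bl_lower_upper]; the new unipotent factors are
    then moved outwards through the diagonal ones by conjugation. *)
Lemma udl_specM g g' d d' : udl_spec g d -> udl_spec g' d' -> udl_spec (g *m g') (d * d').
Proof.
move=> [x [p [p' [s [s' [y [hx hy [hp hs] [hpp hss] [-> ->]]]]]]]].
move=> [z [q [q' [t [t' [w [hz hw [hq ht] [hqq htt] [-> ->]]]]]]]].
have hs' := mx_inverse_even hs hss; have ht' := mx_inverse_even ht htt.
have [f hf fI] := odd_invertible (@odd_sylvesterP _ _ _ _) hy hz.
pose e := 1%:M - z *m f *m y; have eI := mx_inverse_swap fI.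
have hF := odd_mulmx_even hy hz; have hE := odd_mulmx_even hz hy.
have he : mx_part false e := mx_inverse_even hE eI.
have odd1 k l (u : 'M[D]_(k, k)) (v : 'M[D]_(k, l)) :
  mx_part false u -> mx_part true v -> mx_part true (u *m v) by move=> hu hv; exact: (mx_partM hu hv).
have odd2 k l (u : 'M[D]_(k, l)) (v : 'M[D]_(l, l)) :
  mx_part true u -> mx_part false v -> mx_part true (u *m v) by move=> hu hv; exact: (mx_partM hu hv).
have even1 k (u : 'M[D]_(k, k)) (v : 'M[D]_(k, k)) :
  mx_part false u -> mx_part false v -> mx_part false (u *m v) by move=> hu hv; exact: (mx_partM hu hv).
exists (x + p *m (z *m f) *m s'), (p *m e *m q), (q' *m ((1%:M + z *m y) *m p')),
  (s *m (1%:M + y *m z) *m t), (t' *m (f *m s')), (t' *m (f *m y) *m q + w).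
split.
- by apply: mx_partD => //; apply: (odd2) => //; apply: (odd1) => //; exact: odd2.
- by apply: mx_partD => //; apply: (odd2) => //; apply: (odd1) => //; exact: odd1.
- by split; apply: (even1) => //; exact: even1.
- split; apply: mx_inverseM => //; apply: mx_inverseM => //.
  exact: mx_inverse_sym eI.
split.
  rewrite /udl -bl_upperD -bl_lowerD -!bl_diagM -!mulmxA.
  rewrite (mulmxA (bl_lower y)) (bl_lower_upper fI) /udl -!mulmxA; congr (_ *m _).
  rewrite (mulmxA (bl_diag p s)) (bl_diag_upper _ _ (proj2 hss)) -!mulmxA.
  do 3! congr (_ *m _); first by rewrite /e -?mulmxA.
  rewrite (mulmxA (bl_lower (f *m y))) (bl_lower_diag _ _ (proj1 htt)) -!mulmxA.
  by congr (_ *m (_ *m _)).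
(* [e] and [f] invert 1 + z y and 1 + y z, whose determinants are mutually inverse. Lifting to
   [evenD D] lets the factors be permuted. *)
have ef1 : \det e * \det f = 1.
  have := mx_inverse_det hE eI; have := mx_inverse_det hF fI; have := odd_sylvesterP hz hy.
  have [a ->] := det_lift hE; have [b ->] := det_lift hF; have [c ->] := det_lift hf.
  rewrite -/e; have [k ->] := det_lift he.
  rewrite -!(rmorphM (even_val D)) -(rmorph1 (even_val D)) => /val_inj ab /val_inj bc /val_inj ak.
  congr (even_val D _); have := mulrACA a b k c.
  by rewrite ab ak bc !mul1r.
rewrite !det_evenM //; try by [exact: even1].
move: ef1; have [a ->] := det_lift hp; have [b ->] := det_lift hq; have [c ->] := det_lift hf.
have [k ->] := det_lift he; have [u ->] := det_lift hs'; have [v ->] := det_lift ht'.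
rewrite -!(rmorphM (even_val D)) -(rmorph1 (even_val D)) => /val_inj kc; congr (even_val D _).
by rewrite mulrACA (mulrAC a k) -(mulrA (a * b)) (mulrCA v) (mulrA k) kc mul1r (mulrC v).
Qed.

Lemma udl_spec_inv g d : udl_spec g d ->
  exists g' d', [/\ udl_spec g' d', g *m g' = 1%:M, g' *m g = 1%:M & d' * d = 1].
Proof.
move=> [x [p [p' [s [s' [y [hx hy [hp hs] [hpp hss] [-> ->]]]]]]]].
have hs' := mx_inverse_even hs hss; have hp' := mx_inverse_even hp hpp.
have sU : udl_spec (bl_upper (- x)) 1.
  exists (- x), 1%:M, 1%:M, 1%:M, 1%:M, 0; split; try exact: mx_part0.
  - exact: mx_partN.
  - by split; exact: mx_part1.
  - by split; exact: mx_inverse1.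
  - by rewrite /udl bl_lower0 bl_diag1 !mulmx1 !det_even1 mulr1.
have sL : udl_spec (bl_lower (- y)) 1.
  exists 0, 1%:M, 1%:M, 1%:M, 1%:M, (- y); split; try exact: mx_part0.
  - exact: mx_partN.
  - by split; exact: mx_part1.
  - by split; exact: mx_inverse1.
  - by rewrite /udl bl_upper0 bl_diag1 !mul1mx !det_even1 mulr1.
have sD : udl_spec (bl_diag p' s') (\det p' * \det s).
  exists 0, p', p, s', s, 0; split; try exact: mx_part0; try by [].
    by split; exact: mx_inverse_sym.
  by rewrite /udl bl_lower0 bl_upper0 mul1mx mulmx1.
exists (bl_lower (- y) *m (bl_diag p' s' *m bl_upper (- x))), (1 * ((\det p' * \det s) * 1)).
have [pp' p'p] := hpp; have [ss' s's] := hss.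
split; first by apply: udl_specM => //; exact: udl_specM.
- rewrite /udl -!mulmxA (mulmxA (bl_lower y)) bl_lowerD subrr bl_lower0 mul1mx.
  by rewrite (mulmxA (bl_diag p s)) bl_diagM pp' ss' bl_diag1 mul1mx bl_upperD subrr bl_upper0.
- rewrite /udl -!mulmxA (mulmxA (bl_upper (- x))) bl_upperD addNr bl_upper0 mul1mx.
  by rewrite (mulmxA (bl_diag p' s')) bl_diagM p'p s's bl_diag1 mul1mx bl_lowerD addNr bl_lower0.
rewrite mul1r mulr1 -mulrA (mulrA (\det s)) (even_central (\det p) (det_even hs)) -mulrA mulrA.
by rewrite !mx_inverse_det ?mulr1 //; exact: mx_inverse_sym.
Qed.

End SpecialLinear.

(** * Representability *)

Section SpecialLinearGroup.
Variables (K : numFieldType) (D : superalgebra K) (m n : nat).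

Lemma SLP (g : 'M[D]_(m + n)) : SL g <-> udl_spec g 1.
Proof. by split; [move/udl_specP|move/udl_specP]. Qed.

Lemma SL_1 : @SL K D m n 1%:M.
Proof. by apply/SLP; exact: udl_spec1. Qed.

Lemma SL_mul (g g' : 'M[D]_(m + n)) : SL g -> SL g' -> SL (g *m g').
Proof. by move=> /SLP sg /SLP sg'; apply/SLP; rewrite -[1]mulr1; exact: udl_specM. Qed.

Lemma SL_inverse (g : 'M[D]_(m + n)) : SL g -> exists2 g', SL g' & mx_inverse g g'.
Proof.
move=> /SLP/udl_spec_inv[g' [d' [sg' gg' g'g d1]]]; exists g'; last by [].
by apply/SLP; move: sg'; rewrite -d1 mulr1.
Qed.

End SpecialLinearGroup.

Section Transport.
Variables (K : numFieldType) (m n : nat) (X : superalgebra K).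
Variable eta : forall D : superalgebra K, smor X D -> 'M[D]_(m + n).
Hypothesis eta_inj : forall D, injective (@eta D).
Hypothesis eta_range : forall D, range (@eta D) = @SL K D m n.
Hypothesis eta_nat : forall (D D' : superalgebra K) (f : smor D D') (u : smor X D),
  eta (smor_comp f u) = map_mx f (eta u).

Lemma eta_onto (D : superalgebra K) (g : 'M[D]_(m + n)) : SL g -> exists u, eta u = g.
Proof. by rewrite -eta_range => -[u _ <-]; exists u. Qed.

Lemma eta_SL (D : superalgebra K) (u : smor X D) : SL (eta u).
Proof. by rewrite -eta_range; exists u. Qed.

(** Products of matrices are pulled back through the bijections [eta]; the group axioms and
    functoriality are inherited by injectivity. *)
Lemma transported_law : exists mu : forall D : superalgebra K, smor X D -> smor X D -> smor X D,
  supergroup_law mu /\ represents_SL m n mu.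
Proof.
have ex D (u v : smor X D) : exists w, eta w = eta u *m eta v.
  by apply: eta_onto; apply: SL_mul; exact: eta_SL.
pose mu D u v : smor X D := sval (cid (ex D u v)).
have muE D (u v : smor X D) : eta (mu D u v) = eta u *m eta v := svalP (cid (ex D u v)).
exists mu; split; last by exists eta; split.
split=> [D|D D' f u v]; last first.
  by apply: eta_inj; rewrite eta_nat !muE !eta_nat map_mxM.
split=> [u v w|]; first by apply: eta_inj; rewrite !muE mulmxA.
have [e eE] := eta_onto (@SL_1 K D m n).
have exi (u : smor X D) : exists w, mx_inverse (eta u) (eta w).
  by have [g' /eta_onto[w <-] h] := SL_inverse (eta_SL u); exists w.
exists e, (fun u => sval (cid (exi u))); split=> u; apply: eta_inj; rewrite muE ?eE ?mul1mx ?mulmx1 //.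
  by have [_ ->] := svalP (cid (exi u)).
by have [-> _] := svalP (cid (exi u)).
Qed.

End Transport.

Section HypersurfaceSupergroup.
Variables (R : realType) (m n a b : nat) (h : mpoly.mpoly a R[i]).
Hypothesis hslope : forall w, mpeval h w = 1 -> exists (j : 'I_a) (A : mpoly.mpoly a R[i]),
  mpeval A w != 0 /\ forall x t, mpeval h (x + t *: delta_mx 0 j) = mpeval h x + t * mpeval A x.

Lemma hyp_complex_supermanifold : is_complex_supermanifold (hyp_sa h b).
Proof.
exists a, b, (hyp_pres h b); split; first exact: hyp_pres_surj.
by apply: (analytic_complex_supermanifold (h := h)) => // f; exact: hyp_pres_ker.
Qed.

Variable eta : forall D : superalgebra R[i], smor (hyp_sa h b) D -> 'M[D]_(m + n).
Hypothesis eta_inj : forall D, injective (@eta D).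
Hypothesis eta_range : forall D, range (@eta D) = @SL R[i] D m n.
Hypothesis eta_nat : forall (D D' : superalgebra R[i]) (f : smor D D') (u : smor (hyp_sa h b) D),
  eta (smor_comp f u) = map_mx f (eta u).

Lemma hyp_represents : exists (X : superalgebra R[i])
    (mu : forall D : superalgebra R[i], smor X D -> smor X D -> smor X D),
  [/\ affine_algebraic_supergroup mu, represents_SL m n mu & is_complex_supermanifold X].
Proof.
have [mu [mul mur]] := transported_law eta_inj eta_range eta_nat.
exists (hyp_sa h b), mu; split=> //; last exact: hyp_complex_supermanifold.
by split=> //; exact: hyp_affine_supervariety.
Qed.

End HypersurfaceSupergroup.

(** * The defining polynomial: affine in each entry, homogeneous in a row *)

Section DeterminantEntries.
Variables (K : comPzRingType) (k : nat).

Lemma det_add_entry (M : 'M[K]_k) i0 j0 t :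
  \det (M + t *: delta_mx i0 j0) = \det M + t * cofactor M i0 j0.
Proof.
have cof j : cofactor (M + t *: delta_mx i0 j0) i0 j = cofactor M i0 j.
  rewrite /cofactor; congr (_ * \det _); apply/matrixP => i l; rewrite !mxE.
  by rewrite eq_sym (negPf (neq_lift i0 i)) mulr0 addr0.
rewrite !(expand_det_row _ i0); under eq_bigr => j _ do rewrite cof !mxE eqxx mulrDl.
rewrite big_split /=; congr (_ + _).
rewrite (bigD1 j0) //= eqxx mulr1 big1 ?addr0 // => j /negPf ->.
by rewrite mulr0 mul0r.
Qed.

(** [None] stands for no scaling, so that one lemma treats both determinants of [ber_poly], of which
    a single row is scaled. *)
Definition row_scale (z : option 'I_k) (u : K) : K := if z is Some _ then u else 1.

Lemma det_row_scale (M : 'M[K]_k) (z : option 'I_k) u :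
  \det (\matrix_(i, j) (if Some i == z then u * M i j else M i j)) = row_scale z u * \det M.
Proof.
pose d : 'rV[K]_k := \row_i (if Some i == z then u else 1).
have -> : \matrix_(i, j) (if Some i == z then u * M i j else M i j) = diag_mx d *m M.
  by rewrite mul_diag_mx; apply/matrixP => i j; rewrite !mxE; case: ifP => //; rewrite mul1r.
rewrite det_mulmx det_diag; congr (_ * _); case: z @d => [i0|] d /=.
  rewrite (bigD1 i0) //= mxE eqxx big1 ?mulr1 // => i /negPf ii0.
  by rewrite mxE; case: eqP => // -[e]; rewrite e eqxx in ii0.
by rewrite big1 // => i _; rewrite mxE.
Qed.

End DeterminantEntries.

Section SpecialLinearCoordinates.
Variables (K : numFieldType) (m n : nat).
Local Notation a := (m * m + n * n)%N.
Local Notation b := (m * n + n * m)%N.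
Local Notation P := (mpoly.mpoly a K).
Local Notation X i := (mpoly.mpolyX K (mpoly.mnm1 i) : P).

(** The indices refer to the factorisation, not to the blocks of the matrix: [ul] to the Schur
    complement p, [dr] to t = s^-1, [ur] and [dl] to the odd x and y. *)
Definition ul_index (i j : 'I_m) : 'I_a := lshift _ (mxvec_index i j).
Definition dr_index (i j : 'I_n) : 'I_a := rshift _ (mxvec_index i j).
Definition ur_index (i : 'I_m) (j : 'I_n) : 'I_b := lshift _ (mxvec_index i j).
Definition dl_index (i : 'I_n) (j : 'I_m) : 'I_b := rshift _ (mxvec_index i j).

Definition ul_generic : 'M[P]_m := \matrix_(i, j) X (ul_index i j).
Definition dr_generic : 'M[P]_n := \matrix_(i, j) X (dr_index i j).
Definition ber_poly : P := \det ul_generic * \det dr_generic.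

Lemma morph_ber_poly (E : pzRingType) (F : {rmorphism P -> E}) : F ber_poly =
  \det (\matrix_(i, j) F (X (ul_index i j))) * \det (\matrix_(i, j) F (X (dr_index i j))).
Proof.
rewrite rmorphM -!(det_map_mx F); congr (_ * _); congr (determinant _); apply/matrixP => i j; by rewrite !mxE.
Qed.

Definition ul_point (x : 'rV[K]_a) : 'M[K]_m := \matrix_(i, j) x 0 (ul_index i j).
Definition dr_point (x : 'rV[K]_a) : 'M[K]_n := \matrix_(i, j) x 0 (dr_index i j).

Lemma mpeval_X (x : 'rV[K]_a) i : mpeval (X i) x = x 0 i.
Proof. exact: mpoly.mevalXU. Qed.

Lemma mpeval_det k (M : 'M[P]_k) x : mpeval (\det M) x = \det (map_mx (fun p => mpeval p x) M).
Proof. by rewrite /mpeval -det_map_mx. Qed.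

Lemma mpeval_ul x : map_mx (fun p => mpeval p x) ul_generic = ul_point x.
Proof. by apply/matrixP => i j; rewrite !mxE mpeval_X. Qed.

Lemma mpeval_dr x : map_mx (fun p => mpeval p x) dr_generic = dr_point x.
Proof. by apply/matrixP => i j; rewrite !mxE mpeval_X. Qed.

Lemma mpeval_ber_poly x : mpeval ber_poly x = \det (ul_point x) * \det (dr_point x).
Proof. by rewrite mpevalM !mpeval_det mpeval_ul mpeval_dr. Qed.

Lemma mpeval_cofactor k (M : 'M[P]_k) i j x :
  mpeval (cofactor M i j) x = cofactor (map_mx (fun p => mpeval p x) M) i j.
Proof.
rewrite /cofactor mpevalM mpeval_det; congr (_ * _).
  by rewrite /mpeval rmorphXn rmorphN1.
by congr (determinant _); apply/matrixP => ? ?; rewrite !mxE.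
Qed.

Definition vec_row k l (e : 'I_(k * l)) : 'I_k :=
  (enum_val (cast_ord (esym (mxvec_cast k l)) e)).1.

Lemma vec_rowE k l (i : 'I_k) (j : 'I_l) : vec_row (mxvec_index i j) = i.
Proof. by rewrite /vec_row /mxvec_index cast_ordK enum_rankK. Qed.

Definition scaled_coord (z : option 'I_m) (z' : option 'I_n) : pred 'I_a := fun k =>
  match fintype.split k with
  | inl e => Some (vec_row e) == z
  | inr e => Some (vec_row e) == z'
  end.

Lemma ber_poly_scale z z' (x : 'rV[K]_a) (u : K) :
  mpeval ber_poly (\row_i (if scaled_coord z z' i then u * x 0 i else x 0 i)) =
  row_scale z u * row_scale z' u * mpeval ber_poly x.
Proof.
rewrite !mpeval_ber_poly mulrACA -!det_row_scale; congr (_ * _);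
  congr (determinant _); apply/matrixP => i j; rewrite !mxE /scaled_coord /ul_index /dr_index.
  by rewrite (unsplitK (inl _ : _ + _)) vec_rowE.
by rewrite (unsplitK (inr _ : _ + _)) vec_rowE.
Qed.

Lemma ul_point_add x t i0 j0 :
  ul_point (x + t *: delta_mx 0 (ul_index i0 j0)) = ul_point x + t *: delta_mx i0 j0.
Proof.
apply/matrixP => i j; rewrite !mxE eqxx /=; congr (_ + t * _%:R).
rewrite /ul_index; congr nat_of_bool; rewrite (inj_eq (@lshift_inj _ _)) /mxvec_index.
by rewrite (inj_eq (@cast_ord_inj _ _ _)) (inj_eq enum_rank_inj) xpair_eqE.
Qed.

Lemma dr_point_add x t i0 j0 :
  dr_point (x + t *: delta_mx 0 (dr_index i0 j0)) = dr_point x + t *: delta_mx i0 j0.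
Proof.
apply/matrixP => i j; rewrite !mxE eqxx /=; congr (_ + t * _%:R).
rewrite /dr_index; congr nat_of_bool; rewrite (inj_eq (@rshift_inj _ _)) /mxvec_index.
by rewrite (inj_eq (@cast_ord_inj _ _ _)) (inj_eq enum_rank_inj) xpair_eqE.
Qed.

Lemma dr_point_add_ul x t i0 j0 : dr_point (x + t *: delta_mx 0 (ul_index i0 j0)) = dr_point x.
Proof.
apply/matrixP => i j; rewrite !mxE eqxx /= /dr_index /ul_index.
by rewrite eq_rlshift mulr0 addr0.
Qed.

Lemma ul_point_add_dr x t i0 j0 : ul_point (x + t *: delta_mx 0 (dr_index i0 j0)) = ul_point x.
Proof.
apply/matrixP => i j; rewrite !mxE eqxx /= /dr_index /ul_index.
by rewrite eq_lrshift mulr0 addr0.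
Qed.

Lemma cofactor_neq0 k (M : 'M[K]_k) i : \det M != 0 -> exists j, cofactor M i j != 0.
Proof.
move=> M0; apply/existsP; apply: contraNT M0; rewrite negb_exists => /forallP c0.
by rewrite (expand_det_row _ i) big1 // => j _; move: (c0 j); rewrite negbK => /eqP ->; rewrite mulr0.
Qed.

Lemma ber_poly_slope w : (0 < m + n)%N -> mpeval ber_poly w = 1 ->
  exists (j : 'I_a) (A : P), mpeval A w != 0 /\
    forall x t, mpeval ber_poly (x + t *: delta_mx 0 j) = mpeval ber_poly x + t * mpeval A x.
Proof.
move=> mn0; rewrite mpeval_ber_poly => hw.
have : \det (ul_point w) * \det (dr_point w) != 0 by rewrite hw oner_neq0.
rewrite mulf_eq0 negb_or => /andP[ul0 dr0].
have [m0|] := ltnP 0 m.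
  have [j cj] := cofactor_neq0 (Ordinal m0) ul0.
  exists (ul_index (Ordinal m0) j), (cofactor ul_generic (Ordinal m0) j * \det dr_generic).
  split=> [|x t]; first by rewrite mpevalM mpeval_cofactor mpeval_det mpeval_ul mpeval_dr mulf_neq0.
  rewrite !mpeval_ber_poly ul_point_add dr_point_add_ul det_add_entry mulrDl.
  by rewrite mpevalM mpeval_cofactor mpeval_det mpeval_ul mpeval_dr mulrA.
rewrite leqn0 => /eqP m0; have n0 : (0 < n)%N by rewrite m0 in mn0.
have [j cj] := cofactor_neq0 (Ordinal n0) dr0.
exists (dr_index (Ordinal n0) j), (\det ul_generic * cofactor dr_generic (Ordinal n0) j).
split=> [|x t]; first by rewrite mpevalM mpeval_cofactor mpeval_det mpeval_ul mpeval_dr mulf_neq0.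
rewrite !mpeval_ber_poly ul_point_add_dr dr_point_add det_add_entry mulrDr.
by rewrite mpevalM mpeval_cofactor mpeval_det mpeval_ul mpeval_dr mulrCA.
Qed.

Lemma ber_poly_retract : (0 < m + n)%N -> exists J : pred 'I_a, forall (x : 'rV[K]_a) (u : K),
  mpeval ber_poly (\row_i (if J i then u * x 0 i else x 0 i)) = u * mpeval ber_poly x.
Proof.
move=> mn0; have [m0|] := ltnP 0 m.
  exists (scaled_coord (Some (Ordinal m0)) None) => x u.
  by rewrite ber_poly_scale /= mulr1.
rewrite leqn0 => /eqP m0; have n0 : (0 < n)%N by rewrite m0 in mn0.
exists (scaled_coord None (Some (Ordinal n0))) => x u.
by rewrite ber_poly_scale /= mul1r.
Qed.

End SpecialLinearCoordinates.

Section MatrixLemmas.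
Variables (K : numFieldType) (D : superalgebra K) (m n : nat).

Lemma udl_inj (x1 x2 : 'M[D]_(m, n)) p1 p2 s1 s2 t1 t2 (y1 y2 : 'M[D]_(n, m)) :
  mx_inverse s1 t1 -> mx_inverse s2 t2 -> udl x1 p1 s1 y1 = udl x2 p2 s2 y2 ->
  [/\ x1 = x2, p1 = p2, t1 = t2 & y1 = y2].
Proof.
move=> h1 h2; rewrite !udlE => /eq_block_mx[ep ex ey es]; subst s2.
have et := mx_inverse_uniq h1 h2; subst t2; have [st ts] := h1.
have ex12 : x1 = x2 by rewrite -[x1]mulmx1 -[x2]mulmx1 -st !mulmxA ex.
have ey12 : y1 = y2 by rewrite -[y1]mul1mx -[y2]mul1mx -ts -!mulmxA ey.
by split=> //; move: ep; rewrite ex12 ey12 => /addIr.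
Qed.

Lemma mx_part_vec (p : bool) k l (M : 'M[D]_(k, l)) e : mx_part p M -> spart D p (mxvec M 0 e).
Proof. by move=> hM; case/mxvec_indexP: e => i j; rewrite mxvecE. Qed.

End MatrixLemmas.

Lemma map_udl (K : numFieldType) (D D' : superalgebra K) (f : smor D D') m n
    (x : 'M[D]_(m, n)) p s (y : 'M[D]_(n, m)) :
  map_mx f (udl x p s y) = udl (map_mx f x) (map_mx f p) (map_mx f s) (map_mx f y).
Proof. by rewrite !udlE map_block_mx map_mxD !map_mxM. Qed.

Lemma mx_inverse_map (K : numFieldType) (D D' : superalgebra K) (f : smor D D') k
    (s t : 'M[D]_k) : mx_inverse s t -> mx_inverse (map_mx f s) (map_mx f t).
Proof. by move=> [st ts]; split; rewrite -map_mxM ?st ?ts map_mx1. Qed.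

(** * From morphisms to matrices: the universal point *)

Section UniversalPoint.
Variables (K : numFieldType) (m n : nat).
Local Notation a := (m * m + n * n)%N.
Local Notation b := (m * n + n * m)%N.
Local Notation P := (mpoly.mpoly a K).
Local Notation X i := (mpoly.mpolyX K (mpoly.mnm1 i) : P).
Local Notation h := (ber_poly K m n).
Local Notation A := (hyp_sa h b).

Lemma hyp_coord_h : hyp_coord h b h = 1.
Proof.
rewrite /hyp_coord; congr gconst; apply: pfun_ext => z.
exact: set_valP z.
Qed.

Section Point.
Variables (D : superalgebra K) (u : smor A D).

Definition point_ul : 'M[D]_m := \matrix_(i, j) u (hyp_coord h b (X (ul_index n i j))).
Definition point_dr : 'M[D]_n := \matrix_(i, j) u (hyp_coord h b (X (dr_index m i j))).
Definition point_ur : 'M[D]_(m, n) := \matrix_(i, j) u (hyp_odd h (ur_index i j)).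
Definition point_dl : 'M[D]_(n, m) := \matrix_(i, j) u (hyp_odd h (dl_index i j)).

Definition matrix_point : 'M[D]_(m + n) :=
  udl point_ur point_ul (mx_inv point_dr) point_dl.

Lemma point_ul_even : mx_part false point_ul.
Proof. by move=> i j; rewrite mxE; apply: smor_part; exact: gpart_const. Qed.
Lemma point_dr_even : mx_part false point_dr.
Proof. by move=> i j; rewrite mxE; apply: smor_part; exact: gpart_const. Qed.
Lemma point_ur_odd : mx_part true point_ur.
Proof. by move=> i j; rewrite mxE; apply: smor_part; exact: gpart_gxi. Qed.
Lemma point_dl_odd : mx_part true point_dl.
Proof. by move=> i j; rewrite mxE; apply: smor_part; exact: gpart_gxi. Qed.

Lemma point_det : \det point_ul * \det point_dr = 1.
Proof.
pose c0 : {rmorphism P -> grassmann b (pfun h)} := @gconst b (pfun h) \o pfun_of_rmorphism h.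
pose u' : {rmorphism P -> D} := u \o c0.
have <- : u' h = 1 by rewrite -[LHS]/(u (hyp_coord h b h)) hyp_coord_h rmorph1.
exact: esym (morph_ber_poly u').
Qed.

Lemma point_ul_invertible : exists t, mx_inverse point_ul t.
Proof.
have [t _ h] := even_det_invertible point_ul_even (det_even point_dr_even) point_det.
by exists t.
Qed.

Lemma point_dr_inverse : mx_inverse (mx_inv point_dr) point_dr.
Proof.
have e := point_det; rewrite (even_central _ (det_even point_ul_even)) in e.
have [t _ ht] := even_det_invertible point_dr_even (det_even point_ul_even) e.
by rewrite (mx_invE ht); exact: mx_inverse_sym.
Qed.

Lemma matrix_point_SL : SL matrix_point.
Proof.
apply/SLP; have [t ht] := point_ul_invertible.
exists point_ur, point_ul, t, (mx_inv point_dr), point_dr, point_dl; split=> //.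
- exact: point_ur_odd.
- exact: point_dl_odd.
- split; first exact: point_ul_even.
  exact: (mx_inverse_even point_dr_even (mx_inverse_sym point_dr_inverse)).
- by split=> //; exact: point_dr_inverse.
- by rewrite point_det.
Qed.

End Point.

Lemma matrix_point_inj (D : superalgebra K) : injective (@matrix_point D).
Proof.
move=> u v /(udl_inj (point_dr_inverse u) (point_dr_inverse v))[ex ep es ey].
apply: hyp_mor_ext => i.
  case: (fintype.splitP i) => e ei.
    have -> : i = lshift _ e by exact: val_inj.
    by case/mxvec_indexP: e {ei} => k l; have := congr1 (fun M => fun_of_matrix M k l) ep; rewrite !mxE.
  have -> : i = rshift _ e by exact: val_inj.
  by case/mxvec_indexP: e {ei} => k l; have := congr1 (fun M => fun_of_matrix M k l) es; rewrite !mxE.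
case: (fintype.splitP i) => e ei.
  have -> : i = lshift _ e by exact: val_inj.
  by case/mxvec_indexP: e {ei} => k l; have := congr1 (fun M => fun_of_matrix M k l) ex; rewrite !mxE.
have -> : i = rshift _ e by exact: val_inj.
by case/mxvec_indexP: e {ei} => k l; have := congr1 (fun M => fun_of_matrix M k l) ey; rewrite !mxE.
Qed.

Lemma matrix_point_nat (D D' : superalgebra K) (f : smor D D') (u : smor A D) :
  matrix_point (smor_comp f u) = map_mx f (matrix_point u).
Proof.
have e k l (F : 'I_k -> 'I_l -> A) :
  \matrix_(i, j) (smor_comp f u) (F i j) = map_mx f (\matrix_(i, j) u (F i j)).
  by apply/matrixP => i j; rewrite !mxE.
rewrite /matrix_point map_udl /point_ur /point_ul /point_dr /point_dl !e; congr udl.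
by apply: mx_invE; apply: mx_inverse_map; apply: mx_inverse_sym; exact: point_dr_inverse.
Qed.

(** The factors p, s^-1, x, y of [g] prescribe the images of the generators, and Ber g = 1 is the
    relation [F h = 1]. A row to scale exists because m + n > 0. *)
Lemma matrix_point_onto (D : superalgebra K) (g : 'M[D]_(m + n)) : (0 < m + n)%N ->
  SL g -> exists u, matrix_point u = g.
Proof.
move=> mn0 /SLP[x [p [p' [s [s' [y [hx hy [hp hs] [hpp hss] [-> d1]]]]]]]].
have [J hJ] := ber_poly_retract K mn0.
have [p1 ep] := mx_part_lift hp; have [s1 es] := mx_part_lift (mx_inverse_even hs hss).
have [F [FC FX]] := mpoly_morphism_exists (even_scal_rmorphism D) (fun i => row_mx (mxvec p1) (mxvec s1) 0 i).
have Fh : F h = 1.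
  rewrite morph_ber_poly; apply: val_inj; rewrite -[RHS]/(1 : D) d1 ep es !det_map_mx -rmorphM.
  congr (even_val D (_ * _)); congr (determinant _); apply/matrixP => i j; rewrite mxE FX.
    by rewrite row_mxEl mxvecE.
  by rewrite row_mxEr mxvecE.
pose xi i := row_mx (mxvec x) (mxvec y) 0 i.
have xio i : spart D true (xi i).
  by rewrite /xi mxE; case: (fintype.split i) => e; exact: mx_part_vec.
have [u [uF uxi]] := hyp_mor_exists hJ FC Fh xio.
exists u; have eul : point_ul u = p.
  by rewrite ep; apply/matrixP => i j; rewrite !mxE uF FX row_mxEl mxvecE.
have edr : point_dr u = s'.
  by rewrite es; apply/matrixP => i j; rewrite !mxE uF FX row_mxEr mxvecE.
have eur : point_ur u = x.
  by apply/matrixP => i j; rewrite !mxE uxi /xi row_mxEl mxvecE.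
have edl : point_dl u = y.
  by apply/matrixP => i j; rewrite !mxE uxi /xi row_mxEr mxvecE.
rewrite /matrix_point eul edr eur edl; congr udl.
by apply: mx_invE; exact: mx_inverse_sym.
Qed.

End UniversalPoint.

Lemma SL_representable (R : realType) (m n : nat) : (0 < m + n)%N ->
  exists (X : superalgebra R[i])
    (mu : forall D : superalgebra R[i], smor X D -> smor X D -> smor X D),
  [/\ affine_algebraic_supergroup mu, represents_SL m n mu & is_complex_supermanifold X].
Proof.
move=> mn0; apply: (@hyp_represents R m n _ _ (ber_poly _ m n) _ (@matrix_point _ m n)).
- by move=> w; exact: ber_poly_slope.
- exact: matrix_point_inj.
- move=> D; apply/seteqP; split=> [_ [u _ <-]|g sg]; first exact: matrix_point_SL.
  by have [u <-] := matrix_point_onto mn0 sg; exists u.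
- exact: matrix_point_nat.
Qed.

(* The coordinate ring of a point is presented as K[t] / (t - 1). *)
Lemma SL00_representable (R : realType) :
  exists (X : superalgebra R[i])
    (mu : forall D : superalgebra R[i], smor X D -> smor X D -> smor X D),
  [/\ affine_algebraic_supergroup mu, represents_SL 0 0 mu & is_complex_supermanifold X].
Proof.
pose K : numFieldType := R[i].
pose h : mpoly.mpoly 1 K := mpoly.mpolyX K (mpoly.mnm1 0).
pose eta (D : superalgebra K) (u : smor (hyp_sa h 0) D) : 'M[D]_(0 + 0) := 1%:M.
have hX x : mpeval h x = x 0 0 by exact: mpoly.mevalXU.
have mx0 (D : superalgebra K) (g g' : 'M[D]_(0 + 0)) : g = g' by apply/matrixP => -[].
have hh D (u : smor (hyp_sa h 0) D) : u (hyp_coord h 0 h) = 1.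
  rewrite -[RHS](rmorph1 u); congr (u _); rewrite /hyp_coord; congr gconst.
  by apply: pfun_ext => z; exact: set_valP z.
apply: (@hyp_represents R 0 0 _ _ h _ eta).
- move=> w hw; exists 0, 1; split=> [|x t]; first by rewrite mpeval1 oner_neq0.
  by rewrite !hX mpeval1 !mxE.
- move=> D u v _; apply: hyp_mor_ext => [i|[]//].
  by rewrite !ord1 -/h !hh.
- move=> D; apply/seteqP; split=> [_ [u _ <-]|g _].
    exact: SL_1.
  pose F0 := mpoly_morphism_exists (even_scal_rmorphism D) (fun _ : 'I_1 => 1).
  have [F [FC FX]] := F0.
  have hJ (x : 'rV[K]_1) (u : K) :
    mpeval h (\row_i (if xpredT i then u * x 0 i else x 0 i)) = u * mpeval h x.
    by rewrite !hX mxE.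
  have nxi (i : 'I_0) : spart D true ((fun _ => 0) i) by case: i.
  have [u _] := @hyp_mor_exists _ _ h 0 D xpredT hJ F _ FC (FX 0) nxi.
  by exists u.
- by move=> D D' f u; exact: mx0.
Qed.

Theorem mainTheorem4 (R : realType) (m n : nat) :
  exists (X : superalgebra R[i])
    (mu : forall D : superalgebra R[i], smor X D -> smor X D -> smor X D),
    [/\ affine_algebraic_supergroup mu,
        represents_SL m n mu &
        is_complex_supermanifold X].
Proof.
(* For m = n = 0 the polynomial [ber_poly] is the constant 1 in no variables, which has neither a
   slope nor a scaling; another presentation of the point is used. *)
have [mn0|] := ltnP 0 (m + n)%N; first exact: SL_representable.
rewrite leqn0 addn_eq0 => /andP[/eqP -> /eqP ->]; exact: SL00_representable.
Qed.
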